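(* Let $\vec\Lambda\in\mathbb C^n[2\mathfrak m]$ and let $x\in\mathbb C$ (not a pole of $\mathcal F$). Then for $j=1,\dots,n$ $$\mathbb K_j\ \mathcal F(\lambda,x;\vec\Lambda)=\mathcal F(\lambda,x;\vec\Lambda)\ \mathcal K_j(x),$$ where $\mathcal F(\lambda,x;\vec\Lambda)$ is regarded as the operator sending $v_{\vec\Lambda}^{(\vec m')}$ ($\vec m'\in\mathcal Z^n[\mathfrak m]$) to the $M_{\vec\Lambda}[0]$-valued function of $\lambda$ $\ \mathcal F^{\vec m'}(\lambda,x;\vec\Lambda)=\sum_{\vec m\in\mathcal Z^n[\mathfrak m]}\mathcal F_{\vec m}^{\vec m'}(\lambda,x;\vec\Lambda)v_{\vec\Lambda}^{(\vec m)}$.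
   Context: Fix $\eta\in\mathbb C$ with $\operatorname{Im}\eta>0$; $q^x=e^{\pi i\eta x}$, $[x]=\frac{q^x-q^{-x}}{q-q^{-1}}$, $[x]_k=[x][x+1]\cdots[x+k-1]$, $[k]!=[1]\cdots[k]$. Fix integers $\mathfrak m\ge0$, $n\ge1$. $\mathcal Z^n=(\mathbb Z_{\ge0})^n$, $\mathcal Z^n[\mathfrak m]=\{\vec m\in\mathcal Z^n:\sum m_i=\mathfrak m\}$, $\mathbb C^n[2\mathfrak m]=\{\vec\Lambda\in\mathbb C^n:\sum\Lambda_i=2\mathfrak m\}$. $\mathcal U_q(\mathfrak{sl}_2)$ is the unital algebra generated by $\mathbf E,\mathbf F,q^{x\mathbf h}$ ($x\in\mathbb C$) with $q^{x\mathbf h}q^{y\mathbf h}=q^{(x+y)\mathbf h}$, $q^{x\mathbf h}\mathbf E=q^{2x}\mathbf Eq^{x\mathbf h}$, $q^{x\mathbf h}\mathbf F=q^{-2x}\mathbf Fq^{x\mathbf h}$, $\mathbf{EF}-\mathbf{FE}=\frac{q^{\mathbf h}-q^{-\mathbf h}}{q-q^{-1}}$, and comultiplication $\Delta\mathbf E=\mathbf E\otimes1+q^{\mathbf h}\otimes\mathbf E$, $\Delta\mathbf F=\mathbf F\otimes q^{-\mathbf h}+1\otimes\mathbf F$, $\Delta q^{x\mathbf h}=q^{x\mathbf h}\otimes q^{x\mathbf h}$. $M_\lambda$ is the Verma module with highest weight vector $v_\lambda$ of weight $\lambda$ and basis $v_\lambda^{(k)}=\mathbf F^kv_\lambda/[k]!$;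 for $\Lambda\in\mathbb Z_{\ge0}$, $L_\Lambda$ is its irreducible quotient with basis the images of $v_\Lambda^{(0)},\dots,v_\Lambda^{(\Lambda)}$. $M_\Lambda^\star$ has basis $\{u_m^\Lambda\}_{m\ge0}$ with $\mathbf Eu_m^\Lambda=[m]u_{m-1}^\Lambda$, $q^{x\mathbf h}u_m^\Lambda=q^{(\Lambda-2m)x}u_m^\Lambda$, $\mathbf Fu_m^\Lambda=[\Lambda-m]u_{m+1}^\Lambda$. $M_{\vec\Lambda}=M_{\Lambda_1}\otimes\dots\otimes M_{\Lambda_n}$, $v_{\vec\Lambda}^{(\vec m)}=v_{\Lambda_1}^{(m_1)}\otimes\dots\otimes v_{\Lambda_n}^{(m_n)}$, $u_{\vec m}^{\vec\Lambda}=u_{m_1}^{\Lambda_1}\otimes\dots\otimes u_{m_n}^{\Lambda_n}$; $M_{\vec\Lambda}[0]$ (zero weight space) has basis $\{v_{\vec\Lambda}^{(\vec m)}\}_{\vec m\in\mathcal Z^n[\mathfrak m]}$. Trace matrix: $\Phi_m^\Lambda(\lambda):M_{\lambda-1}\to M_{\lambda-\Lambda+2m-1}\otimes M_\Lambda^\star$ is the module map determined by $\Phi_m^\Lambda(\lambda)v_{\lambda-1}=\sum_{i=0}^mq^{i(\lambda-\Lambda+2m-i)}[-\lambda+\Lambda-2m+i+1]_{m-i}\,v^{(i)}_{\lambda-\Lambda+2m-1}\otimes\mathbf E^iu_m^\Lambda$; $\Phi_{\vec m}^{\vec\Lambda}(\lambda)=\big(\Phi_{m_1}^{\Lambda_1}(\lambda-\sum_{i=2}^n(\Lambda_i-2m_i))\otimes1^{n-1}\big)\cdots\big(\Phi_{m_{n-1}}^{\Lambda_{n-1}}(\lambda-\Lambda_n+2m_n)\otimes1\big)\Phi_{m_n}^{\Lambda_n}(\lambda)$;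 and $$q^{-\mathfrak m(\mathfrak m+1)/2}(q-q^{-1})^{\mathfrak m}(q^x-q^{-x})\operatorname{Tr}\big|_{M_{\lambda-1}}\big(\Phi_{\vec m}^{\vec\Lambda}(\lambda)q^{x\mathbf h}\big)=\sum_{\vec m'\in\mathcal Z^n[\mathfrak m]}\mathcal F_{\vec m}^{\vec m'}(\lambda,x;\vec\Lambda)\,u_{\vec m'}^{\vec\Lambda},$$ the trace being convergent for $|q^{2x}|\gg1$ and continued meromorphically in $x$. Quantum $R$-matrix: $\mathcal R_{\Lambda_1,\Lambda_2}=q^{-\Lambda_1\Lambda_2/2}\Big(\sum_{k\ge0}q^{k(k-1)/2}\frac{(q-q^{-1})^k}{[k]!}\mathbf E^k\otimes\mathbf F^k\Big)q^{\frac{\mathbf h\otimes\mathbf h}2}\Big|_{M_{\Lambda_1}\otimes M_{\Lambda_2}}$, where $q^{\mathbf h\otimes\mathbf h/2}$ multiplies a tensor of weights $(a,b)$ by $q^{ab/2}$. Dynamical $R$-matrix: the family $\mathbb R_{\Lambda_1,\Lambda_2}(\lambda)\in\operatorname{End}(M_{\Lambda_1}\otimes M_{\Lambda_2})$, meromorphic in $\lambda$, with matrix elements $\mathbb R_{\Lambda_1,\Lambda_2}(\lambda)(v^{(m_1)}\otimes v^{(m_2)})=\sum_{n_1,n_2}(\mathbb R_{\Lambda_1,\Lambda_2}(\lambda))^{m_1,m_2}_{n_1,n_2}v^{(n_1)}\otimes v^{(n_2)}$ (an asymptotic limit of the elliptic dynamical $R$-matrix of $E_{\tau,\eta}(\mathfrak{sl}_2)$),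 uniquely determined by: (i) matrix elements vanish unless $m_1+m_2=n_1+n_2$; (ii) they are rational functions of $q^{\Lambda_1},q^{\Lambda_2},q^{2\lambda}$; (iii) they vanish if $\Lambda_i\in\{n_i,\dots,m_i-1\}$ for $i=1$ or $2$ (so for $\Lambda_1,\Lambda_2\in\mathbb Z_{\ge0}$ the operator descends to $L_{\Lambda_1}\otimes L_{\Lambda_2}$); (iv) with $\gamma_{\Lambda',\Lambda''}:M_{\Lambda'+\Lambda''}\to M_{\Lambda'}\otimes M_{\Lambda''}$, $v^{(m)}\mapsto\sum_{m'+m''=m}v^{(m')}\otimes v^{(m'')}$: $\gamma_{\Lambda_1,\Lambda_2}\mathbb R_{\Lambda_1+\Lambda_2,\Lambda_3}(\lambda)=\mathbb R_{\Lambda_2,\Lambda_3}(\lambda)\mathbb R_{\Lambda_1,\Lambda_3}(\lambda-\mathbf h^{(2)})\gamma_{\Lambda_1,\Lambda_2}$ and $\gamma_{\Lambda_2,\Lambda_3}\mathbb R_{\Lambda_1,\Lambda_2+\Lambda_3}(\lambda)=\mathbb R_{\Lambda_1,\Lambda_2}(\lambda-\mathbf h^{(3)})\mathbb R_{\Lambda_1,\Lambda_3}(\lambda)\gamma_{\Lambda_2,\Lambda_3}$; (v) on $L_1\otimes L_1$: $v^{(0)}\otimes v^{(0)}$, $v^{(1)}\otimes v^{(1)}$ are fixed, $v^{(0)}\otimes v^{(1)}\mapsto\frac{q^{-1}[\lambda+1]}{[\lambda]}v^{(0)}\otimes v^{(1)}+\frac{q^{\lambda-1}}{[\lambda]}v^{(1)}\otimes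 v^{(0)}$, $v^{(1)}\otimes v^{(0)}\mapsto-\frac{q^{-\lambda-1}}{[\lambda]}v^{(0)}\otimes v^{(1)}+\frac{q^{-1}[\lambda-1]}{[\lambda]}v^{(1)}\otimes v^{(0)}$. Notation: in a tensor product, $\mathbb R_{\Lambda_a,\Lambda_b}$ and $\mathcal R_{\Lambda_a,\Lambda_b}$ act in the tensor factors labelled $a$ (as first factor) and $b$ (as second factor); $\mathbf h^{(k)}$ is replaced by the weight in the $k$-th tensor factor and $\mathbf h^{(i,\dots,k)}=\mathbf h^{(i)}+\dots+\mathbf h^{(k)}$. qKZB operators on $M_{\vec\Lambda}[0]$-valued functions: with $\Gamma_j\big(\xi(\lambda)v_{\vec\Lambda}^{(\vec m)}\big)=\xi(\lambda-\Lambda_j+2m_j)v_{\vec\Lambda}^{(\vec m)}$, $$\mathbb K_j=\mathbb R_{\Lambda_{j+1},\Lambda_j}(\lambda-\mathbf h^{(j+2,\dots,n)})^{-1}\cdots\mathbb R_{\Lambda_n,\Lambda_j}(\lambda)^{-1}\ \Gamma_j\ \mathbb R_{\Lambda_j,\Lambda_1}(\lambda-\mathbf h^{(2,\dots,j-1)}-\mathbf h^{(j+1,\dots,n)})\cdots\mathbb R_{\Lambda_j,\Lambda_{j-1}}(\lambda-\mathbf h^{(j+1,\dots,n)}).$$ qKZ operators on $M_{\vec\Lambda}[0]$: with $(q^{-x\mathbf h})_jv_{\vec\Lambda}^{(\vec m)}=q^{-(\Lambda_j-2m_j)x}v_{\vec\Lambda}^{(\vec m)}$, $$\mathcal K_j(x)=\mathcal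 R_{\Lambda_{j+1},\Lambda_j}^{-1}\cdots\mathcal R_{\Lambda_n,\Lambda_j}^{-1}\ (q^{-x\mathbf h})_j\ \mathcal R_{\Lambda_j,\Lambda_1}\cdots\mathcal R_{\Lambda_j,\Lambda_{j-1}} .$$ *)

(* Defs.v *)
From HB Require Import structures.
From mathcomp Require Import all_boot all_order all_algebra.
From mathcomp Require Import all_classical all_reals all_analysis.
From mathcomp Require Import complex ring.
Set Implicit Arguments.
Unset Strict Implicit.
Unset Printing Implicit Defensive.
Import Order.TTheory GRing.Theory Num.Theory.
Import numFieldNormedType.Exports.

Local Open Scope classical_set_scope.
Local Open Scope ring_scope.
Local Open Scope complex_scope.

(* [R[i]] carries its topology only through its [numFieldType] structure, so
   the topological notions are stated over a general [K : numFieldType]. *)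

(* [P] holds off a closed discrete set.  All identities between functions that
   are meromorphic in the dynamical variable are stated in this sense, so that
   the values taken at poles are irrelevant. *)
Definition generically (K : numFieldType) (P : K -> Prop) : Prop :=
  forall x0 : K, \forall x \near x0^', P x.

Definition has_sum (K : numFieldType) (u : nat -> K) (l : K) : Prop :=
  series u @ \oo --> l.

Definition analytic_at (K : numFieldType) (f : K -> K) (x0 : K) : Prop :=
  exists a : nat -> K,
    \forall x \near x0, has_sum (fun i => a i * (x - x0) ^+ i) (f x).

(* Finite Laurent tail at [x0]; nothing is required of the value [f x0]. *)
Definition meromorphic_at (K : numFieldType) (f : K -> K) (x0 : K) : Prop :=
  exists (p : nat) (a : nat -> K),
    \forall x \near x0^',
      has_sum (fun i => a i * (x - x0) ^+ i) ((x - x0) ^+ p * f x).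

Section QuantumGroup.
Variables (R : realType) (eta : R[i]).
Local Notation C := R[i].

Definition cexp (z : C) : C :=
  (expR (complex.Re z))%:C * (cos (complex.Im z) +i* sin (complex.Im z)).

Definition qp (x : C) : C := cexp (pi%:C * 'i * eta * x).

Definition br (x : C) : C := (qp x - qp (- x)) / (qp 1 - qp (- 1)).

Definition brn (x : C) (k : nat) : C := \prod_(i < k) br (x + i%:R).

Definition brfact (k : nat) : C := brn 1 k.

Record uq_action (V : Type) := UqAction {
  actE : V -> V;
  actF : V -> V;
  actK : C -> V -> V  (* [actK x] is the action of q^{x h} *)
}.

Definition is_uq_module (V : lmodType C) (A : uq_action V) : Prop :=
  [/\ [/\ linear (actE A), linear (actF A) & forall x, linear (actK A x)],
      forall v, actK A 0 v = v,
      forall x y v, actK A x (actK A y v) = actK A (x + y) v,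
      [/\ forall x v, actK A x (actE A v) = qp (2 * x) *: actE A (actK A x v)
        & forall x v,
            actK A x (actF A v) = qp (- (2 * x)) *: actF A (actK A x v)]
    & forall v, actE A (actF A v) - actF A (actE A v) =
        (qp 1 - qp (- 1))^-1 *: (actK A 1 v - actK A (- 1) v)].

(* Modules with a countable basis are given by their action on coordinates:
   [c : nat -> C] stands for the combination of the basis vectors with
   coefficients [c k]; [nat -> nat -> C] plays this role for a tensor product
   of two such modules.  Every vector used below has finite support. *)
Definition bas (k : nat) : nat -> C := fun i => (i == k)%:R.

(* M_lambda in the basis v^(k) = F^k v / [k]!, where
   F v^(k) = [k+1] v^(k+1) and E v^(k) = [lambda-k+1] v^(k-1). *)
Definition verma (lambda : C) : uq_action (nat -> C) := {|
  actE := fun c k => br (lambda - k%:R) * c k.+1;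
  actF := fun c k => if k is k'.+1 then br k%:R * c k' else 0;
  actK := fun x c k => qp ((lambda - 2 * k%:R) * x) * c k |}.

(* M_Lambda^* in the basis u_m, where E u_m = [m] u_(m-1) and
   F u_m = [Lambda-m] u_(m+1). *)
Definition verma_dual (Lambda : C) : uq_action (nat -> C) := {|
  actE := fun c m => br m.+1%:R * c m.+1;
  actF := fun c m => if m is m'.+1 then br (Lambda - m'%:R) * c m' else 0;
  actK := fun x c m => qp ((Lambda - 2 * m%:R) * x) * c m |}.

Definition act1 (T : (nat -> C) -> nat -> C) (c : nat -> nat -> C) :
    nat -> nat -> C :=
  fun i j => T (fun i' => c i' j) i.
Definition act2 (T : (nat -> C) -> nat -> C) (c : nat -> nat -> C) :
    nat -> nat -> C :=
  fun i => T (c i).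

Definition tensor (A B : uq_action (nat -> C)) :
    uq_action (nat -> nat -> C) := {|
  actE := fun c => act1 (actE A) c + act1 (actK A 1) (act2 (actE B) c);
  actF := fun c => act1 (actF A) (act2 (actK B (- 1)) c) + act2 (actF B) c;
  actK := fun x c => act1 (actK A x) (act2 (actK B x) c) |}.

(* [phi k] is the image of v^(k) under a module map from M_mu. *)
Definition is_verma_map (mu : C) (V : lmodType C) (A : uq_action V)
    (phi : nat -> V) : Prop :=
  [/\ forall k, actF A (phi k) = br k.+1%:R *: phi k.+1,
      actE A (phi 0%N) = 0,
      forall k, actE A (phi k.+1) = br (mu - k%:R) *: phi k
    & forall x k, actK A x (phi k) = qp ((mu - 2 * k%:R) * x) *: phi k].

(* The image of the highest weight vector under Phi_m^Lambda(lambda). *)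
Definition Phi_hw (m : nat) (Lambda lambda : C) : nat -> nat -> C :=
  fun i j => \sum_(s < m.+1)
    qp (s%:R * (lambda - Lambda + 2 * m%:R - s%:R)) *
    brn (- lambda + Lambda - 2 * m%:R + s%:R + 1) (m - s) *
    (bas s i * iter s (actE (verma_dual Lambda)) (bas m) j).

(* [Phi m Lambda lambda k i j] is the coefficient of v^(i) (x) u_j in
   Phi_m^Lambda(lambda) v^(k).  See [Phi_verma_map] and [Phi_unique]. *)
Definition Phi (m : nat) (Lambda lambda : C) (k : nat) : nat -> nat -> C :=
  (brfact k)^-1 *:
  iter k
    (actF (tensor (verma (lambda - Lambda + 2 * m%:R - 1)) (verma_dual Lambda)))
    (Phi_hw m Lambda lambda).

Lemma cexpD z w : cexp (z + w) = cexp z * cexp w.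
Proof.
case: z w => [a b] [c d].
rewrite /cexp /= expRD cosD sinD rmorphM /= -!mulrA; congr (_ * _).
by rewrite mulrCA; congr (_ * _); simpc; congr (_ +i* _); rewrite addrC.
Qed.

Lemma norm_cexp z : `|cexp z| = (expR (complex.Re z))%:C.
Proof.
rewrite /cexp normrM normc_def /= expr0n addr0 sqrtr_sqr gtr0_norm ?expR_gt0//.
by rewrite normc_def /= cos2Dsin2 sqrtr1 mulr1.
Qed.

Lemma qp0 : qp 0 = 1.
Proof. by rewrite /qp mulr0 /cexp /= expR0 cos0 sin0 mul1r. Qed.

Lemma qpD x y : qp (x + y) = qp x * qp y.
Proof. by rewrite /qp mulrDr cexpD. Qed.

Lemma qp_neq0 x : qp x != 0.
Proof.
apply/eqP => h; have := qpD x (- x).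
by rewrite subrr qp0 h mul0r => /eqP; rewrite oner_eq0.
Qed.

Lemma qpN x : qp (- x) = (qp x)^-1.
Proof.
by apply: (mulfI (qp_neq0 x)); rewrite mulfV ?qp_neq0// -qpD subrr qp0.
Qed.

Lemma br0 : br 0 = 0.
Proof. by rewrite /br oppr0 subrr mul0r. Qed.

Lemma brN x : br (- x) = - br x.
Proof. by rewrite /br opprK -[RHS]mulNr opprB. Qed.

Lemma br_comm x y : br (x - y) * br (y + 1) - br y * br (x - y + 1) =
  br (x - 2 * y).
Proof.
rewrite /br; have [->|D0] := eqVneq (qp 1 - qp (- 1)) 0.
  by rewrite invr0 !mulr0 subrr.
rewrite mulr_natl mulr2n !opprD !opprK !qpD !qpN in D0 *.
have h1 := qp_neq0 1; have hx := qp_neq0 x; have hy := qp_neq0 y.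
have D1 : qp 1 * qp 1 - 1 != 0.
  apply: contra D0 => /eqP h; rewrite -(mulIr_eq0 _ (mulIf h1)).
  by rewrite mulrBl mulVf// h.
by field; rewrite h1 hx hy /= D1.
Qed.

Lemma br_neq0 k : 0 < complex.Im eta -> br k.+1%:R != 0.
Proof.
move=> heta.
have q2 l : qp l.+1%:R - qp (- l.+1%:R) != 0.
  apply/eqP => /eqP; rewrite subr_eq0 => /eqP h.
  have : `|qp (l.+1%:R)| = `|qp (- l.+1%:R)| by rewrite h.
  rewrite /qp !norm_cexp => /complexI /expR_inj.
  case: eta heta => a b /= b0; rewrite mulrN -mulr_natr mul1r /=.
  rewrite -(rmorph_nat (real_complex R)) /=.
  rewrite !(oppr0, mulr0, mul0r, mulr1, mul1r, subr0, sub0r, add0r, addr0).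
  move=> /eqP; rewrite -subr_eq0 opprK -mulr2n mulrn_eq0 /=.
  by rewrite mulf_eq0 oppr_eq0 mulf_eq0 pnatr_eq0 orbF (gt_eqF b0) (gt_eqF (pi_gt0 R)).
by rewrite /br mulf_eq0 invr_eq0 negb_or q2 /=; have := q2 0%N; rewrite mulr1n.
Qed.

Lemma brfact_neq0 k : 0 < complex.Im eta -> brfact k != 0.
Proof.
move=> heta; rewrite /brfact /brn prodf_seq_neq0; apply/allP => i _ /=.
by rewrite nat1r br_neq0.
Qed.

Lemma brD a b : br (a + b) = qp (- b) * br a + qp a * br b.
Proof.
by rewrite /br !mulrA -mulrDl; congr (_ / _); rewrite opprD !qpD; ring.
Qed.

Let h (Lambda : C) (j : nat) : C :=
  if j is j'.+1 then br (Lambda - j'%:R) else 0.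

Let vermaF lambda c k :
  actF (verma lambda) c k = br k%:R * c k.-1.
Proof. by case: k => //=; rewrite br0 mul0r. Qed.

Let dualF Lambda c k : actF (verma_dual Lambda) c k = h Lambda k * c k.-1.
Proof. by case: k => //=; rewrite mul0r. Qed.

Let vermaE lambda c k : actE (verma lambda) c k = br (lambda - k%:R) * c k.+1.
Proof. by []. Qed.

Let vermaK lambda x c k :
  actK (verma lambda) x c k = qp ((lambda - 2 * k%:R) * x) * c k.
Proof. by []. Qed.

Let dualK Lambda x c k :
  actK (verma_dual Lambda) x c k = qp ((Lambda - 2 * k%:R) * x) * c k.
Proof. by []. Qed.

Let dualE Lambda c k : actE (verma_dual Lambda) c k = br k.+1%:R * c k.+1.
Proof. by []. Qed.

Let verma_comm lambda k :
  br (lambda - k%:R) * br k.+1%:R - br k%:R * br (lambda - k.-1%:R) =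
  br (lambda - 2 * k%:R).
Proof.
rewrite -br_comm natr1; congr (_ - _).
by case: k => [|k]; rewrite ?br0 ?mul0r//= -(natr1 k) opprD addrA subrK.
Qed.

Let dual_comm Lambda k :
  br k.+1%:R * h Lambda k.+1 - h Lambda k * br k.-1.+1%:R =
  br (Lambda - 2 * k%:R).
Proof.
rewrite -verma_comm mulrC; congr (_ - _).
by case: k => [|k] /=; rewrite ?br0 ?mul0r// mulrC.
Qed.

Let K_diff a c :
  (qp 1 - qp (- 1))^-1 * (qp (a * 1) * c - qp (a * - 1) * c) = br a * c.
Proof. by rewrite -mulrBl mulr1 mulrN1 mulrA; congr (_ * _); rewrite mulrC. Qed.

Lemma verma_uq lambda : is_uq_module (verma lambda).
Proof.
split; first split.
- by move=> a u v; apply/funext => k; rewrite !fctE /= mulrDr mulrCA.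
- move=> a u v; apply/funext => k.
  by rewrite !fctE !vermaF /= mulrDr mulrCA.
- by move=> x a u v; apply/funext => k; rewrite !fctE /= mulrDr mulrCA.
- by move=> v; apply/funext => k; rewrite /= mulr0 qp0 mul1r.
- by move=> x y v; apply/funext => k; rewrite /= mulrA -qpD -mulrDr.
- split=> x v; apply/funext => k; rewrite !fctE.
    rewrite /= [RHS]mulrCA [LHS]mulrCA; congr (_ * _); rewrite [RHS]mulrA -qpD.
    by congr (qp _ * _); rewrite -natr1; ring.
  rewrite vermaK !vermaF vermaK [RHS]mulrCA [LHS]mulrCA.
  case: k => [|k]; first by rewrite br0 !mul0r.
  congr (_ * _); rewrite [RHS]mulrA -qpD.
  by congr (qp _ * _); rewrite -natr1 /=; ring.
- move=> v; apply/funext => k; rewrite !fctE.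
  rewrite [RHS]K_diff -verma_comm vermaE !vermaF vermaE.
  case: k => [|k] /=; last by rewrite mulrBl !mulrA.
  by rewrite br0 !mul0r !subr0 mulrA.
Qed.

Lemma verma_dual_uq Lambda : is_uq_module (verma_dual Lambda).
Proof.
split; first split.
- by move=> a u v; apply/funext => k; rewrite !fctE /= mulrDr mulrCA.
- move=> a u v; apply/funext => k.
  by rewrite !fctE !dualF /= mulrDr mulrCA.
- by move=> x a u v; apply/funext => k; rewrite !fctE /= mulrDr mulrCA.
- by move=> v; apply/funext => k; rewrite /= mulr0 qp0 mul1r.
- by move=> x y v; apply/funext => k; rewrite /= mulrA -qpD -mulrDr.
- split=> x v; apply/funext => k; rewrite !fctE.
    rewrite /= [RHS]mulrCA [LHS]mulrCA; congr (_ * _); rewrite [RHS]mulrA -qpD.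
    by congr (qp _ * _); rewrite -natr1; ring.
  rewrite dualK !dualF dualK [RHS]mulrCA [LHS]mulrCA.
  case: k => [|k]; first by rewrite !mul0r.
  congr (_ * _); rewrite [RHS]mulrA -qpD.
  by congr (qp _ * _); rewrite -natr1 /=; ring.
- move=> v; apply/funext => k; rewrite !fctE.
  rewrite [RHS]K_diff -dual_comm dualE !dualF dualE.
  case: k => [|k] /=; last by rewrite mulrBl !mulrA.
  by rewrite !mul0r !subr0 mulrA.
Qed.

Section Tensor.
Variables mu Lambda : C.
Local Notation T := (tensor (verma mu) (verma_dual Lambda)).

Let tE c i j : actE T c i j =
  br (mu - i%:R) * c i.+1 j +
  qp (mu - 2 * i%:R) * (br j.+1%:R * c i j.+1).
Proof. by rewrite -[X in qp X]mulr1. Qed.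

Let tF c i j : actF T c i j =
  br i%:R * (qp (- (Lambda - 2 * j%:R)) * c i.-1 j) + h Lambda j * c i j.-1.
Proof.
transitivity (actF (verma mu) (fun i' => actK (verma_dual Lambda) (- 1) (c i') j) i
  + actF (verma_dual Lambda) (c i) j) => //.
by rewrite vermaF dualF /= mulrN1.
Qed.

Let tK x c i j : actK T x c i j =
  qp ((mu - 2 * i%:R) * x + (Lambda - 2 * j%:R) * x) * c i j.
Proof. by rewrite qpD -mulrA. Qed.

Let lin2 (a : C) (u v : nat -> nat -> C) i j :
  (a *: u + v) i j = a * u i j + v i j.
Proof. by []. Qed.

Lemma tensor_uq : is_uq_module T.
Proof.
split; first split.
- by move=> a u v; apply/funext => i; apply/funext => j; rewrite lin2 !tE !lin2; ring.
- by move=> a u v; apply/funext => i; apply/funext => j; rewrite lin2 !tF !lin2; ring.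
- move=> x a u v; apply/funext => i; apply/funext => j.
  by rewrite lin2 !tK lin2; ring.
- move=> v; apply/funext => i; apply/funext => j.
  by rewrite tK !mulr0 addr0 qp0 mul1r.
- move=> x y v; apply/funext => i; apply/funext => j.
  by rewrite !tK mulrA -qpD; congr (qp _ * _); ring.
- split=> x v; apply/funext => i; apply/funext => j; rewrite !fctE.
    rewrite tK !tE !tK [RHS]mulrDr mulrDr; congr (_ + _).
      rewrite [RHS]mulrCA [LHS]mulrCA; congr (_ * _).
      by rewrite [RHS]mulrA -qpD; congr (qp _ * _); rewrite -natr1; ring.
    rewrite [RHS]mulrCA [LHS]mulrCA; congr (_ * _).
    rewrite [RHS]mulrCA [LHS]mulrCA; congr (_ * _).
    by rewrite [RHS]mulrA -qpD; congr (qp _ * _); rewrite -natr1; ring.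
  rewrite tK !tF !tK [RHS]mulrDr mulrDr; congr (_ + _).
    rewrite [RHS]mulrCA [LHS]mulrCA; case: i => [|i]; first by rewrite br0 !mul0r.
    congr (_ * _); rewrite [RHS]mulrCA [LHS]mulrCA; congr (_ * _).
    by rewrite [RHS]mulrA -qpD; congr (qp _ * _); rewrite -natr1 /=; ring.
  rewrite [RHS]mulrCA [LHS]mulrCA; case: j => [|j]; first by rewrite !mul0r.
  congr (_ * _).
  by rewrite [RHS]mulrA -qpD; congr (qp _ * _); rewrite -natr1 /=; ring.
- move=> c; apply/funext => i; apply/funext => j; rewrite !fctE !tK.
  rewrite -!mulrDl [RHS]K_diff.
  rewrite brD -verma_comm -dual_comm tE tF tF tF tE tE.
  have -> : qp (- (Lambda - 2 * j.+1%:R)) = qp (- (Lambda - 2 * j%:R)) * qp 2.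
    by rewrite -qpD; congr qp; rewrite -natr1; ring.
  case: i => [|i].
    by rewrite br0; case: j => [|j] /=; ring.
  have -> : qp (mu - 2 * i.+1.-1%:R) = qp (mu - 2 * i.+1%:R) * qp 2.
    by rewrite -qpD; congr qp; rewrite -(natr1 i) /=; ring.
  by case: j => [|j] /=; ring.
Qed.

Lemma tensorF_support k c m :
  (forall i j, (i + j)%N <> m -> c i j = 0) ->
  forall i j, (i + j)%N <> (k + m)%N -> iter k (actF T) c i j = 0.
Proof.
move=> hc; elim: k => [|k IH] i j hij; first exact: hc.
rewrite iterS tF; case: i hij => [|i] hij; case: j hij => [|j] hij;
  rewrite ?br0 ?mul0r ?add0r ?addr0 ?[h _ 0]/= ?mul0r ?addr0 //= !IH ?mulr0 ?addr0 //;
  by move=> e; apply: hij; rewrite ?addSn ?addnS -?e ?addSn ?addnS.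
Qed.

Lemma tensor_coordE c i j : actE T c i j =
  br (mu - i%:R) * c i.+1 j + qp (mu - 2 * i%:R) * (br j.+1%:R * c i j.+1).
Proof. exact: tE. Qed.

Lemma tensor_coordK x c i j : actK T x c i j =
  qp ((mu - 2 * i%:R) * x + (Lambda - 2 * j%:R) * x) * c i j.
Proof. exact: tK. Qed.

End Tensor.

Lemma brnS x k : brn x k.+1 = br x * brn (x + 1) k.
Proof.
rewrite /brn big_ord_recl addr0; congr (_ * _).
by apply: eq_bigr => i _; rewrite lift0 -nat1r addrA.
Qed.

Lemma brnSr x k : brn x k.+1 = brn x k * br (x + k%:R).
Proof. by rewrite /brn big_ord_recr. Qed.

Lemma iter_dualE Lambda s c j :
  iter s (actE (verma_dual Lambda)) c j = brn j.+1%:R s * c (j + s)%N.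
Proof.
elim: s j => [|s IH] j; first by rewrite /brn big_ord0 mul1r addn0.
by rewrite iterS dualE IH mulrA brnS natr1 addSnnS.
Qed.

Lemma Phi_hwE m Lambda lambda i j : Phi_hw m Lambda lambda i j =
  if (i + j == m)%N then
    qp (i%:R * (lambda - Lambda + 2 * m%:R - i%:R)) *
    brn (- lambda + Lambda - 2 * m%:R + i%:R + 1) j * brn j.+1%:R i
  else 0.
Proof.
rewrite /Phi_hw; case: eqP => [<-|hij].
  have hi : (i < (i + j).+1)%N by rewrite ltnS leq_addr.
  rewrite (bigD1 (Ordinal hi)) // big1 => [|s hs].
    by rewrite iter_dualE /bas /= [(j + i)%N]addnC !eqxx mul1r mulr1 addKn addr0.
  rewrite /bas (_ : (i == s) = false) ?mul0r ?mulr0//.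
  by apply: contraNF hs => /eqP e; apply/eqP/val_inj.
rewrite big1// => s _; rewrite iter_dualE /bas.
case: eqP => [e|]; last by rewrite mul0r mulr0.
case: eqP => [e'|]; last by rewrite !mulr0.
by case: hij; rewrite e addnC.
Qed.

Lemma Phi_hw_singular m Lambda lambda :
  actE (tensor (verma (lambda - Lambda + 2 * m%:R - 1)) (verma_dual Lambda))
    (Phi_hw m Lambda lambda) = 0.
Proof.
apply/funext => i; apply/funext => j.
rewrite tensor_coordE !Phi_hwE addSn addnS; case: eqP => [<-|]; last first.
  by rewrite !mulr0 addr0.
set mu := lambda - _ + _ - 1.
set y := - lambda + _ - _ + i%:R + 1.
have -> : - lambda + Lambda - 2 * (i + j).+1%:R + i.+1%:R + 1 = y + 1.
  by rewrite /y -(natr1 i); ring.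
have -> : mu - i%:R = - y by rewrite /mu /y; ring.
rewrite brN [brn y _]brnS [brn j.+1%:R _]brnS natr1.
set Q := qp (i.+1%:R * _).
have -> : Q = qp (mu - 2 * i%:R) * qp (i%:R * (lambda - Lambda +
     2 * (i + j).+1%:R - i%:R)).
  by rewrite /Q -qpD; congr qp; rewrite /mu -(natr1 i); ring.
set q1 := qp (mu - _); set q2 := qp (i%:R * _); clearbody q1 q2; ring.
Qed.

Lemma Phi_hw_weight m Lambda lambda x :
  actK (tensor (verma (lambda - Lambda + 2 * m%:R - 1)) (verma_dual Lambda)) x
    (Phi_hw m Lambda lambda) = qp ((lambda - 1) * x) *: Phi_hw m Lambda lambda.
Proof.
apply/funext => i; apply/funext => j; rewrite tensor_coordK !fctE Phi_hwE.
case: eqP => [<-|_]; last by rewrite mulr0 [RHS]mulr0.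
by congr (qp _ * _); rewrite natrD; ring.
Qed.

Lemma verma_map_exists (V : lmodType C) (A : uq_action V) mu w :
    0 < complex.Im eta -> is_uq_module A ->
    actE A w = 0 -> (forall x, actK A x w = qp (mu * x) *: w) ->
  is_verma_map mu A (fun k => (brfact k)^-1 *: iter k (actF A) w).
Proof.
move=> heta [[linE linF linK] _ _ [_ KF] EF] Ew Kw.
have scaleE a v : actE A (a *: v) = a *: actE A v.
  have E0 : actE A 0 = 0.
    by have := linE (- 1) 0 0; rewrite scaler0 addr0 scaleN1r addNr.
  by rewrite -[a *: v]addr0 linE E0 addr0.
have scaleF a v : actF A (a *: v) = a *: actF A v.
  have F0 : actF A 0 = 0.
    by have := linF (- 1) 0 0; rewrite scaler0 addr0 scaleN1r addNr.
  by rewrite -[a *: v]addr0 linF F0 addr0.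
have scaleK x a v : actK A x (a *: v) = a *: actK A x v.
  have K0 : actK A x 0 = 0.
    by have := linK x (- 1) 0 0; rewrite scaler0 addr0 scaleN1r addNr.
  by rewrite -[a *: v]addr0 linK K0 addr0.
have b1 : br 1%:R = 1.
  have := br_neq0 0 heta; rewrite mulr1n /br mulf_eq0 negb_or => /andP[D0 _].
  by rewrite divff.
have Kit x k : actK A x (iter k (actF A) w) =
    qp ((mu - 2 * k%:R) * x) *: iter k (actF A) w.
  elim: k => [|k IH]; first by rewrite mulr0 subr0 Kw.
  rewrite iterS KF IH scaleF scalerA -qpD; congr (qp _ *: _).
  by rewrite -natr1; ring.
have Eit k : actE A (iter k.+1 (actF A) w) =
    (br k.+1%:R * br (mu - k%:R)) *: iter k (actF A) w.
  elim: k => [|k IH].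
    have := EF w; rewrite Ew (_ : actF A 0 = 0); last first.
      by have := scaleF 0 0; rewrite !scale0r.
    rewrite subr0 /= => ->; rewrite !Kw -scalerBl scalerA subr0.
    by congr (_ *: _); rewrite mulr1 mulrN1 b1 mul1r /br [RHS]mulrC.
  have := EF (iter k.+1 (actF A) w); rewrite IH scaleF -[actF A (iter _ _ _)]iterS.
  move/eqP; rewrite subr_eq => /eqP ->.
  rewrite !Kit -scalerBl scalerA -scalerDl; congr (_ *: _).
  rewrite mulr1 mulrN1 [_^-1 * _]mulrC -/(br _).
  have := br_comm mu k.+1%:R; rewrite natr1.
  rewrite (_ : mu - k.+1%:R + 1 = mu - k%:R); last by rewrite -natr1; ring.
  by move=> <-; rewrite subrK mulrC.
have f0 := brfact_neq0 ^~ heta; have b0 := br_neq0 ^~ heta.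
have fS k : brfact k.+1 = brfact k * br k.+1%:R.
  by rewrite /brfact brnSr nat1r.
split=> [k||k|x k].
- by rewrite scaleF [RHS]scalerA fS invfM mulrCA divff ?b0 ?mulr1.
- by rewrite scaleE Ew scaler0.
- rewrite scaleE Eit scalerA [RHS]scalerA fS invfM; congr (_ *: _).
  by rewrite -mulrA mulKf// mulrC.
- by rewrite scaleK Kit !scalerA mulrC.
Qed.

(* [Phi] is the module map with the prescribed value on the highest weight
   vector, and the only one. *)
Lemma Phi_verma_map m Lambda lambda : 0 < complex.Im eta ->
  is_verma_map (lambda - 1)
    (tensor (verma (lambda - Lambda + 2 * m%:R - 1)) (verma_dual Lambda))
    (Phi m Lambda lambda).
Proof.
move=> heta; apply: verma_map_exists => //.
- exact: tensor_uq.
- exact: Phi_hw_singular.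
- exact: Phi_hw_weight.
Qed.

Lemma Phi_hw_value m Lambda lambda :
  Phi m Lambda lambda 0 = Phi_hw m Lambda lambda.
Proof. by rewrite /Phi /brfact /brn big_ord0 invr1 scale1r. Qed.

Lemma Phi_unique m Lambda lambda phi : 0 < complex.Im eta ->
  is_verma_map (lambda - 1)
    (tensor (verma (lambda - Lambda + 2 * m%:R - 1)) (verma_dual Lambda)) phi ->
  phi 0%N = Phi_hw m Lambda lambda -> phi = Phi m Lambda lambda.
Proof.
move=> heta [hphi _ _ _] phi0; have [hPhi _ _ _] := Phi_verma_map m Lambda lambda heta.
apply/funext; elim=> [|k IH]; first by rewrite phi0 Phi_hw_value.
by apply: (scalerI (br_neq0 k heta)); rewrite -hphi -hPhi IH.
Qed.

Lemma Phi_support m Lambda lambda k i j :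
  (i + j)%N <> (k + m)%N -> Phi m Lambda lambda k i j = 0.
Proof.
move=> hij; rewrite /Phi !fctE (@tensorF_support _ _ k _ m) ?scaler0//.
by move=> i' j' hij'; rewrite Phi_hwE; case: eqP.
Qed.

(* [PhiV [:: (Lambda_1, m_1); ...; (Lambda_n, m_n)] lambda k i [:: j_1; ...; j_n]]
   is the coefficient of v^(i) (x) u_(j_1) (x) ... (x) u_(j_n) in the image of
   v^(k) under the composite Phi; the summation range is exhaustive by
   [Phi_support]. *)
Fixpoint PhiV (s : seq (C * nat)) (lambda : C) (k i : nat) (js : seq nat) : C :=
  match s, js with
  | [::], [::] => (i == k)%:R
  | (Lambda, m) :: s', j :: js' =>
      \sum_(k' < (i + j).+1)
        PhiV s' lambda k k' js' *
        Phi m Lambda (lambda - \sum_(p <- s') (p.1 - 2 * p.2%:R)) k' i j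
  | _, _ => 0
  end.

End QuantumGroup.

(* Z^n[M]; the entries are at most M because they add up to M. *)
Definition mindex (n M : nat) : finType :=
  {m : {ffun 'I_n -> 'I_M.+1} | (\sum_i (m i : nat) == M)%N}.

Definition mpart (n M : nat) (m : mindex n M) (i : 'I_n) : nat := val m i.

Section Operators.
Variables (R : realType) (eta : R[i]) (n M : nat) (Lambda : 'I_n -> R[i]).
Local Notation C := R[i].
Local Notation Z := (mindex n M).
Local Notation N := #|Z|.
Local Notation qp := (qp eta).

Definition wt (m : Z) (i : 'I_n) : C := Lambda i - 2 * (mpart m i)%:R.

Definition wtsum (m : Z) (P : pred 'I_n) : C := \sum_(i | P i) wt m i.

(* M_Lambda[0] is identified with column vectors via the basis v^(m), m in Z;
   [f m m'] is the coefficient of v^(m') in the image of v^(m). *)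
Definition opmx (f : Z -> Z -> C) : 'M[C]_N :=
  \matrix_(i, j) f (enum_val j) (enum_val i).

(* Operators with matrix elements [f m m_a m_b m'_a m'_b] in the factors [a]
   (first) and [b] (second), diagonal in the other factors, on whose weights
   they may depend through [m]. *)
Definition two_factor (a b : 'I_n) (f : Z -> nat -> nat -> nat -> nat -> C) :
    'M[C]_N :=
  opmx (fun m m' =>
    if [forall i, (i != a) && (i != b) ==> (mpart m i == mpart m' i)]
    then f m (mpart m a) (mpart m b) (mpart m' a) (mpart m' b) else 0).

(* The trace at (lambda, x) is the sum over k of these terms (the coefficient
   of u_(m')), up to the prefactor of F. *)
Definition trace_term (m m' : Z) (lambda x : C) (k : nat) : C :=
  PhiV eta [seq (Lambda i, mpart m i) | i <- enum 'I_n] lambda k k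
    [seq mpart m' i | i <- enum 'I_n] *
  qp ((lambda - 1 - 2 * k%:R) * x).

Definition trace_prefactor (x : C) : C :=
  qp (- (M%:R * (M%:R + 1) / 2)) * (qp 1 - qp (- 1)) ^+ M * (qp x - qp (- x)).

(* [F lambda x m m'] is F_m^(m')(lambda, x; Lambda): the trace for
   |q^(2x)| large, continued meromorphically in [x]. *)
Definition is_trace_matrix (F : C -> C -> Z -> Z -> C) : Prop :=
  forall (lambda : C) (m m' : Z),
    (forall x0, meromorphic_at (fun x => F lambda x m m') x0) /\
    exists r : R, forall x : C, r%:C < `|qp (2 * x)| ->
      exists2 T : C, has_sum (trace_term m m' lambda x) T
                   & F lambda x m m' = trace_prefactor x * T.

Definition trace_regular (F : C -> C -> Z -> Z -> C) (x : C) : Prop :=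
  forall (lambda : C) (m m' : Z), analytic_at (fun y => F lambda y m m') x.

Definition trace_op (F : C -> C -> Z -> Z -> C) (lambda x : C) : 'M[C]_N :=
  opmx (fun m' m => F lambda x m m').

(* Coefficient of v^(n1) (x) v^(n2) in R_{L1,L2} (v^(m1) (x) v^(m2)); the terms
   with k > m1 vanish because E^k v^(m1) = 0. *)
Definition qRmatrix (L1 L2 : C) (m1 m2 n1 n2 : nat) : C :=
  qp (- (L1 * L2 / 2)) *
  (\sum_(k < m1.+1)
     qp (k%:R * (k%:R - 1) / 2) * (qp 1 - qp (- 1)) ^+ k / brfact eta k *
     (iter k (actE (verma eta L1)) (bas R m1) n1 *
      iter k (actF (verma eta L2)) (bas R m2) n2)) *
  qp ((L1 - 2 * m1%:R) * (L2 - 2 * m2%:R) / 2).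

Definition qRop (a b : 'I_n) : 'M[C]_N :=
  two_factor a b (fun _ => qRmatrix (Lambda a) (Lambda b)).

Definition qKZ (j : 'I_n) (x : C) : 'M[C]_N :=
  \big[mulmx/1%:M]_(k < n | (j < k)%N) invmx (qRop k j) *m
  opmx (fun m m' => (m == m')%:R * qp (- (wt m j * x))) *m
  \big[mulmx/1%:M]_(k < n | (k < j)%N) qRop j k.

(* [RR L1 L2 lambda m1 m2 n1 n2] is the matrix element of R_{L1,L2}(lambda)
   from v^(m1) (x) v^(m2) to v^(n1) (x) v^(n2). *)
Definition dynRop (RR : C -> C -> C -> nat -> nat -> nat -> nat -> C)
    (a b : 'I_n) (P : pred 'I_n) (lambda : C) : 'M[C]_N :=
  two_factor a b (fun m => RR (Lambda a) (Lambda b) (lambda - wtsum m P)).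

Definition Gamma (j : 'I_n) (xi : C -> 'cV[C]_N) (lambda : C) : 'cV[C]_N :=
  \col_i xi (lambda - wt (enum_val i) j) i 0.

Definition qKZB (RR : C -> C -> C -> nat -> nat -> nat -> nat -> C)
    (j : 'I_n) (xi : C -> 'cV[C]_N) (lambda : C) : 'cV[C]_N :=
  \big[mulmx/1%:M]_(k < n | (j < k)%N)
     invmx (dynRop RR k j (fun i => k < i)%N lambda) *m
  Gamma j (fun l =>
    \big[mulmx/1%:M]_(k < n | (k < j)%N)
       dynRop RR j k (fun i => (k < i < j) || (j < i))%N l *m xi l) lambda.

End Operators.

Section DynamicalR.
Variables (R : realType) (eta : R[i]).
Local Notation C := R[i].
Local Notation qp := (qp eta).
Local Notation br := (br eta).

Definition eval3 (p : {poly {poly {poly C}}}) (a b c : C) : C :=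
  p.[c%:P%:P].[b%:P].[a].

(* The properties determining the dynamical R-matrix.  In the fusion relations
   the left hand sides are evaluated at v^(m) (x) v^(m3), resp.
   v^(m1) (x) v^(m), and the coefficient of v^(n1) (x) v^(n2) (x) v^(n3) is
   taken; by weight conservation the inner sum over [l] is exhaustive. *)
Record is_dynR (RR : C -> C -> C -> nat -> nat -> nat -> nat -> C) : Prop :=
  IsDynR {
  dynR_weight : forall L1 L2 m1 m2 n1 n2, (m1 + m2)%N <> (n1 + n2)%N ->
    generically (fun lambda => RR L1 L2 lambda m1 m2 n1 n2 = 0);
  (* The denominator does not vanish identically in lambda for any L1, L2, so
     each matrix element is defined and meromorphic in lambda for all L1, L2. *)
  dynR_rational : forall m1 m2 n1 n2,
    exists P Q : {poly {poly {poly C}}}, forall L1 L2,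
      (exists lambda, eval3 Q (qp L1) (qp L2) (qp (2 * lambda)) != 0) /\
      generically (fun lambda => RR L1 L2 lambda m1 m2 n1 n2 =
        eval3 P (qp L1) (qp L2) (qp (2 * lambda)) /
        eval3 Q (qp L1) (qp L2) (qp (2 * lambda)));
  dynR_descends1 : forall L2 m1 m2 n1 n2 k, (n1 <= k < m1)%N ->
    generically (fun lambda => RR k%:R L2 lambda m1 m2 n1 n2 = 0);
  dynR_descends2 : forall L1 m1 m2 n1 n2 k, (n2 <= k < m2)%N ->
    generically (fun lambda => RR L1 k%:R lambda m1 m2 n1 n2 = 0);
  dynR_fusion1 : forall L1 L2 L3 m m3 n1 n2 n3,
    generically (fun lambda =>
      RR (L1 + L2) L3 lambda m m3 (n1 + n2)%N n3 =
      \sum_(m2 < m.+1) \sum_(l < (m + m3).+1)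
        RR L2 L3 lambda m2 l n2 n3 *
        RR L1 L3 (lambda - (L2 - 2 * m2%:R)) (m - m2)%N m3 n1 l);
  dynR_fusion2 : forall L1 L2 L3 m1 m n1 n2 n3,
    generically (fun lambda =>
      RR L1 (L2 + L3) lambda m1 m n1 (n2 + n3)%N =
      \sum_(m3 < m.+1) \sum_(l < (m1 + m).+1)
        RR L1 L2 (lambda - (L3 - 2 * n3%:R)) l (m - m3)%N n1 n2 *
        RR L1 L3 lambda m1 m3 l n3);
  dynR_vector : generically (fun lambda =>
    [/\ RR 1 1 lambda 0%N 0%N 0%N 0%N = 1 /\ RR 1 1 lambda 1%N 1%N 1%N 1%N = 1,
        RR 1 1 lambda 0%N 1%N 0%N 1%N = qp (- 1) * br (lambda + 1) / br lambda,
        RR 1 1 lambda 0%N 1%N 1%N 0%N = qp (lambda - 1) / br lambda,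
        RR 1 1 lambda 1%N 0%N 0%N 1%N = - (qp (- lambda - 1) / br lambda)
      & RR 1 1 lambda 1%N 0%N 1%N 0%N = qp (- 1) * br (lambda - 1) / br lambda])
}.

End DynamicalR.

(* Main.v *)
Require Import Defs.
From mathcomp Require Import all_boot all_order all_algebra.
From mathcomp Require Import all_classical all_reals all_analysis.
From mathcomp Require Import complex ring lra zify.
Set Implicit Arguments.
Unset Strict Implicit.
Unset Printing Implicit Defensive.
Import Order.TTheory GRing.Theory Num.Theory.
Import numFieldNormedType.Exports.
Local Open Scope ring_scope.
Local Open Scope complex_scope.

(** The entries of [F] are traces over a Verma module of composites of the
    intertwiners [Phi], one for each tensor factor, weighted by q^(xh).  Two
    facts about these composites give the theorem.

    Exchange.  Two neighbouring intertwiners can be permuted at the price of a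
    dynamical R-matrix acting on the indices m of the intertwiners and a quantum
    R-matrix acting on their values in the modules M^* ([exchange],
    [gexchange_all], and [Wmx_swap] inside a composite of n intertwiners).  For
    two weights equal to 1 this is a finite check against the prescribed
    dynamical R-matrix ([exchange_base01] and its companions).  The intertwiners
    of weight L + 1 are obtained by fusing those of weights L and 1
    ([phi_op_fuse]); the fusion rule of the dynamical R-matrix on one side and
    the hexagon identities of the quantum R-matrix on the other
    ([hexagon_left], [hexagon_right]) then propagate the relation to all
    positive integral weights ([fusion_left], [fusion_right],
    [gexchange_kl]).  Here it matters that the dynamical R-matrix descends to
    the irreducible quotients: the fusion sums only involve indices for which
    the relation is already known.  Finally, after clearing denominators both
    sides are Laurent polynomials in q^L1, q^L2 and q^lambda, so infinitely many
    integral weights determine them for all complex weights.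

    Cyclicity.  Exchanging the j-th intertwiner with all its left neighbours
    brings it to the left end, exchanging it with its right neighbours brings it
    to the right end ([Wmx_move_left], [Wmx_move_right]).  The traces of the two
    composites agree because a trace is cyclic: transporting the j-th
    intertwiner around shifts lambda by the weight of its index (this is
    [Gamma]) and produces the factor q^(-x h) ([cyclic_term], [cyclic_entry]).
    The inverses that occur exist: quantum R-matrices and composites of
    intertwiners are triangular with nonzero diagonal, and [Wmx_swap] transfers
    invertibility to the dynamical R-matrices ([dynRop_unit]).

    This proves the equation where the traces converge, that is for
    |q^(2x)| large ([qKZB_far]).  For fixed generic lambda both sides are
    meromorphic in x and continuous at the given regular point, so the identity
    theorem ([meromorphic_vanish], [tame_identity]) gives it there too. *)

(** * Quantum numbers and intertwiners for weights differing by one *)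

Section QNumbers.
Variables (R : realType) (eta : R[i]).
Hypothesis heta : 0 < complex.Im eta.
Local Notation C := R[i].
Local Notation qp := (qp eta).
Local Notation br := (br eta).
Local Notation brn := (brn eta).
Local Notation Phi := (Phi eta).

Lemma qp_double x : qp (2 * x) = qp x * qp x.
Proof. by rewrite mulr_natl mulr2n qpD. Qed.

Lemma br1 : br 1 = 1.
Proof.
have := br_neq0 0 heta; rewrite mulr1n /Defs.br mulf_eq0 negb_or => /andP[D0 _].
by rewrite divff.
Qed.

Lemma qdiff_neq0 : qp 1 - qp (- 1) != 0.
Proof.
have := br_neq0 0 heta; rewrite mulr1n /Defs.br mulf_eq0 negb_or.
by case/andP.
Qed.

Lemma qp1_sq_neq1 : qp 1 * qp 1 - 1 != 0.
Proof.
apply: contra qdiff_neq0 => /eqP h.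
by rewrite -(mulIr_eq0 _ (mulIf (qp_neq0 eta 1))) qpN mulrBl mulVf ?qp_neq0// h.
Qed.

(** Every bracket becomes a rational expression in exponentials, so that [field]
    decides identities between them. *)
Lemma br_num x : br x = (qp x - (qp x)^-1) * qp 1 / (qp 1 * qp 1 - 1).
Proof.
rewrite /Defs.br !qpN; have h1 := qp_neq0 eta 1; have h2 := qp_neq0 eta x.
have h3 := qp1_sq_neq1; have h4 : qp 1 - (qp 1)^-1 != 0 by rewrite -qpN qdiff_neq0.
apply: (mulIf h4); rewrite mulfVK//; field; by rewrite ?h1 ?h2 ?h3.
Qed.

(** This is commutation of [Phi] with the action of [F], in coordinates; with
    [Phi0_hw] it determines [Phi] recursively. *)
Lemma Phi_recF m Lambda lambda k i j :
  br k.+1%:R * Phi m Lambda lambda k.+1 i j =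
  br i%:R * (qp (- (Lambda - 2 * j%:R)) * Phi m Lambda lambda k i.-1 j) +
  (if j is j'.+1 then br (Lambda - j'%:R) * Phi m Lambda lambda k i j' else 0).
Proof.
have [hF _ _ _] := Phi_verma_map m Lambda lambda heta.
transitivity ((br k.+1%:R *: Phi m Lambda lambda k.+1) i j) => //.
rewrite -hF /= /act1 /act2 /= !fctE /= mulrN1.
case: i => [|i]; first by rewrite br0 !mul0r.
by [].
Qed.

Lemma Phi0_hw m Lambda lambda i j : Phi m Lambda lambda 0 i j =
  if (i + j == m)%N then
    qp (i%:R * (lambda - Lambda + 2 * m%:R - i%:R)) *
    brn (- lambda + Lambda - 2 * m%:R + i%:R + 1) j * brn j.+1%:R i
  else 0.
Proof. by rewrite Phi_hw_value Phi_hwE. Qed.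

Lemma brn0 x : brn x 0 = 1.
Proof. by rewrite /Defs.brn big_ord0. Qed.

Definition phi_pred m Lambda lambda k i (j : nat) : C :=
  if j is j'.+1 then Phi m Lambda lambda k i j' else 0.

(** Reduces an equation to be proved to a polynomial identity, by exhibiting it
    as the multiple [c] of a known equation. *)
Lemma lincomb (c a b x y : C) : a = b -> x - y = c * (a - b) -> x = y.
Proof. by move=> ->; rewrite subrr mulr0 => /eqP; rewrite subr_eq0 => /eqP. Qed.

Ltac qside := by rewrite ?qp_neq0 ?qp1_sq_neq1.
Ltac qfield := rewrite ?br_num ?(qpD, qpN, qp_double, qp0); field; qside.

(** Both sides satisfy the recursion [Phi_recF] and agree on the highest weight
    vector. The two terms on the right are the composites of the intertwiner of
    weight [L] with the two components of the one of weight 1 and index 0. *)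
Lemma Phi_fuse0 m L lambda k i j :
  Phi m (L + 1) lambda k i j =
  qp (- k%:R) * Phi m L (lambda - 1) k i j +
  (if k is k'.+1 then qp (L - j%:R + 1) * phi_pred m L (lambda - 1) k' i j else 0).
Proof.
elim: k i j => [|k IH] i j.
  rewrite !Phi0_hw oppr0 qp0 mul1r addr0.
  rewrite (_ : lambda - (L + 1) = lambda - 1 - L); last by ring.
  by rewrite (_ : - lambda + (L + 1) = - (lambda - 1) + L)//; ring.
apply: (mulfI (br_neq0 k heta)).
have rk := Phi_recF m L (lambda - 1) k i j.
case: j rk => [|j] rk.
  rewrite Phi_recF !IH; apply: (lincomb (c := qp (- k.+1%:R)) (esym rk)).
  rewrite /= -(natr1 k).
  by case: k {IH rk} => [|k]; rewrite -?(natr1 k); qfield.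
rewrite Phi_recF !IH /=; apply: (lincomb (c := qp (- k.+1%:R)) (esym rk)).
case: k {IH rk} => [|k].
  by rewrite -?(natr1 j) -?(natr1 0) /=; qfield.
have rk := Phi_recF m L (lambda - 1) k i j.
apply/eqP; rewrite -subr_eq0; apply/eqP.
apply: (lincomb (c := qp (L - j%:R + 1)) (esym rk)).
case: j {rk} => [|j]; rewrite -?(natr1 k.+1) -?(natr1 k) -?(natr1 j.+1) -?(natr1 j) /=; qfield.
Qed.

End QNumbers.

Section TwistedFusion.
Variables (R : realType) (eta : R[i]).
Hypothesis heta : 0 < complex.Im eta.
Local Notation C := R[i].
Local Notation qp := (qp eta).
Local Notation br := (br eta).
Local Notation brn := (brn eta).
Local Notation Phi := (Phi eta).
Local Notation phi_pred := (phi_pred eta).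
Ltac qside := by rewrite ?qp_neq0 ?qp1_sq_neq1.
Ltac qfield := rewrite ?(br_num heta) ?(qpD, qpN, qp_double, qp0); field; qside.

(** As [Phi_fuse0], now for the index 1 in the factor of weight 1. The initial
    case is no longer immediate, since the right hand side involves the
    degree-one term of the recursion. *)
Lemma Phi_fuse1 m L lambda k i j :
  Phi m.+1 (L + 1) lambda k i j =
  qp (L - j%:R + 1) * br (k%:R - lambda) * phi_pred m L (lambda + 1) k i j +
  qp (lambda - k%:R) * br k.+1%:R * Phi m L (lambda + 1) k.+1 i j.
Proof.
elim: k i j => [|k IH] i j; last first.
  apply: (mulfI (br_neq0 k heta)).
  have rk := Phi_recF heta m L (lambda + 1) k.+1 i j.
  case: j rk => [|j] rk.
    rewrite (Phi_recF heta) !IH /phi_pred.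
    apply: (lincomb (c := br k.+1%:R * qp (lambda - k.+1%:R)) (esym rk)).
    rewrite -(natr1 k.+1) -(natr1 k) /=; qfield.
  rewrite (Phi_recF heta) !IH /phi_pred.
  apply/eqP; rewrite -subr_eq0; apply/eqP.
  apply: (lincomb (c := br k.+1%:R * qp (lambda - k.+1%:R)) (esym rk)).
  have rk2 := Phi_recF heta m L (lambda + 1) k i j.
  apply/eqP; rewrite -subr_eq0; apply/eqP.
  apply: (lincomb (c := qp (L - j%:R + 1) * br (k%:R - lambda)) (esym rk2)).
  case: j {rk rk2} => [|j];
    rewrite -(natr1 k.+1) -(natr1 k) -?(natr1 j.+1) -?(natr1 j) /=; qfield.
rewrite -[X in _ = _ + X]mulrA (Phi_recF heta m L (lambda + 1) 0 i j) /phi_pred.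
rewrite mulr0n sub0r subr0.
case: i => [|i].
  rewrite mulr0n br0 mul0r add0r.
  case: j => [|j]; first by rewrite !Phi0_hw /= !mulr0 addr0.
  rewrite !Phi0_hw !add0n eqSS; case: eqP => [<-|_]; last by rewrite !mulr0 addr0.
  rewrite !mulr0n !mul0r qp0 !mul1r !addr0 !brn0 !mulr1 brnSr.
  set y := L - lambda - 2 * j%:R.
  have -> : - lambda + (L + 1) - 2 * j.+1%:R + 1 = y by rewrite /y -(natr1 j); ring.
  have -> : - (lambda + 1) + L - 2 * j%:R + 1 = y by rewrite /y; ring.
  set B := brn y j; clearbody B; rewrite /y -(natr1 j); qfield.
case: j => [|j].
  rewrite !Phi0_hw !addn0 eqSS !mulr0 add0r addr0; case: eqP => [<-|_]; last by rewrite !mulr0.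
  rewrite !brn0 brnSr !mulr1.
  set B := brn _ i; clearbody B; rewrite -(natr1 i).
  have -> : (i%:R + 1) * (lambda - (L + 1) + 2 * (i%:R + 1) - (i%:R + 1)) =
    i%:R * (lambda + 1 - L + 2 * i%:R - i%:R) + lambda - L by ring.
  rewrite !(qpD _ (_ * _ + _)) !(qpD _ (_ * _)).
  set X := qp (_ * (_ - _)); clearbody X; rewrite mulr1n; qfield.
rewrite !Phi0_hw !addSn !addnS !eqSS succnK; case: eqP => [<-|_]; last by rewrite !(mulr0, addr0).
clear m; set m := (i + j)%N.
have mE : m%:R = i%:R + j%:R :> C by rewrite natrD.
set W := lambda - L + 2 * m.+1%:R - i%:R.
set y := L - lambda - 2 * m.+1%:R + i%:R + 1.
have -> : i.+1%:R * (lambda - (L + 1) + 2 * m.+2%:R - i.+1%:R) = i%:R * W + W.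
  by rewrite /W -(natr1 m.+1) -(natr1 i); ring.
have -> : i.+1%:R * (lambda + 1 - L + 2 * m.+1%:R - i.+1%:R) = i%:R * W + W.
  by rewrite /W -(natr1 i); ring.
have -> : i%:R * (lambda + 1 - L + 2 * m.+1%:R - i%:R) = i%:R * W + i%:R.
  by rewrite /W; ring.
have -> : - lambda + (L + 1) - 2 * m.+2%:R + i.+1%:R + 1 = y.
  by rewrite /y -(natr1 m.+1) -(natr1 i); ring.
have -> : - (lambda + 1) + L - 2 * m.+1%:R + i.+1%:R + 1 = y.
  by rewrite /y -(natr1 i); ring.
have -> : - (lambda + 1) + L - 2 * m.+1%:R + i%:R + 1 = y - 1.
  by rewrite /y; ring.
rewrite (brnSr eta y) (brnS eta (y - 1)) subrK (brnSr eta j.+2%:R) (brnS eta j.+1%:R) natr1.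
set B := brn y j; set B2 := brn _ i; clearbody B B2.
rewrite !(qpD _ (i%:R * W)); set X := qp (i%:R * W); clearbody X.
rewrite /y /W -(natr1 m) mE -(natr1 j.+1) -(natr1 j) -(natr1 i); qfield.
Qed.
End TwistedFusion.

(** * Intertwiners as operators on coordinates *)

Section IntertwinerOperators.
Variables (R : realType) (eta : R[i]).
Hypothesis heta : 0 < complex.Im eta.
Local Notation C := R[i].
Local Notation qp := (qp eta).
Local Notation br := (br eta).
Local Notation Phi := (Phi eta).

(** The component along [u_j] of the intertwiner, as a linear map on coordinate
    functions of the Verma module: [f] is the argument, the result is read at
    [i]. By [Phi_support] the sum is exhaustive. *)
Definition phi_op (m : nat) (L lambda : C) (j : nat) (f : nat -> C) (i : nat) : C :=
  \sum_(k < (i + j).+1) f k * Phi m L lambda k i j.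

Lemma phi_op_wide B m L lambda j f i : (i + j < B)%N ->
  phi_op m L lambda j f i = \sum_(k < B) f k * Phi m L lambda k i j.
Proof.
move=> hB; rewrite /phi_op (big_ord_widen B (fun k => f k * Phi m L lambda k i j))//.
rewrite big_mkcond; apply: eq_bigr => k _ /=; case: ltnP => // hk.
rewrite Phi_support ?mulr0// => e.
by lia.
Qed.

Lemma phi_op_linear (I : Type) (r : seq I) (a : I -> C) (f : I -> nat -> C) m L lambda j i :
  phi_op m L lambda j (fun k => \sum_(p <- r) a p * f p k) i =
  \sum_(p <- r) a p * phi_op m L lambda j (f p) i.
Proof.
rewrite /phi_op; under eq_bigr do rewrite big_distrl.
rewrite exchange_big /=; apply: eq_bigr => p _.
by rewrite big_distrr /=; apply: eq_bigr => k _; rewrite mulrA.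
Qed.

Lemma eq_phi_op m L lambda j f g i : f =1 g ->
  phi_op m L lambda j f i = phi_op m L lambda j g i.
Proof. by move=> e; apply: eq_bigr => k _; rewrite e. Qed.

Lemma phi_op_scale m L lambda j a f i :
  phi_op m L lambda j (fun k => a * f k) i = a * phi_op m L lambda j f i.
Proof. by rewrite /phi_op big_distrr /=; apply: eq_bigr => k _; rewrite mulrA. Qed.

Lemma phi_op_zero m L lambda j i : phi_op m L lambda j (fun=> 0) i = 0.
Proof. by rewrite /phi_op big1// => k _; rewrite mul0r. Qed.

(** For weight and index 0 the intertwiner is the identity; it starts the
    computation of weight 1 by fusion. *)
Lemma Phi_trivial lambda k i j : Phi 0 0 lambda k i j = ((i == k) && (j == 0%N))%:R.
Proof.
elim: k i j => [|k IH] i j.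
  rewrite Phi0_hw; case: i => [|i]; case: j => [|j] //=.
  by rewrite !brn0 mul0r qp0 !mulr1.
apply: (mulfI (br_neq0 k heta)); rewrite Phi_recF// !IH.
case: j => [|j] /=; last first.
  rewrite IH !andbF !mulr0 add0r.
  case: j => [|j]; last by rewrite andbF mulr0.
  by rewrite subr0 br0 mul0r.
case: i => [|i]; first by rewrite br0 !mulr0 mul0r addr0.
rewrite mulr0 subr0 oppr0 qp0 mul1r addr0 !andbT succnK.
by case: eqP => [->|]//; rewrite !mulr0.
Qed.

Lemma Phi1_0 lambda k i j : Phi 0 1 lambda k i j =
  match j with
  | 0 => (i == k)%:R * qp (- k%:R)
  | 1 => (i.+1 == k)%:R
  | _ => 0
  end.
Proof.
(* Weight 1 is fused from the weights 0 and 1. *)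
rewrite -[X in Phi _ X](add0r 1) Phi_fuse0// Phi_trivial /phi_pred.
case: j => [|j]; first by rewrite andbT mulrC; case: k => [|k]; rewrite ?mulr0 addr0.
rewrite andbF mulr0 add0r; case: k => [|k]; first by case: j.
rewrite Phi_trivial eqSS; case: j => [|j]; last by rewrite andbF mulr0.
by rewrite andbT sub0r addNr qp0 mul1r.
Qed.

Lemma Phi1_1 lambda k i j : Phi 1 1 lambda k i j =
  match j with
  | 0 => (i == k.+1)%:R * (qp (lambda - k%:R) * br k.+1%:R)
  | 1 => (i == k)%:R * br (k%:R - lambda)
  | _ => 0
  end.
Proof.
rewrite -[X in Phi _ X](add0r 1) Phi_fuse1// Phi_trivial /phi_pred.
case: j => [|j]; first by rewrite andbT mulr0 add0r mulrC.
rewrite andbF mulr0 addr0 Phi_trivial; case: j => [|j]; last by rewrite andbF mulr0.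
by rewrite andbT sub0r addNr qp0 mul1r mulrC.
Qed.

Let sum_delta (f : nat -> C) B i : (i < B)%N ->
  \sum_(k < B) f k * (i == k)%:R = f i.
Proof.
move=> hi; rewrite (bigD1 (Ordinal hi)) //= eqxx mulr1 big1 ?addr0// => k hk.
by case: eqP => [e|]; rewrite ?mulr0//; case/eqP: hk; apply: val_inj.
Qed.

Lemma phi_op1_00 lambda f i : phi_op 0 1 lambda 0 f i = qp (- i%:R) * f i.
Proof.
rewrite (@phi_op_wide i.+1) ?addn0//.
under eq_bigr do rewrite Phi1_0 [_ * qp _]mulrC mulrA.
by rewrite (sum_delta (fun k => f k * qp (- k%:R))) ?ltnS// mulrC.
Qed.

Lemma phi_op1_01 lambda f i : phi_op 0 1 lambda 1 f i = f i.+1.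
Proof.
rewrite (@phi_op_wide i.+2) ?addn1//.
by under eq_bigr do rewrite Phi1_0; rewrite sum_delta.
Qed.

Lemma phi_op1_10 lambda f i :
  phi_op 1 1 lambda 0 f i = qp (lambda - i%:R + 1) * br i%:R * f i.-1.
Proof.
case: i => [|i]; first by rewrite /phi_op big_ord1 Phi1_1 /= br0 !(mul0r, mulr0).
rewrite (@phi_op_wide i.+2) ?addn0//.
under eq_bigr do rewrite Phi1_1.
transitivity (\sum_(k < i.+2) (f k * (qp (lambda - k%:R) * br k.+1%:R)) * (i == k)%:R).
  by apply: eq_bigr => k _; rewrite -mulrA; congr (_ * _); rewrite mulrC.
rewrite (sum_delta (fun k => f k * (qp (lambda - k%:R) * br k.+1%:R))) ?leqnSn//=.
rewrite mulrC; congr (qp _ * _ * _); rewrite -natr1; ring.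
Qed.

Lemma phi_op1_11 lambda f i : phi_op 1 1 lambda 1 f i = br (i%:R - lambda) * f i.
Proof.
rewrite (@phi_op_wide i.+2) ?addn1//.
under eq_bigr do rewrite Phi1_1 [_ * br _]mulrC mulrA.
by rewrite (sum_delta (fun k => f k * br (k%:R - lambda))) ?ltnS// mulrC.
Qed.

Lemma phi_op1_ge2 m lambda j f i : (m <= 1)%N -> (1 < j)%N -> phi_op m 1 lambda j f i = 0.
Proof.
by case: m => [|[|m]]// _; case: j => [|[|j]]// _; rewrite /phi_op big1// => k _;
  rewrite ?Phi1_0 ?Phi1_1 mulr0.
Qed.

(** Coefficients of the projection of [u_(j-b) (x) u_b] to [u_j], under which
    the composites for weights [L] and [1] fuse to the one of weight [L + 1]. *)
Definition fuse_coef (L : C) (j b : nat) : C :=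
  (b <= j)%:R * qp ((L - (j%:R - b%:R)) * b%:R).

Lemma fuse_coef0 L j : fuse_coef L j 0 = 1.
Proof. by rewrite /fuse_coef mulr0 qp0 mulr1. Qed.

Lemma fuse_coef1 L j : fuse_coef L j.+1 1 = qp (L - j%:R).
Proof. by rewrite /fuse_coef mul1r -natr1 addrK mulr1. Qed.

(** The intertwiner of weight [L + 1] is the composite of those of weights 1 and
    [L], followed by the projection with coefficients [fuse_coef]. Only the
    components 0 and 1 of the weight 1 factor contribute. *)
Lemma phi_op_fuse m1 m2 L lambda j f i : (m2 <= 1)%N ->
  phi_op (m1 + m2) (L + 1) lambda j f i =
  \sum_(b < 2) fuse_coef L j b *
    phi_op m1 L (lambda - (1 - 2 * m2%:R)) (j - b) (phi_op m2 1 lambda b f) i.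
Proof.
move=> hm2; rewrite big_ord_recl big_ord1 fuse_coef0 mul1r subn0 /= /bump /= addn0.
case: m2 hm2 => [|[|m2]]// _; rewrite ?addn0 ?addn1 ?mulr0 ?mulr1 ?subr0.
  rewrite (eq_phi_op _ _ _ _ _ (phi_op1_00 _ _)) (eq_phi_op _ _ _ _ _ (phi_op1_01 _ _)).
  rewrite /phi_op; under eq_bigr do rewrite Phi_fuse0// mulrDr.
  rewrite big_split /=; congr (_ + _).
    by apply: eq_bigr => k _; rewrite mulrCA mulrA.
  case: j => [|j].
    rewrite /fuse_coef !mul0r big1// => k _; case: (k : nat) => [|k']; by rewrite !mulr0.
  rewrite addnS big_ord_recl mulr0 add0r fuse_coef1 subn1 /= big_distrr /=.
  apply: eq_bigr => k _; rewrite mulrCA; congr (qp _ * _).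
  by rewrite -natr1; ring.
have -> : lambda - (1 - 2) = lambda + 1 by ring.
rewrite (eq_phi_op _ _ _ _ _ (phi_op1_10 _ _)) (eq_phi_op _ _ _ _ _ (phi_op1_11 _ _)).
rewrite {1}/phi_op; under eq_bigr do rewrite Phi_fuse1// mulrDr.
rewrite big_split /= addrC; congr (_ + _).
  rewrite (@phi_op_wide (i + j).+2)// [RHS]big_ord_recl /= mulr0n br0 mulr0 !mul0r add0r.
  apply: eq_bigr => k _; rewrite /bump /= add1n mulrCA !mulrA; congr (_ * _ * _ * _).
  by congr (qp _ * _ / _); rewrite -natr1; ring.
case: j => [|j].
  by rewrite /fuse_coef !mul0r big1// => k _; rewrite !mulr0.
rewrite (@phi_op_wide (i + j.+1).+1) ?subn1 ?addnS// fuse_coef1 big_distrr /=.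
apply: eq_bigr => k _; rewrite /phi_pred -natr1.
by rewrite (_ : L - (j%:R + 1) + 1 = L - j%:R); [ring|ring].
Qed.
End IntertwinerOperators.

(** * Matrix elements of the quantum R-matrix *)

Section QuantumRCoefficients.
Variables (R : realType) (eta : R[i]).
Hypothesis heta : 0 < complex.Im eta.
Local Notation C := R[i].
Local Notation qp := (qp eta).
Local Notation br := (br eta).
Local Notation brn := (brn eta).

Local Notation fuse_coef := (fuse_coef eta).

(** The coefficient of v^(j1 - s) (x) v^(j2 + s) in the image of v^(j1) (x)
    v^(j2) under the quantum R-matrix, see [qRmatrixE]. *)
Definition rcoef (L1 L2 : C) (j1 j2 s : nat) : C :=
  qp (- (j1%:R * L2) - j2%:R * L1 + 2 * (j1%:R * j2%:R)) *
  (qp (s%:R * (s%:R - 1) / 2) * (qp 1 - qp (- 1)) ^+ s / brfact eta s) *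
  brn (L1 - j1%:R + 1) s * brn j2.+1%:R s.

Lemma iter_vermaE_bas L s m j :
  iter s (actE (verma eta L)) (bas R m) j =
  (j + s == m)%N%:R * brn (L - j%:R - s%:R + 1) s.
Proof.
elim: s j => [|s IH] j; first by rewrite brn0 mulr1 addn0.
rewrite iterS /= IH addSnnS mulrCA; congr (_ * _).
rewrite brnSr mulrC -(natr1 j) -(natr1 s); congr (brn _ _ * br _); ring.
Qed.

Lemma iter_vermaF_bas L s m j :
  iter s (actF (verma eta L)) (bas R m) j =
  (j == m + s)%N%:R * brn m.+1%:R s.
Proof.
elim: s j => [|s IH] j; first by rewrite addn0 brn0 mulr1.
rewrite iterS /=; case: j => [|j]; first by rewrite addnS mul0r.
rewrite IH addnS eqSS; case: eqP => [->|_]; last by rewrite !mul0r ?mulr0.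
rewrite !mul1r brnSr mulrC; congr (_ * br _).
by rewrite -!natr1 natrD; ring.
Qed.

Lemma qRmatrixE (L1 L2 : C) m1 m2 n1 n2 : qRmatrix eta L1 L2 m1 m2 n1 n2 =
  if (n1 <= m1)%N && (n2 == m2 + (m1 - n1))%N then rcoef L1 L2 m1 m2 (m1 - n1) else 0.
Proof.
rewrite /qRmatrix.
have [hn|hn] := leqP n1 m1; last first.
  rewrite big1 ?mulr0 ?mul0r// => s _; rewrite iter_vermaE_bas.
  have -> : (n1 + s == m1)%N = false by lia.
  by rewrite !mul0r mulr0.
have hs : (m1 - n1 < m1.+1)%N by lia.
rewrite (bigD1 (Ordinal hs)) //= big1 ?addr0; last first.
  move=> s /eqP hs'; rewrite iter_vermaE_bas.
  have -> : (n1 + s == m1)%N = false.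
    by apply/eqP => e; apply: hs'; apply: val_inj; rewrite /=; lia.
  by rewrite !mul0r mulr0.
rewrite iter_vermaE_bas (iter_vermaF_bas L2) subnKC// eqxx mul1r.
case: eqP => _; last by rewrite mul0r !mulr0 mul0r.
rewrite /rcoef mul1r natrB// (_ : L1 - n1%:R - (m1%:R - n1%:R) + 1 = L1 - m1%:R + 1); last by ring.
have -> : - (m1%:R * L2) - m2%:R * L1 + 2 * (m1%:R * m2%:R) =
  - (L1 * L2 / 2) + (L1 - 2 * m1%:R) * (L2 - 2 * m2%:R) / 2 by field.
by rewrite [in RHS]qpD; ring.
Qed.

Lemma qp_binS (s : nat) : qp (s.+1%:R * (s.+1%:R - 1) / 2) = qp (s%:R * (s%:R - 1) / 2) * qp s%:R.
Proof. by rewrite -qpD; congr qp; rewrite -natr1; field. Qed.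

Lemma brfactS s : brfact eta s.+1 = brfact eta s * br s.+1%:R.
Proof. by rewrite /brfact brnSr nat1r. Qed.

Lemma rcoef0 L1 L2 j1 j2 :
  rcoef L1 L2 j1 j2 0 = qp (- (j1%:R * L2) - j2%:R * L1 + 2 * (j1%:R * j2%:R)).
Proof. by rewrite /rcoef !mul0r qp0 expr0 /brfact !brn0 invr1 !mulr1. Qed.

Lemma rcoefS L1 L2 j1 j2 s : rcoef L1 L2 j1 j2 s.+1 =
  rcoef L1 L2 j1 j2 s * (qp s%:R * (qp 1 - qp (- 1)) / br s.+1%:R) *
  br (L1 - j1%:R + 1 + s%:R) * br (j2.+1%:R + s%:R).
Proof.
rewrite /rcoef qp_binS exprS brfactS !brnSr.
have h1 := br_neq0 s heta; have h2 := brfact_neq0 s heta.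
by field; rewrite h1 h2.
Qed.

Lemma qp2_neq1 s : qp s.+1%:R * qp s.+1%:R - 1 != 0.
Proof.
have h := br_neq0 s heta; apply: contra h => /eqP h.
have q0 := qp_neq0 eta s.+1%:R.
rewrite (br_num heta) (_ : qp s.+1%:R - _ = (qp s.+1%:R * qp s.+1%:R - 1) / qp s.+1%:R); last by field.
by rewrite h !mul0r.
Qed.

Local Notation qden s := (qp s%:R * (qp 1 - qp (- 1)) / br s.+1%:R).

(** Raising the number [s] of transferred units together with the first index
    multiplies the coefficient by an elementary factor; the next lemmas vary the
    other arguments in the same way. The hexagon identities below reduce to such
    ratios. *)
Lemma rcoefSS L1 L2 j c s : rcoef L1 L2 j.+1 c s.+1 =
  rcoef L1 L2 j c s * qp (2 * c%:R - L2) * qden s * br (L1 - j%:R) * br (c%:R + 1 + s%:R).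
Proof.
rewrite /rcoef qp_binS exprS brfactS.
rewrite (_ : L1 - j.+1%:R + 1 = L1 - j%:R); last by rewrite -natr1; ring.
rewrite (brnS eta (L1 - j%:R)) [brn c.+1%:R s.+1]brnSr.
have -> : - (j.+1%:R * L2) - c%:R * L1 + 2 * (j.+1%:R * c%:R) =
  - (j%:R * L2) - c%:R * L1 + 2 * (j%:R * c%:R) + (2 * c%:R - L2) by rewrite -(natr1 j); ring.
rewrite [in LHS]qpD natr1.
have h1 := br_neq0 s heta; have h2 := brfact_neq0 s heta.
by field; rewrite h1 h2.
Qed.

(** The variant of [rcoefSS] in which one unit is taken from the second index. *)
Lemma rcoefSS' L1 L2 j c s : rcoef L1 L2 j.+1 c s.+1 =
  rcoef L1 L2 j c.+1 s * qp (2 * c%:R - L2 + L1 - 2 * j%:R) * qden s *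
  br (L1 - j%:R) * br (c%:R + 1).
Proof.
rewrite /rcoef qp_binS exprS brfactS.
rewrite (_ : L1 - j.+1%:R + 1 = L1 - j%:R); last by rewrite -natr1; ring.
rewrite (brnS eta (L1 - j%:R)) (brnS eta c.+1%:R) natr1.
have -> : - (j.+1%:R * L2) - c%:R * L1 + 2 * (j.+1%:R * c%:R) =
  - (j%:R * L2) - c.+1%:R * L1 + 2 * (j%:R * c.+1%:R) + (2 * c%:R - L2 + L1 - 2 * j%:R).
  by rewrite -(natr1 j) -(natr1 c); ring.
rewrite [in LHS]qpD natr1.
have h1 := br_neq0 s heta; have h2 := brfact_neq0 s heta.
by field; rewrite h1 h2.
Qed.

Lemma rcoef_weight2 L1 L2 j c s : rcoef L1 (L2 + 1) j c s = rcoef L1 L2 j c s * qp (- j%:R).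
Proof.
rewrite /rcoef (_ : - (j%:R * (L2 + 1)) - c%:R * L1 + 2 * (j%:R * c%:R) =
  - (j%:R * L2) - c%:R * L1 + 2 * (j%:R * c%:R) - j%:R); last by ring.
by rewrite qpD; ring.
Qed.

Lemma rcoef_weight1 L1 L2 j c s :
  rcoef (L1 + 1) L2 j.+1 c s = rcoef L1 L2 j c s * qp (c%:R - L2).
Proof.
rewrite /rcoef (_ : L1 + 1 - j.+1%:R + 1 = L1 - j%:R + 1); last by rewrite -natr1; ring.
rewrite (_ : - (j.+1%:R * L2) - c%:R * (L1 + 1) + 2 * (j.+1%:R * c%:R) =
  - (j%:R * L2) - c%:R * L1 + 2 * (j%:R * c%:R) + (c%:R - L2)); last first.
  by rewrite -(natr1 j); ring.
by rewrite qpD; ring.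
Qed.

Lemma rcoef_first L1 L2 c : rcoef L1 L2 1 c 1 =
  qp (2 * c%:R - L2 - c%:R * L1) * (qp 1 - qp (- 1)) * br L1 * br (c%:R + 1).
Proof.
rewrite rcoefSS rcoef0 -qpD mulr0n qp0 mulr1n (br1 heta) divr1 mul1r subr0 addr0.
by congr (qp _ * _ * _ * _); ring.
Qed.

Lemma qp2_neq1' s : qp s%:R * qp 1 * (qp s%:R * qp 1) - 1 != 0.
Proof. by rewrite -qpD natr1 qp2_neq1. Qed.

(** This identity and the next two are the matrix elements of the statement that
    fusing the first factor from weights [L] and 1 turns the product of the two
    quantum R-matrices into the one of weight [L + 1]. Dividing by a common
    coefficient [rcoef] leaves at most a rational identity in exponentials. *)
Lemma hexagon_left_coef0 L L3 j c : rcoef L L3 j c 0 * rcoef 1 L3 0 c 0 = rcoef (L + 1) L3 j c 0.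
Proof. by rewrite !rcoef0 -qpD; congr qp; ring. Qed.

Lemma hexagon_left_coef2 L L3 j c s :
  qp (L - j%:R) * rcoef L L3 j c s * rcoef 1 L3 1 (c + s) 0 =
  rcoef (L + 1) L3 j.+1 c s * qp (L - j%:R + s%:R).
Proof.
rewrite rcoef_weight1 rcoef0.
have e : qp (L - j%:R) * qp (- (1 * L3) - (c + s)%:R * 1 + 2 * (1 * (c + s)%:R)) =
    qp (c%:R - L3) * qp (L - j%:R + s%:R).
  by rewrite -!qpD natrD; congr qp; ring.
apply: (lincomb (c := rcoef L L3 j c s) e); ring.
Qed.

Lemma hexagon_left_coef1 L L3 j c s :
  rcoef L L3 j.+1 c s.+1 * rcoef 1 L3 0 (c + s.+1) 0 +
  qp (L - j%:R) * rcoef L L3 j c s * rcoef 1 L3 1 (c + s) 1 =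
  rcoef (L + 1) L3 j.+1 c s.+1.
Proof.
rewrite rcoef_weight1 [rcoef _ _ j c s.+1]rcoefS rcoefSS rcoef_first rcoef0.
have h := qp2_neq1' s; rewrite -(natr1 s).
set S := rcoef _ _ _ _ _; clearbody S.
rewrite addnS -(natr1 (c + s)) natrD -(natr1 c) mulr0n !mul0r !mulr0 (br1 heta) !mulr1.
rewrite !(br_num heta) !(qpD, qpN, qp_double, qp0).
by field; rewrite ?qp_neq0 ?(qp1_sq_neq1 heta) ?h.
Qed.

(** The corresponding matrix elements for fusion in the second factor. *)
Lemma hexagon_right_coef0 L1 L j c s : rcoef L1 1 j 0 0 * rcoef L1 L j c s = rcoef L1 (L + 1) j c s.
Proof.
rewrite rcoef_weight2 mulrC rcoef0; congr (_ * qp _).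
by rewrite mulr0n; ring.
Qed.

Lemma hexagon_right_coef1 L1 L j c :
  qp (L - c%:R) * (rcoef L1 1 j 1 0 * rcoef L1 L j c 0) =
  rcoef L1 (L + 1) j c.+1 0 * qp (L - c%:R).
Proof. by rewrite !rcoef0 -!qpD; congr qp; rewrite -(natr1 c); ring. Qed.

Lemma hexagon_right_coef2 L1 L j s :
  rcoef L1 1 j.+1 0 1 * rcoef L1 L j 0 s = rcoef L1 (L + 1) j.+1 0 s.+1 * qp (L - s%:R).
Proof.
rewrite rcoef_weight2 rcoefSS rcoefSS rcoef0.
have h := qp2_neq1' s; rewrite -(natr1 s).
set S := rcoef _ _ _ _ _; clearbody S.
rewrite -(natr1 j) mulr0n !(mulr0, mul0r, add0r, addr0, mul1r, mulr1, subr0).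
rewrite !(br_num heta) !(qpD, qpN, qp_double, qp0).
by field; rewrite ?qp_neq0 ?(qp1_sq_neq1 heta) ?h.
Qed.

Lemma hexagon_right_coef3 L1 L j c s :
  rcoef L1 1 j.+1 0 1 * rcoef L1 L j c.+1 s +
  qp (L - c%:R) * (rcoef L1 1 j.+1 1 0 * rcoef L1 L j.+1 c s.+1) =
  rcoef L1 (L + 1) j.+1 c.+1 s.+1 * qp (L - (c + s.+1)%:R).
Proof.
rewrite rcoef_weight2 (rcoefSS _ _ _ c.+1) rcoefSS (rcoefSS' _ _ _ c) !rcoef0.
have h := qp2_neq1' s; rewrite -(natr1 s).
set S := rcoef _ _ _ _ _; clearbody S.
rewrite natrD -?(natr1 s) -(natr1 c) -(natr1 j) mulr0n !(mulr0, mul0r, add0r, addr0, mul1r, mulr1, subr0).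
rewrite !(br_num heta) !(qpD, qpN, qp_double, qp0).
by field; rewrite ?qp_neq0 ?(qp1_sq_neq1 heta) ?h.
Qed.
End QuantumRCoefficients.

(** * Exchange relation and hexagon identities *)

Section Hexagons.
Variables (R : realType) (eta : R[i]).
Hypothesis heta : 0 < complex.Im eta.
Local Notation C := R[i].

Local Notation phi_op := (phi_op eta).
Local Notation fuse_coef := (fuse_coef eta).
Local Notation rcoef := (rcoef eta).

(** The permutation of two intertwiners. On the left the intertwiner of weight
    [L2] is applied last and the coefficients [r] are those of a dynamical
    R-matrix, with [p] and [n1 + n2 - p] the indices of the two intertwiners; on
    the right the order is reversed and the quantum R-matrix acts on the
    components. *)
Definition exchange (r : nat -> C) (L1 L2 : C) (n1 n2 : nat) (lam : C) : Prop :=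
  forall f i j1 j2,
  \sum_(p < (n1 + n2).+1) r p *
    phi_op (n1 + n2 - p) L2 (lam - (L1 - 2 * p%:R)) j2 (phi_op p L1 lam j1 f) i =
  \sum_(s < j1.+1) rcoef L1 L2 j1 j2 s *
    phi_op n1 L1 (lam - (L2 - 2 * n2%:R)) (j1 - s) (phi_op n2 L2 lam (j2 + s) f) i.

Let big2 (g : nat -> C) : \sum_(b < 2) g b = g 0%N + g 1%N.
Proof. by rewrite big_ord_recl big_ord1. Qed.

Lemma fuse_coef_out L : fuse_coef L 0%N 1%N = 0.
Proof. by rewrite /fuse_coef mul0r. Qed.

(** The three coefficient identities assembled into sums. The arbitrary [X]
    stands for the components of a composite of three intertwiners. *)
Lemma hexagon_left L L3 j c (X : nat -> nat -> nat -> C) :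
  \sum_(b < 2) fuse_coef L j b * (\sum_(s < (j - b).+1) rcoef L L3 (j - b) c s *
     \sum_(t < b.+1) rcoef 1 L3 b (c + s)%N t * X (j - b - s)%N (b - t)%N (c + s + t)%N) =
  \sum_(s < j.+1) rcoef (L + 1) L3 j c s *
     \sum_(b < 2) fuse_coef L (j - s) b * X (j - s - b)%N b (c + s)%N.
Proof.
rewrite (big2 (fun b => fuse_coef L j b * (\sum_(s < (j - b).+1) rcoef L L3 (j - b) c s *
     \sum_(t < b.+1) rcoef 1 L3 b (c + s)%N t * X (j - b - s)%N (b - t)%N (c + s + t)%N))).
under [RHS]eq_bigr => s _ do
  rewrite (big2 (fun b => fuse_coef L (j - s) b * X (j - s - b)%N b (c + s)%N)).
under [RHS]eq_bigr => s _ do rewrite mulrDr fuse_coef0 mul1r subn0.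
rewrite fuse_coef0 mul1r subn0.
under [X in X + _]eq_bigr => s _ do rewrite big_ord1 subn0 addn0.
case: j => [|j].
  rewrite fuse_coef_out mul0r addr0 !big_ord1 /= mul0r mulr0 addr0 mulrA !addn0.
  by rewrite hexagon_left_coef0.
rewrite fuse_coef1 subn1 /=.
under [X in _ + _ * X]eq_bigr => s _ do
  rewrite (big2 (fun t => rcoef 1 L3 1%N (c + s)%N t * X (j - s)%N (1 - t)%N (c + s + t)%N))
  mulrDr addn0 subnn subn0.
rewrite big_split /= mulrDr addrCA addrC big_split /=; congr (_ + _); last first.
  rewrite big_distrr /= [RHS]big_ord_recr /= subnn fuse_coef_out mul0r mulr0 addr0.
  apply: eq_bigr => s _; have hs := ltn_ord s.
  rewrite subSn; last by lia.
  rewrite fuse_coef1 subn1 /= [RHS]mulrA.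
  have -> : L - (j - s)%:R = L - j%:R + s%:R by rewrite natrB; [ring|lia].
  have e := hexagon_left_coef2 eta L L3 j c s.
  rewrite -e; set a := rcoef _ _ _ _ _; set b := rcoef _ _ _ _ _; set x := X _ _ _.
  by clearbody a b x; ring.
rewrite [RHS]big_ord_recl [in LHS]big_ord_recl /= addn0 subn0 mulrA hexagon_left_coef0 -addrA; congr (_ + _).
rewrite big_distrr -big_split /=; apply: eq_bigr => s _.
have e := hexagon_left_coef1 heta L L3 j c s.
rewrite /bump /= add1n subSS [(c + s + 1)%N]addn1 addnS -e addnS.
set a := rcoef _ _ _ _ _; set b := rcoef _ _ _ _ _.
set a' := rcoef _ _ _ _ _; set b' := rcoef _ _ _ _ _; set x := X _ _ _.
by clearbody a b a' b' x; ring.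
Qed.

(** In the second factor the component of weight 1 can be raised by the
    R-matrix; the hypothesis on [X] says that its components beyond 1 vanish. *)
Lemma hexagon_right L1 L j1 j2 (X : nat -> nat -> nat -> C) :
  (forall a b e, (1 < e)%N -> X a b e = 0) ->
  \sum_(b < 2) fuse_coef L j2 b * (\sum_(s < j1.+1) rcoef L1 1 j1 b s *
     \sum_(t < (j1 - s).+1) rcoef L1 L (j1 - s) (j2 - b) t *
        X (j1 - s - t)%N (j2 - b + t)%N (b + s)%N) =
  \sum_(s < j1.+1) rcoef L1 (L + 1) j1 j2 s *
     \sum_(b < 2) fuse_coef L (j2 + s)%N b * X (j1 - s)%N (j2 + s - b)%N b.
Proof.
move=> hX.
rewrite (big2 (fun b => fuse_coef L j2 b * (\sum_(s < j1.+1) rcoef L1 1 j1 b s *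
     \sum_(t < (j1 - s).+1) rcoef L1 L (j1 - s) (j2 - b) t *
        X (j1 - s - t)%N (j2 - b + t)%N (b + s)%N))).
under [RHS]eq_bigr => s _ do
  rewrite (big2 (fun b => fuse_coef L (j2 + s)%N b * X (j1 - s)%N (j2 + s - b)%N b))
  mulrDr fuse_coef0 mul1r subn0.
rewrite fuse_coef0 mul1r big_split /= subn0.
have -> : \sum_(s < j1.+1) rcoef L1 1 j1 1%N s *
     (\sum_(t < (j1 - s).+1) rcoef L1 L (j1 - s) (j2 - 1)%N t *
        X (j1 - s - t)%N (j2 - 1 + t)%N (1 + s)%N) =
   rcoef L1 1 j1 1%N 0%N * \sum_(t < j1.+1) rcoef L1 L j1 (j2 - 1)%N t * X (j1 - t)%N (j2 - 1 + t)%N 1%N.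
  rewrite big_ord_recl [X in _ + X]big1 ?addr0 ?subn0// => s _.
  by rewrite big1 ?mulr0// => t _; rewrite hX ?mulr0.
rewrite [in LHS]big_ord_recl /= add0n subn0 -addrA; congr (_ + _).
  rewrite big_distrr /=; apply: eq_bigr => s _.
  by rewrite mulrA (hexagon_right_coef0 eta L1 L).
case: j1 => [|j1].
  rewrite big_ord0 add0r !big_ord1 !addn0 subnn.
  case: j2 => [|j2]; first by rewrite fuse_coef_out !mul0r mulr0.
  have e := hexagon_right_coef1 eta L1 L 0 j2.
  rewrite fuse_coef1 subn1 /= [RHS]mulrA -e.
  set a := rcoef _ _ _ _ _; set b := rcoef _ _ _ _ _; set x := X _ _ _.
  by clearbody a b x; ring.
have -> : \sum_(i < j1.+1) rcoef L1 1 j1.+1 0%N (bump 0 i) *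
    (\sum_(t < (j1.+1 - bump 0 i).+1) rcoef L1 L (j1.+1 - bump 0 i) j2 t *
       X (j1.+1 - bump 0 i - t)%N (j2 + t)%N (0 + bump 0 i)%N) =
   rcoef L1 1 j1.+1 0%N 1%N * \sum_(t < j1.+1) rcoef L1 L j1 j2 t * X (j1 - t)%N (j2 + t)%N 1%N.
  rewrite big_ord_recl [X in _ + X]big1 ?addr0 /bump /= ?add1n ?subn1// => s _.
  by rewrite big1 ?mulr0// => t _; rewrite hX ?mulr0.
rewrite [in RHS]big_ord_recl /= addn0 subn0.
rewrite big_distrr /=.
case: j2 => [|j2].
  rewrite !fuse_coef_out !mul0r addr0 mulr0 add0r; apply: eq_bigr => s _.
  have e := hexagon_right_coef2 heta L1 L j1 s.
  by rewrite mulrA e add0n /bump /= add1n subSS fuse_coef1 subn1 -mulrA.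
rewrite !fuse_coef1 subn1 /= [in X in _ + X]big_ord_recl /= addn0 subn0 !(mulrDr (rcoef _ _ _ _ _)) mulrDr addrCA.
have e1 := hexagon_right_coef1 eta L1 L j1.+1 j2.
congr (_ + _).
  rewrite [RHS]mulrA -e1.
  set a := rcoef _ _ _ _ _; set b := rcoef _ _ _ _ _; set x := X _ _ _.
  by clearbody a b x; ring.
rewrite !big_distrr -big_split /=; apply: eq_bigr => s _.
have e := hexagon_right_coef3 heta L1 L j1 j2 s.
rewrite /bump /= add1n subSS addSn fuse_coef1 subn1 /= [RHS]mulrA -e addnS.
set a := rcoef _ _ _ _ _; set b := rcoef _ _ _ _ _; set x := X _ _ _.
set a' := rcoef _ _ _ _ _; set b' := rcoef _ _ _ _ _.
by clearbody a b a' b' x; ring.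
Qed.

End Hexagons.

(** * Exchange relation for two weights equal to one *)

Section VectorRepresentations.
Variables (R : realType) (eta : R[i]).
Hypothesis heta : 0 < complex.Im eta.
Local Notation C := R[i].
Local Notation qp := (qp eta).
Local Notation br := (br eta).

Local Notation phi_op := (phi_op eta).
Local Notation rcoef := (rcoef eta).
Local Notation exchange := (exchange eta).

(** For weight 1 only the components 0 and 1 exist. The one term not excluded by
    this has [j1 = 2], and there the quantum R-matrix element vanishes since it
    contains the bracket of 0. *)
Lemma exchange_zero n1 n2 lam lam' f i j1 j2 : (n1 <= 1)%N -> (n2 <= 1)%N ->
  (1 < j1)%N || (1 < j2)%N ->
  \sum_(s < j1.+1) rcoef 1 1 j1 j2 s *
    phi_op n1 1 lam' (j1 - s) (phi_op n2 1 lam (j2 + s) f) i = 0.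
Proof.
move=> h1 h2 hj; apply: big1 => s _.
have [hs|hs] := ltnP 1 (j2 + s).
  by rewrite (eq_phi_op _ _ _ _ _ _ (fun k => phi_op1_ge2 heta lam f k h2 hs)) phi_op_zero mulr0.
have [hs'|hs'] := ltnP 1 (j1 - s); first by rewrite phi_op1_ge2// mulr0.
have [e1 -> ->] : [/\ j1 = 2, j2 = 0 & nat_of_ord s = 1]%N by split; lia.
by rewrite e1 rcoefSS// subrr br0 !(mulr0, mul0r).
Qed.

Lemma rcoef1_1 c : rcoef 1 1 1%N c 1%N = qp (c%:R - 1) * (qp 1 - qp (- 1)) * br (c%:R + 1).
Proof. by rewrite rcoef_first// br1// mulr1; congr (qp _ * _ * _); ring. Qed.

Lemma phi_op1_0_ge2 lam j f i : phi_op 0 1 lam j.+2 f i = 0.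
Proof. exact: phi_op1_ge2. Qed.

Lemma phi_op1_1_ge2 lam j f i : phi_op 1 1 lam j.+2 f i = 0.
Proof. exact: phi_op1_ge2. Qed.

(* Everything is explicit here: the components are given by [phi_op1_00] to
   [phi_op1_11], and the claim is an identity between exponentials. *)
Ltac base_case i :=
  rewrite ?big_ord_recl ?big_ord0 /= /bump /= ?subnn ?subn0 ?addn0 ?add0n ?add1n ?addr0 ?rcoef0 ?rcoef1_1;
  rewrite ?(phi_op1_00 heta, phi_op1_01 heta, phi_op1_10 heta, phi_op1_11 heta,
     phi_op1_0_ge2, phi_op1_1_ge2);
  rewrite ?succnK -?(natr1 i.+1) -?(natr1 i);
  rewrite ?mulr0n ?br0 ?(mul0r, mulr0, mul1r, oppr0, add0r, addr0, subr0, sub0r, qp0);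
  rewrite ?(br_num heta) ?(qpD, qpN, qp_double, qp0); field;
  rewrite ?qp_neq0 ?(qp1_sq_neq1 heta) //=; assumption.

Lemma exchange_base00 (r : nat -> C) lam : r 0%N = 1 -> exchange r 1 1 0 0 lam.
Proof.
move=> r0 f i j1 j2; rewrite big_ord1 r0 mul1r /=.
have [hj|] := boolP ((1 < j1)%N || (1 < j2)%N).
  rewrite exchange_zero//; case/orP: hj => hj; last by rewrite phi_op1_ge2.
  by rewrite (eq_phi_op _ _ _ _ _ _ (fun k => phi_op1_ge2 heta lam f k (isT : (0 <= 1)%N) hj)) phi_op_zero.
case: j1 => [|[|j1]] //; case: j2 => [|[|j2]]// _; base_case i.
Qed.

Lemma exchange_base11 (r : nat -> C) lam : r 0%N = 0 -> r 1%N = 1 -> r 2 = 0 ->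
  exchange r 1 1 1 1 lam.
Proof.
move=> r0 r1 r2 f i j1 j2; rewrite ![in LHS]big_ord_recl [in LHS]big_ord0 addr0 r0 r1 r2 !mul0r add0r addr0 mul1r.
rewrite /bump /=.
have [hj|] := boolP ((1 < j1)%N || (1 < j2)%N).
  rewrite exchange_zero//; case/orP: hj => hj; last by rewrite phi_op1_ge2.
  by rewrite (eq_phi_op _ _ _ _ _ _ (fun k => phi_op1_ge2 heta lam f k (isT : (1 <= 1)%N) hj)) phi_op_zero.
case: j1 => [|[|j1]] //; case: j2 => [|[|j2]]// _; have i0 := i;
  (case: i => [|i]; [base_case i0|base_case i]).
Qed.

Lemma exchange_base01 (r : nat -> C) lam : br lam != 0 ->
  r 0%N = qp (- 1) * br (lam + 1) / br lam -> r 1%N = - (qp (- lam - 1) / br lam) ->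
  exchange r 1 1 0 1 lam.
Proof.
move=> hlam r0 r1 f i j1 j2; rewrite ![in LHS]big_ord_recl [in LHS]big_ord0 addr0 r0 r1.
rewrite /bump /=.
have [hj|] := boolP ((1 < j1)%N || (1 < j2)%N).
  rewrite exchange_zero//; case/orP: hj => hj; last by rewrite !phi_op1_ge2// !mulr0 addr0.
  rewrite (eq_phi_op _ _ _ _ _ _ (fun k => phi_op1_ge2 heta lam f k (isT : (1 <= 1)%N) hj)) phi_op_zero.
  rewrite (eq_phi_op _ _ _ _ _ _ (fun k => phi_op1_ge2 heta lam f k (isT : (0 <= 1)%N) hj)) phi_op_zero.
  by rewrite !mulr0 addr0.
have hl : qp lam * qp lam - 1 != 0.
  apply: contra hlam => /eqP h; have q0 := qp_neq0 eta lam.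
  rewrite (br_num heta) (_ : qp lam - _ = (qp lam * qp lam - 1) / qp lam); last by field.
  by rewrite h !mul0r.
case: j1 => [|[|j1]] //; case: j2 => [|[|j2]]// _; have i0 := i;
  (case: i => [|i]; [base_case i0|base_case i]).
Qed.

Lemma exchange_base10 (r : nat -> C) lam : br lam != 0 ->
  r 0%N = qp (lam - 1) / br lam -> r 1%N = qp (- 1) * br (lam - 1) / br lam ->
  exchange r 1 1 1 0 lam.
Proof.
move=> hlam r0 r1 f i j1 j2; rewrite ![in LHS]big_ord_recl [in LHS]big_ord0 addr0 r0 r1.
rewrite /bump /=.
have [hj|] := boolP ((1 < j1)%N || (1 < j2)%N).
  rewrite exchange_zero//; case/orP: hj => hj; last by rewrite !phi_op1_ge2// !mulr0 addr0.
  rewrite (eq_phi_op _ _ _ _ _ _ (fun k => phi_op1_ge2 heta lam f k (isT : (1 <= 1)%N) hj)) phi_op_zero.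
  rewrite (eq_phi_op _ _ _ _ _ _ (fun k => phi_op1_ge2 heta lam f k (isT : (0 <= 1)%N) hj)) phi_op_zero.
  by rewrite !mulr0 addr0.
have hl : qp lam * qp lam - 1 != 0.
  apply: contra hlam => /eqP h; have q0 := qp_neq0 eta lam.
  rewrite (br_num heta) (_ : qp lam - _ = (qp lam * qp lam - 1) / qp lam); last by field.
  by rewrite h !mul0r.
case: j1 => [|[|j1]] //; case: j2 => [|[|j2]]// _; have i0 := i;
  (case: i => [|i]; [base_case i0|base_case i]).
Qed.
End VectorRepresentations.

(** * Fusion of the exchange relation in each factor *)

Section FusionLeft.
Variables (R : realType) (eta : R[i]).
Hypothesis heta : 0 < complex.Im eta.
Local Notation C := R[i].

Local Notation phi_op := (phi_op eta).
Local Notation fuse_coef := (fuse_coef eta).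
Local Notation rcoef := (rcoef eta).
Local Notation exchange := (exchange eta).

Let sum_trunc2 (K : nat) (g : nat -> C) : (forall p, (1 < p)%N -> g p = 0) ->
  \sum_(p < K.+1) g p = \sum_(m < 2) (if (m <= K)%N then g m else 0).
Proof.
move=> hg; rewrite [RHS]big_ord_recl big_ord1 /=.
rewrite big_ord_recl; congr (_ + _); case: K => [|K]; first by rewrite big_ord0.
rewrite big_ord_recl big1 ?addr0// => i _; apply: hg.
by rewrite /bump.
Qed.

Let sum_shift (m K : nat) (G : nat -> C) :
  \sum_(p < m + K | (m <= p)%N) G p = \sum_(p < K) G (m + p)%N.
Proof.
rewrite big_split_ord /= big1 ?add0r; last by move=> p hp; have := ltn_ord p; lia.
by apply: eq_bigl => p; rewrite leq_addr.
Qed.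

(** The relation for weights [L + 1] and [L3] follows from those for ([L], [L3])
    and (1, [L3]). Exchanging through the fused intertwiner means exchanging
    through its weight [L] part, then through its weight 1 part; the fusion rule
    for [r] collects the dynamical coefficients, and [hexagon_left] the quantum
    ones. The relation for ([L], [L3]) is only required where its coefficient
    [a] does not vanish: that is what makes an induction over bounded indices
    possible. *)
Lemma fusion_left (r : nat -> C) (a : nat -> nat -> C) (b : nat -> nat -> nat -> nat -> C)
    (L L3 : C) (n1 n2 n3 : nat) (lam : C) : (n2 <= 1)%N ->
  let N := (n1 + n2 + n3)%N in
  (forall p, (p <= N)%N -> r p = \sum_(m2 < p.+1) \sum_(l < N.+1) a m2 l * b m2 (p - m2)%N (N - p)%N l) ->
  (forall m2 l, (m2 + l)%N <> (n2 + n3)%N -> a m2 l = 0) ->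
  (forall m2 l, (1 < m2)%N -> a m2 l = 0) ->
  exchange (fun p => a p (n2 + n3 - p)%N) 1 L3 n2 n3 lam ->
  (forall m2, (m2 <= 1)%N -> (m2 <= n2 + n3)%N ->
     a m2 (n2 + n3 - m2)%N = 0 \/
     exchange (fun p => b m2 p (n1 + (n2 + n3 - m2) - p)%N (n2 + n3 - m2)%N) L L3 n1 (n2 + n3 - m2)
       (lam - (1 - 2 * m2%:R))) ->
  exchange r (L + 1) L3 (n1 + n2) n3 lam.
Proof.
move=> hn2 N hr ha ha2 ex1 ex2 f i j c.
(* By weight conservation one value of the inner summation index survives in the
   fusion rule. *)
pose al m2 := if (m2 <= n2 + n3)%N then a m2 (n2 + n3 - m2)%N else 0.
have hr' p : (p <= N)%N -> r p = \sum_(m2 < 2) (if (m2 <= p)%N then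
     al m2 * b m2 (p - m2)%N (N - p)%N (n2 + n3 - m2)%N else 0).
  move=> hp; rewrite hr// -(sum_trunc2 p (g := fun m2 => al m2 * b m2 (p - m2)%N (N - p)%N (n2 + n3 - m2)%N)).
    apply: eq_bigr => m2 _; rewrite /al; case: leqP => hm2; last first.
      by rewrite mul0r big1// => l _; rewrite ha ?mul0r//; lia.
    have hl : (n2 + n3 - m2 < N.+1)%N by lia.
    rewrite (bigD1 (Ordinal hl)) //= big1 ?addr0// => l /eqP hne.
    rewrite ha ?mul0r// => e; apply: hne; apply: val_inj; rewrite /=; lia.
  by move=> m2 hm2; rewrite /al; case: leqP => _; rewrite ?ha2 ?mul0r.
pose X x y z := phi_op n1 L (lam - (L3 - 2 * n3%:R) - (1 - 2 * n2%:R)) x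
   (phi_op n2 1 (lam - (L3 - 2 * n3%:R)) y (phi_op n3 L3 lam z f)) i.
have -> : \sum_(s < j.+1) rcoef (L + 1) L3 j c s *
    phi_op (n1 + n2) (L + 1) (lam - (L3 - 2 * n3%:R)) (j - s) (phi_op n3 L3 lam (c + s) f) i =
  \sum_(s < j.+1) rcoef (L + 1) L3 j c s * \sum_(b < 2) fuse_coef L (j - s) b *
    X (j - s - b)%N b (c + s)%N.
  by apply: eq_bigr => s _; rewrite phi_op_fuse.
rewrite -(hexagon_left heta L L3 j c X) /X {X}.
have -> : \sum_(p < (n1 + n2 + n3).+1) r p *
    phi_op (n1 + n2 + n3 - p) L3 (lam - (L + 1 - 2 * p%:R)) c (phi_op p (L + 1) lam j f) i =
  \sum_(m2 < 2) al m2 * \sum_(p1 < (n1 + (n2 + n3 - m2)).+1)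
     b m2 p1 (n1 + (n2 + n3 - m2) - p1)%N (n2 + n3 - m2)%N *
     phi_op (n1 + (n2 + n3 - m2) - p1) L3 (lam - (1 - 2 * m2%:R) - (L - 2 * p1%:R)) c
       (phi_op (p1 + m2) (L + 1) lam j f) i.
  transitivity (\sum_(p < N.+1) \sum_(m2 < 2) (if (m2 <= p)%N then
     al m2 * b m2 (p - m2)%N (N - p)%N (n2 + n3 - m2)%N *
      phi_op (N - p) L3 (lam - (L + 1 - 2 * p%:R)) c (phi_op p (L + 1) lam j f) i else 0)).
    apply: eq_bigr => p _; rewrite hr'; last by have := ltn_ord p; lia.
    by rewrite big_distrl; apply: eq_bigr => m2 _; rewrite /=; case: leqP; rewrite ?mul0r.
  rewrite exchange_big /=; apply: eq_bigr => m2 _.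
  have [hm2|hm2] := leqP m2 (n2 + n3); last first.
    rewrite /al leqNgt hm2 /= mul0r big1// => p _; case: ifP => // _; by rewrite !mul0r.
  rewrite big_distrr /= -big_mkcond /=.
  pose G p := al m2 * (b m2 (p - m2)%N (N - p)%N (n2 + n3 - m2)%N *
      phi_op (N - p) L3 (lam - (L + 1 - 2 * p%:R)) c (phi_op p (L + 1) lam j f) i).
  rewrite (eq_bigr (fun p : 'I_N.+1 => G p)); last by move=> p _; rewrite /G !mulrA.
  rewrite (eq_bigr (fun p : 'I_(n1 + (n2 + n3 - m2)).+1 => G (m2 + p)%N)); last first.
    move=> p _; rewrite /G; congr (_ * _).
    have -> : (m2 + p - m2 = p)%N by lia.
    have -> : (N - (m2 + p) = n1 + (n2 + n3 - m2) - p)%N by rewrite /N; lia.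
    rewrite [(m2 + p)%N]addnC; congr (_ * phi_op _ _ _ _ _ _).
    by rewrite natrD; ring.
  have e : N.+1 = (m2 + (n1 + (n2 + n3 - m2)).+1)%N by rewrite /N; lia.
  by rewrite e sum_shift.
have -> : \sum_(m2 < 2) al m2 * \sum_(p1 < (n1 + (n2 + n3 - m2)).+1)
     b m2 p1 (n1 + (n2 + n3 - m2) - p1)%N (n2 + n3 - m2)%N *
     phi_op (n1 + (n2 + n3 - m2) - p1) L3 (lam - (1 - 2 * m2%:R) - (L - 2 * p1%:R)) c
       (phi_op (p1 + m2) (L + 1) lam j f) i =
  \sum_(m2 < 2) al m2 * \sum_(d < 2) fuse_coef L j d * \sum_(s < (j - d).+1)
    rcoef L L3 (j - d) c s * phi_op n1 L (lam - (1 - 2 * m2%:R) - (L3 - 2 * (n2 + n3 - m2)%:R)) (j - d - s)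
      (phi_op (n2 + n3 - m2) L3 (lam - (1 - 2 * m2%:R)) (c + s) (phi_op m2 1 lam d f)) i.
  apply: eq_bigr => m2 _.
  have [->|hal] := eqVneq (al m2) 0; first by rewrite !mul0r.
  have hm2 : (m2 <= n2 + n3)%N by move: hal; rewrite /al; case: leqP; rewrite ?eqxx.
  have hm1 : (m2 <= 1)%N by have := ltn_ord m2.
  case: (ex2 _ hm1 hm2) => [h0|ex2']; first by move: hal; rewrite /al hm2 h0 eqxx.
  congr (_ * _).
  under eq_bigr => p1 _.
    rewrite (eq_phi_op _ _ _ _ _ _ (fun k => phi_op_fuse heta p1 L lam j f k hm1)).
    rewrite (@phi_op_linear _ _ _ _ (fun d : 'I_2 => fuse_coef L j d)).
    over.
  under eq_bigr do rewrite big_distrr /=.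
  rewrite exchange_big /=; apply: eq_bigr => d _.
  rewrite -ex2' big_distrr /=; apply: eq_bigr => p1 _; ring.
under eq_bigr do rewrite big_distrr /=.
rewrite exchange_big /=; apply: eq_bigr => d _.
under eq_bigr do rewrite mulrCA big_distrr /=.
rewrite -big_distrr exchange_big /=; congr (_ * _); apply: eq_bigr => s _.
under eq_bigr do rewrite mulrCA.
rewrite -big_distrr /=; congr (_ * _).
have ex1' k := ex1 f k d (c + s)%N.
transitivity (phi_op n1 L (lam - (L3 - 2 * n3%:R) - (1 - 2 * n2%:R)) (j - d - s) (fun k =>
   \sum_(p < (n2 + n3).+1) a p (n2 + n3 - p)%N *
     phi_op (n2 + n3 - p) L3 (lam - (1 - 2 * p%:R)) (c + s) (phi_op p 1 lam d f) k) i).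
  rewrite (@phi_op_linear _ _ _ _ (fun p : 'I_(n2 + n3).+1 => a p (n2 + n3 - p)%N)).
  rewrite (sum_trunc2 (n2 + n3) (g := fun p => a p (n2 + n3 - p)%N *
     phi_op n1 L (lam - (L3 - 2 * n3%:R) - (1 - 2 * n2%:R)) (j - d - s)
     (phi_op (n2 + n3 - p) L3 (lam - (1 - 2 * p%:R)) (c + s) (phi_op p 1 lam d f)) i)); last first.
    by move=> p hp; rewrite ha2 ?mul0r.
  apply: eq_bigr => m2 _; rewrite /al; case: leqP => hm2; last by rewrite mul0r.
  congr (_ * phi_op _ _ _ _ _ _).
  by rewrite natrB// natrD; ring.
rewrite (eq_phi_op _ _ _ _ _ _ ex1').
by rewrite (@phi_op_linear _ _ _ _ (fun t : 'I_d.+1 => rcoef 1 L3 d (c + s)%N t)).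
Qed.
End FusionLeft.

Section FusionRight.
Variables (R : realType) (eta : R[i]).
Hypothesis heta : 0 < complex.Im eta.
Local Notation C := R[i].

Local Notation phi_op := (phi_op eta).
Local Notation fuse_coef := (fuse_coef eta).
Local Notation rcoef := (rcoef eta).
Local Notation exchange := (exchange eta).

(** The relation for weights [L1] and [L + 1] from those for ([L1], 1) and
    ([L1], [L]), by the argument of [fusion_left] with the roles of the factors
    interchanged. *)
Lemma fusion_right (r : nat -> C) (A : nat -> nat -> C) (B : nat -> nat -> nat -> C)
    (L1 L : C) (n1 n2 n3 : nat) (lam : C) : (n3 <= 1)%N ->
  let N := (n1 + n2 + n3)%N in
  (forall p, (p <= N)%N -> r p =
     \sum_(m3 < (N - p).+1) \sum_(l < N.+1) A l (N - p - m3)%N * B p m3 l) ->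
  (forall l m, (l + m)%N <> (n1 + n2)%N -> A l m = 0) ->
  (forall p m3 l, (1 < m3)%N -> B p m3 l = 0) ->
  exchange (fun l => A l (n1 + n2 - l)%N) L1 L n1 n2 (lam - (1 - 2 * n3%:R)) ->
  (forall l, (l <= n1 + n2)%N -> A l (n1 + n2 - l)%N = 0 \/
     exchange (fun p => B p (l + n3 - p)%N l) L1 1 l n3 lam) ->
  exchange r L1 (L + 1) n1 (n2 + n3) lam.
Proof.
move=> hn3 N hr hA hB ex1 ex2 f i j1 j2.
rewrite addnA -/N.
have hN : N = (n1 + n2 + n3)%N by []. clearbody N.
pose al l := A l (n1 + n2 - l)%N.
have hr' p : (p <= N)%N -> r p = \sum_(l < (n1 + n2).+1)
    (if (p <= l + n3)%N then al l * B p (l + n3 - p)%N l else 0).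
  move=> hp; rewrite hr// exchange_big /=.
  have hw : ((n1 + n2).+1 <= N.+1)%N by lia.
  rewrite (big_ord_widen _ (fun l => if (p <= l + n3)%N then al l * B p (l + n3 - p)%N l else 0) hw).
  rewrite [RHS]big_mkcond /=; apply: eq_bigr => l _.
  case: ltnP => hl; last by rewrite big1// => m3 _; rewrite hA ?mul0r//; lia.
  case: leqP => hpl; last first.
    by rewrite big1// => m3 _; rewrite hA ?mul0r//; have := ltn_ord m3; lia.
  have hm : (l + n3 - p < (N - p).+1)%N by lia.
  rewrite (bigD1 (Ordinal hm)) //= big1 ?addr0 => [|m3 /eqP hne].
    by congr (A _ _ * _); lia.
  rewrite hA ?mul0r// => e; apply: hne; apply: val_inj => /=.
  by move: e (ltn_ord m3); lia.
have hX a b e : (1 < e)%N -> phi_op n1 L1 (lam - (L + 1 - 2 * (n2 + n3)%:R)) a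
   (phi_op n2 L (lam - (1 - 2 * n3%:R)) b (phi_op n3 1 lam e f)) i = 0.
  move=> he; rewrite (eq_phi_op _ _ _ _ _ _ (fun k => eq_phi_op _ _ _ _ _ _ (fun k => phi_op1_ge2 heta lam f k hn3 he))).
  by rewrite (eq_phi_op _ _ _ _ _ _ (fun k => phi_op_zero _ _ _ _ _ _)) phi_op_zero.
pose X x y z := phi_op n1 L1 (lam - (L + 1 - 2 * (n2 + n3)%:R)) x
   (phi_op n2 L (lam - (1 - 2 * n3%:R)) y (phi_op n3 1 lam z f)) i.
have -> : \sum_(s < j1.+1) rcoef L1 (L + 1) j1 j2 s *
    phi_op n1 L1 (lam - (L + 1 - 2 * (n2 + n3)%:R)) (j1 - s) (phi_op (n2 + n3) (L + 1) lam (j2 + s) f) i =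
  \sum_(s < j1.+1) rcoef L1 (L + 1) j1 j2 s * \sum_(b < 2) fuse_coef L (j2 + s)%N b *
    X (j1 - s)%N (j2 + s - b)%N b.
  apply: eq_bigr => s _; congr (_ * _).
  rewrite (eq_phi_op _ _ _ _ _ _ (fun k => phi_op_fuse heta n2 L lam (j2 + s) f k hn3)).
  by rewrite (@phi_op_linear _ _ _ _ (fun d : 'I_2 => fuse_coef L (j2 + s)%N d)).
rewrite -(hexagon_right heta L1 L j1 j2 (X := X) hX).
have -> : \sum_(p < N.+1) r p *
    phi_op (N - p) (L + 1) (lam - (L1 - 2 * p%:R)) j2 (phi_op p L1 lam j1 f) i =
  \sum_(l < (n1 + n2).+1) al l * \sum_(p < (l + n3).+1) B p (l + n3 - p)%N l *
     phi_op (n1 + n2 - l + (l + n3 - p)) (L + 1) (lam - (L1 - 2 * p%:R)) j2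
       (phi_op p L1 lam j1 f) i.
  pose G l p := al l * (B p (l + n3 - p)%N l *
     phi_op (N - p) (L + 1) (lam - (L1 - 2 * p%:R)) j2 (phi_op p L1 lam j1 f) i).
  transitivity (\sum_(p < N.+1) \sum_(l < (n1 + n2).+1) (if (p <= l + n3)%N then G l p else 0)).
    apply: eq_bigr => p _; rewrite hr'; last by have := ltn_ord p; lia.
    rewrite big_distrl; apply: eq_bigr => l _ /=; case: leqP => _; rewrite ?mul0r//.
    by rewrite /G mulrA.
  rewrite exchange_big /=; apply: eq_bigr => l _.
  have hw : ((l + n3).+1 <= N.+1)%N by have := ltn_ord l; lia.
  rewrite big_distrr /= [RHS](eq_bigr (fun p : 'I_(l + n3).+1 => G l p)).
    by rewrite (big_ord_widen _ (fun p => G l p) hw) [RHS]big_mkcond.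
  move=> p _; rewrite /G.
  have hp := ltn_ord p; have hl := ltn_ord l.
  have -> : (n1 + n2 - l + (l + n3 - p) = N - p)%N by lia.
  by [].
have -> : \sum_(l < (n1 + n2).+1) al l * \sum_(p < (l + n3).+1) B p (l + n3 - p)%N l *
     phi_op (n1 + n2 - l + (l + n3 - p)) (L + 1) (lam - (L1 - 2 * p%:R)) j2
       (phi_op p L1 lam j1 f) i =
  \sum_(l < (n1 + n2).+1) al l * \sum_(d < 2) fuse_coef L j2 d *
    \sum_(s < j1.+1) rcoef L1 1 j1 d s *
    phi_op (n1 + n2 - l) L (lam - (1 - 2 * n3%:R) - (L1 - 2 * l%:R)) (j2 - d)
       (phi_op l L1 (lam - (1 - 2 * n3%:R)) (j1 - s) (phi_op n3 1 lam (d + s) f)) i.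
  apply: eq_bigr => l _.
  have [->|hal] := eqVneq (al l) 0; first by rewrite !mul0r.
  have hl : (l <= n1 + n2)%N by have := ltn_ord l; lia.
  case: (ex2 _ hl) => [h0|ex2']; first by move: hal; rewrite /al h0 eqxx.
  congr (_ * _).
  transitivity (\sum_(p < (l + n3).+1) \sum_(d < 2) fuse_coef L j2 d *
     (B p (l + n3 - p)%N l * phi_op (n1 + n2 - l) L (lam - (1 - 2 * n3%:R) - (L1 - 2 * l%:R)) (j2 - d)
       (phi_op (l + n3 - p) 1 (lam - (L1 - 2 * p%:R)) d (phi_op p L1 lam j1 f)) i)).
    apply: eq_bigr => p _.
    have [hp|hp] := leqP (l + n3 - p) 1; last first.
      by rewrite hB// mul0r big1// => d _; rewrite mul0r mulr0.
    rewrite (phi_op_fuse heta _ _ _ _ _ _ hp) big_distrr /=; apply: eq_bigr => d _.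
    rewrite mulrCA; congr (_ * (_ * phi_op _ _ _ _ _ _)).
    by rewrite natrB ?natrD; [ring|have := ltn_ord p; lia].
  rewrite exchange_big /=; apply: eq_bigr => d _; rewrite -big_distrr /=; congr (_ * _).
  transitivity (phi_op (n1 + n2 - l) L (lam - (1 - 2 * n3%:R) - (L1 - 2 * l%:R)) (j2 - d)
     (fun k => \sum_(p < (l + n3).+1) B p (l + n3 - p)%N l *
        phi_op (l + n3 - p) 1 (lam - (L1 - 2 * p%:R)) d (phi_op p L1 lam j1 f) k) i).
    by rewrite (@phi_op_linear _ _ _ _ (fun p : 'I_(l + n3).+1 => B p (l + n3 - p)%N l)).
  rewrite (eq_phi_op _ _ _ _ _ _ (fun k => ex2' f k j1 d)).
  by rewrite (@phi_op_linear _ _ _ _ (fun t : 'I_j1.+1 => rcoef L1 1 j1 d t)).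
under eq_bigr do rewrite big_distrr /=.
rewrite exchange_big /=; apply: eq_bigr => d _.
under eq_bigr do rewrite mulrCA big_distrr /=.
rewrite -big_distrr exchange_big /=; congr (_ * _); apply: eq_bigr => s _.
under eq_bigr do rewrite mulrCA.
rewrite -big_distrr /=; congr (_ * _).
rewrite /al ex1; apply: eq_bigr => t _; congr (_ * _); rewrite /X.
congr (phi_op _ _ _ _ _ _); by rewrite natrD; ring.
Qed.
End FusionRight.

(** * Properties that hold off a discrete set, and limits *)

Section NearPoint.
Local Open Scope classical_set_scope.
Local Open Scope ring_scope.
Local Open Scope complex_scope.
Variable K : numFieldType.
Implicit Types (P Q : K -> Prop) (x : K).

Lemma near_puncturedP x0 P :
  (\forall x \near x0^', P x) <->
  exists2 e : K, 0 < e & forall x, x != x0 -> `|x0 - x| < e -> P x.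
Proof.
split.
  rewrite near_withinE => /nbhs_ballP[e /= e0 h]; exists e => // x hx hxe.
  by apply: (h x) => //; rewrite -ball_normE.
move=> [e e0 h]; rewrite near_withinE; apply/nbhs_ballP; exists e => //= x.
by rewrite -ball_normE /= => hx hxx; apply: h.
Qed.

Lemma near_ballP x0 P :
  (\forall x \near x0, P x) <->
  exists2 e : K, 0 < e & forall x, `|x0 - x| < e -> P x.
Proof.
split.
  move=> /nbhs_ballP H; case: H => e /= e0 hP; exists e; first exact: e0.
  by move=> x hxe; apply: hP; rewrite -ball_normE.
by move=> [e e0 h]; apply/nbhs_ballP; exists e.
Qed.

Lemma generically_imp P Q : (forall x, P x -> Q x) -> generically P -> generically Q.
Proof. by move=> PQ gP x0; apply: filterS (gP x0). Qed.

Lemma generically_and P Q : generically P -> generically Q ->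
  generically (fun x => P x /\ Q x).
Proof. by move=> gP gQ x0; exact: filterI (gP x0) (gQ x0). Qed.

Lemma generically_true : generically (fun _ : K => True).
Proof. by move=> x0; apply: filterT. Qed.

Lemma generically_const (A : Prop) : A -> generically (fun _ : K => A).
Proof. by move=> a x0; apply: filterE. Qed.

Lemma generically_forall (I : finType) (P : I -> K -> Prop) :
  (forall i, generically (P i)) -> generically (fun x => forall i, P i x).
Proof.
move=> gP x0; have := @filter_forall _ _ (fun i x => P i x) (x0^') _; apply.
by move=> i; apply: gP.
Qed.

Lemma generically_lt N (P : nat -> K -> Prop) :
  (forall i, (i < N)%N -> generically (P i)) ->
  generically (fun x => forall i, (i < N)%N -> P i x).
Proof.
move=> gP; have := @generically_forall 'I_N (fun i => P i) (fun i => gP i (ltn_ord i)).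
by apply: generically_imp => x h i hi; apply: (h (Ordinal hi)).
Qed.

Lemma generically_shift (c : K) P : generically P -> generically (fun x => P (x - c)).
Proof.
move=> gP x0; have /near_puncturedP[e e0 h] := gP (x0 - c).
apply/near_puncturedP; exists e => // x hx hxe; apply: h.
  by apply: contra hx => /eqP/addIr ->.
by rewrite opprB addrA subrK.
Qed.

(** These three abbreviations are stated over an abstract [numFieldType], where
    the topology lives, so that statements over the complex numbers can mention
    limits through them. *)
Definition punctured_near x0 P : Prop := \forall x \near x0^', P x.
Definition ball_near x0 P : Prop := \forall x \near x0, P x.
Definition seq_to (u : nat -> K) (l : K) : Prop := u @ \oo --> l.

Lemma seq_toP (u : nat -> K) (l : K) : seq_to u l <->
  forall e : K, 0 < e -> exists N, forall n, (N <= n)%N -> `|l - u n| < e.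
Proof.
split.
  by move=> /cvgrPdist_lt h e e0; have [N _ hN] := h e e0; exists N => n hn; exact: hN.
by move=> h; apply/cvgrPdist_lt => e e0; have [N hN] := h e e0; exists N.
Qed.

Lemma seq_toM (u v : nat -> K) (k l : K) :
  seq_to u k -> seq_to v l -> seq_to (fun n => u n * v n) (k * l).
Proof. exact: cvgM. Qed.

Lemma seq_toD (u v : nat -> K) (k l : K) :
  seq_to u k -> seq_to v l -> seq_to (fun n => u n + v n) (k + l).
Proof. exact: cvgD. Qed.

Lemma seq_to_unique (u : nat -> K) (k l : K) : seq_to u k -> seq_to u l -> k = l.
Proof. exact: cvg_unique. Qed.

End NearPoint.

(** * Power series over the complex numbers *)

Section PowerSeries.
Local Open Scope classical_set_scope.
Local Open Scope ring_scope.
Local Open Scope complex_scope.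
Variable R : realType.
Local Notation C := R[i].

(** The modulus as an element of [R]: the norm of [R[i]] takes values in [R[i]],
    where linear arithmetic is not available. *)
Definition nm (z : C) : R := complex.Re `|z|.

Lemma nmE (z : C) : `|z| = (nm z)%:C.
Proof. by []. Qed.

Lemma nm_ge0 z : 0 <= nm z.
Proof. by rewrite -lecR -nmE normr_ge0. Qed.

Lemma nmM y z : nm (y * z) = nm y * nm z.
Proof. by apply: complexI; rewrite rmorphM /= -!nmE normrM. Qed.

Lemma nmD y z : nm (y + z) <= nm y + nm z.
Proof. by rewrite -lecR rmorphD /= -!nmE ler_normD. Qed.

Lemma nmN z : nm (- z) = nm z.
Proof. by apply: complexI; rewrite -!nmE normrN. Qed.

Lemma nmBC y z : nm (y - z) = nm (z - y).
Proof. by rewrite -nmN opprB. Qed.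

Lemma nm0 : nm 0 = 0.
Proof. by apply: complexI; rewrite -nmE normr0. Qed.

Lemma nm1 : nm 1 = 1.
Proof. by apply: complexI; rewrite -nmE normr1. Qed.

Lemma nm_eq0 z : (nm z == 0) = (z == 0).
Proof. by rewrite -(inj_eq (@complexI R)) /= -nmE normr_eq0. Qed.

Lemma nm_gt0 z : z != 0 -> 0 < nm z.
Proof. by move=> z0; rewrite lt_def nm_ge0 nm_eq0 z0. Qed.

Lemma nmX z n : nm (z ^+ n) = nm z ^+ n.
Proof. by apply: complexI; rewrite rmorphXn /= -!nmE normrX. Qed.

Lemma nmV z : nm z^-1 = (nm z)^-1.
Proof. by apply: complexI; rewrite fmorphV /= -!nmE normfV. Qed.

Lemma nm_real (r : R) : nm r%:C = `|r|.
Proof. by rewrite /nm normc_def /= expr0n addr0 sqrtr_sqr. Qed.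

Lemma nm_sum (I : Type) (r : seq I) (P : pred I) (F : I -> C) :
  nm (\sum_(i <- r | P i) F i) <= \sum_(i <- r | P i) nm (F i).
Proof.
elim/big_ind2: _ => [|x1 x2 y1 y2 h1 h2|]//; first by rewrite nm0.
by apply: le_trans (nmD _ _) _; apply: lerD.
Qed.

Lemma near_puncturedR (x0 : C) (P : C -> Prop) :
  punctured_near x0 P <->
  exists2 e : R, 0 < e & forall x, x != x0 -> nm (x - x0) < e -> P x.
Proof.
split.
  move=> /near_puncturedP[e e0 h]; have eE := RRe_real (gtr0_real e0).
  exists (complex.Re e); first by rewrite -ltcR eE.
  by move=> x xx h'; apply: h => //; rewrite -eE nmE ltcR nmBC.
move=> [e e0 h]; apply/near_puncturedP; exists e%:C; first by rewrite ltcR.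
by move=> x xx; rewrite nmE ltcR nmBC; apply: h.
Qed.

Lemma near_ballR (x0 : C) (P : C -> Prop) :
  ball_near x0 P <->
  exists2 e : R, 0 < e & forall x, nm (x - x0) < e -> P x.
Proof.
split.
  move=> /near_ballP[e e0 h]; have eE := RRe_real (gtr0_real e0).
  exists (complex.Re e); first by rewrite -ltcR eE.
  by move=> x h'; apply: h => //; rewrite -eE nmE ltcR nmBC.
move=> [e e0 h]; apply/near_ballP; exists e%:C; first by rewrite ltcR.
by move=> x; rewrite nmE ltcR nmBC; apply: h.
Qed.

Lemma cvg_seqR (u : nat -> C) (l : C) : seq_to u l <->
  forall e : R, 0 < e -> exists N, forall n, (N <= n)%N -> nm (u n - l) < e.
Proof.
split.
  move=> /seq_toP h e e0.
  have [|N hN] := h e%:C; first by rewrite ltcR.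
  by exists N => n hn; have := hN n hn; rewrite nmE ltcR nmBC.
move=> h; apply/seq_toP => e e0; have eE := RRe_real (gtr0_real e0).
have [|N hN] := h (complex.Re e); first by rewrite -ltcR eE.
by exists N => n hn; rewrite -eE nmE ltcR nmBC; apply: hN.
Qed.

Lemma has_sumR (u : nat -> C) (l : C) : has_sum u l <->
  forall e : R, 0 < e -> exists N, forall n, (N <= n)%N -> nm (\sum_(i < n) u i - l) < e.
Proof.
rewrite /has_sum; split.
  by move=> /cvg_seqR h e /h [N hN]; exists N => n /hN; rewrite /series /= big_mkord.
by move=> h; apply/cvg_seqR => e /h [N hN]; exists N => n /hN; rewrite /series /= big_mkord.
Qed.

Lemma has_sum_unique (u : nat -> C) l l' : has_sum u l -> has_sum u l' -> l = l'.
Proof. by move=> h h'; exact: seq_to_unique h h'. Qed.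

Definition psum (a : nat -> C) (z l : C) : Prop := has_sum (fun i => a i * z ^+ i) l.

(** The terms of a convergent series are bounded, so the coefficients grow at
    most geometrically.  All later estimates use only this bound, well inside
    the disc of convergence. *)
Lemma psum_bound a z l : psum a z l -> z != 0 ->
  exists M s : R, [/\ 0 <= M, 0 < s & forall i, nm (a i) <= M * s ^+ i].
Proof.
move=> /has_sumR h z0; have [//|N hN] := h 1.
pose u i := a i * z ^+ i.
(* Beyond [N] the partial sums are within 1 of the limit, so each term is at
   most 2; the finitely many terms before are bounded by their sum. *)
exists (2 + \sum_(i < N) nm (u i)), (nm z)^-1.
have S0 : 0 <= \sum_(i < N) nm (u i) by apply: sumr_ge0 => i _; exact: nm_ge0.
split; [lra|by rewrite invr_gt0 nm_gt0|move=> i].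
have zi : 0 < nm z ^+ i by rewrite exprn_gt0// nm_gt0.
rewrite exprVn ler_pdivlMr// -nmX -nmM -/(u i).
have [hi|hi] := ltnP i N.
  rewrite (bigD1 (Ordinal hi)) //= .
  have : 0 <= \sum_(j < N | j != Ordinal hi) nm (u j) by apply: sumr_ge0 => j _; exact: nm_ge0.
  by move=> ?; lra.
have h1 := hN i hi; have h2 := hN i.+1 (leq_trans hi (leqnSn _)).
rewrite big_ord_recr /= -/(u i) in h2.
set S := \sum_(k < i) _ in h1 h2.
have -> : u i = (S + u i - l) - (S - l) by ring.
apply: le_trans (nmD _ _) _; rewrite nmN; lra.
Qed.

(** Coefficients of a Cauchy product. *)
Definition conv (u v : nat -> C) (n : nat) : C := \sum_(i < n.+1) u i * v (n - i)%N.

Lemma sum_conv (u v : nat -> C) n :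
  \sum_(m < n) conv u v m = \sum_(i < n) u i * \sum_(j < n - i) v j.
Proof.
elim: n => [|n IH]; first by rewrite !big_ord0.
rewrite big_ord_recr /= IH /conv !big_ord_recr /= subnn subSnn big_ord1 addrA -big_split /=.
congr (_ + _); apply: eq_bigr => i _; rewrite subSn; last by have := ltn_ord i; lia.
by rewrite big_ord_recr /= mulrDr.
Qed.

(** The error term in [cauchy_product] tends to 0. *)
Lemma small_pow (M e : R) : 0 < e -> exists N, forall n, (N <= n)%N ->
  M * n%:R ^+ 2 / 8 ^+ n < e.
Proof.
move=> e0; pose B := `|M| / e.
have B0 : 0 <= B by rewrite divr_ge0// ltW.
have [k hk] : exists k : nat, B < k%:R by exists (Num.bound B); rewrite archi_boundP.
exists k => n hn.
have h8 : 0 < (8 : R) ^+ n by rewrite exprn_gt0.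
have h2 : 0 < (2 : R) ^+ n by rewrite exprn_gt0.
rewrite ltr_pdivrMr//.
(* The factor 8 to the n beats the square of n, which costs 4 to the n, by
   another 2 to the n. *)
have n2 : n%:R <= (2 : R) ^+ n by rewrite -natrX ler_nat ltnW// ltn_expl.
have kn : k%:R <= (2:R) ^+ n by apply: le_trans n2; rewrite ler_nat.
have e8 : (8 : R) ^+ n = 2 ^+ n * (2 ^+ n * 2 ^+ n) by rewrite -!exprMn; congr (_ ^+ _); lra.
rewrite e8 (_ : e * _ = e * 2 ^+ n * (2 ^+ n * 2 ^+ n)); last by ring.
have n22 : n%:R ^+ 2 <= (2 : R) ^+ n * 2 ^+ n.
  by rewrite expr2; apply: ler_pM.
apply: (@le_lt_trans _ _ (`|M| * (2 ^+ n * 2 ^+ n))).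
  apply: (@le_trans _ _ (`|M| * n%:R ^+ 2)).
    by apply: ler_wpM2r; [exact: exprn_ge0|exact: ler_norm].
  by apply: ler_wpM2l.
rewrite ltr_pM2r; last by apply: mulr_gt0.
have : B < 2 ^+ n by apply: lt_le_trans kn.
by rewrite /B ltr_pdivrMr// mulrC.
Qed.

(** With terms bounded by a geometric progression of ratio 1/8, the n-th partial
    sum of the convolution differs from the product of the partial sums by at
    most n^2 terms, each of size at most a constant times 8^(-n). *)
Lemma cauchy_product (u v : nat -> C) U V (M : R) :
  (forall i, nm (u i) <= M / 8 ^+ i) -> (forall i, nm (v i) <= M / 8 ^+ i) ->
  has_sum u U -> has_sum v V -> has_sum (conv u v) (U * V).
Proof.
move=> hu hv sU sV; apply/has_sumR => e e0.
have e20 : 0 < e / 2 by lra.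
have /cvg_seqR := seq_toM sU sV => /(_ _ e20)[N1 hN1].
have [N2 hN2] := small_pow (M ^+ 2) e20.
have M0 : 0 <= M by have := hu 0%N; rewrite expr0 divr1; apply: le_trans; exact: nm_ge0.
exists (maxn N1 N2) => n; rewrite geq_max => /andP[h1 h2].
have := hN1 n h1; have := hN2 n h2.
rewrite /series /= !big_mkord.
set Un := \sum_(k < n) u k; set Vn := \sum_(k < n) v k => A B.
have D : nm (\sum_(i < n) conv u v i - Un * Vn) <= M ^+ 2 * n%:R ^+ 2 / 8 ^+ n.
  rewrite sum_conv /Un big_distrl -sumrB /=.
  apply: le_trans (nm_sum _ _ _) _.
  apply: (@le_trans _ _ (\sum_(i < n) (M ^+ 2 * n%:R / 8 ^+ n))); last first.
    by rewrite sumr_const card_ord -mulr_natr le_eqVlt; apply/orP; left; apply/eqP; ring.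
  apply: ler_sum => i _; rewrite -mulrBr nmM.
  have hi := ltn_ord i.
  have -> : \sum_(j < n - i) v j - Vn = - \sum_(n - i <= j < n) v j.
    rewrite /Vn -!(big_mkord xpredT v) (@big_cat_nat _ _ _ (n - i) 0 n) //=; last by lia.
    by rewrite opprD addrA subrr sub0r.
  rewrite nmN.
  have T : nm (\sum_(n - i <= j < n) v j) <= M * n%:R / 8 ^+ (n - i).
    apply: le_trans (nm_sum _ _ _) _.
    apply: (@le_trans _ _ (\sum_(n - i <= j < n) (M / 8 ^+ (n - i)))).
      rewrite big_nat_cond [leRHS]big_nat_cond; apply: ler_sum => j /andP[/andP[hj _] _].
      apply: le_trans (hv j) _; apply: ler_wpM2l => //.
      rewrite lef_pV2 ?posrE ?exprn_gt0//.
      by rewrite ler_weXn2l// ler1n.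
    rewrite sumr_const_nat -[leLHS]mulr_natr mulrAC; apply: ler_wpM2r.
      by rewrite invr_ge0 exprn_ge0.
    by apply: ler_wpM2l => //; rewrite ler_nat; lia.
  apply: le_trans (ler_pM (nm_ge0 _) (nm_ge0 _) (hu i) T) _.
  rewrite (_ : (8:R) ^+ n = 8 ^+ i * 8 ^+ (n - i)); last by rewrite -exprD subnKC// ltnW.
  have a0 : (8 : R) ^+ i != 0 by rewrite expf_neq0// pnatr_eq0.
  have b0 : (8 : R) ^+ (n - i) != 0 by rewrite expf_neq0// pnatr_eq0.
  by rewrite le_eqVlt; apply/orP; left; apply/eqP; field; rewrite a0 b0.
have -> : \sum_(i < n) conv u v i - U * V = (\sum_(i < n) conv u v i - Un * Vn) + (Un * Vn - U * V) by ring.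
apply: le_lt_trans (nmD _ _) _; lra.
Qed.

Lemma psum_term (a : nat -> C) z (M s : R) i : 0 <= M -> 0 < s ->
  nm (a i) <= M * s ^+ i -> nm z * s <= 8^-1 -> nm (a i * z ^+ i) <= M / 8 ^+ i.
Proof.
move=> M0 s0 ha hz; rewrite nmM nmX.
apply: (@le_trans _ _ (M * s ^+ i * nm z ^+ i)).
  by apply: ler_wpM2r => //; rewrite exprn_ge0// nm_ge0.
rewrite -mulrA -exprMn [s * _]mulrC -exprVn; apply: ler_wpM2l => //.
by apply: lerXn2r => //; rewrite nnegrE ?mulr_ge0 ?nm_ge0 ?invr_ge0// ltW.
Qed.

Lemma psum_mul a b z F G (M s : R) : 0 <= M -> 0 < s ->
  (forall i, nm (a i) <= M * s ^+ i) -> (forall i, nm (b i) <= M * s ^+ i) ->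
  nm z * s <= 8^-1 -> psum a z F -> psum b z G -> psum (conv a b) z (F * G).
Proof.
move=> M0 s0 ha hb hz sF sG; rewrite /psum.
have -> : (fun i => conv a b i * z ^+ i) = conv (fun i => a i * z ^+ i) (fun i => b i * z ^+ i).
  apply/funext => n; rewrite /conv big_distrl; apply: eq_bigr => i _ /=.
  have -> : z ^+ n = z ^+ i * z ^+ (n - i) by rewrite -exprD subnKC// -ltnS.
  by ring.
apply: (@cauchy_product _ _ _ _ M).
- by move=> i; exact: (psum_term M0 s0 (ha i) hz).
- by move=> i; exact: (psum_term M0 s0 (hb i) hz).
- exact: sF.
- exact: sG.
Qed.

Lemma psum_add a b z F G : psum a z F -> psum b z G -> psum (fun i => a i + b i) z (F + G).
Proof.
rewrite /psum /has_sum => hF hG.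
have -> : series (fun i => (a i + b i) * z ^+ i) =
   (fun n => series (fun i => a i * z ^+ i) n + series (fun i => b i * z ^+ i) n).
  by apply/funext => n; rewrite /series /= -big_split; apply: eq_bigr => i _; rewrite mulrDl.
exact: (seq_toD hF hG).
Qed.

Lemma psum_delta (c z : C) p : psum (fun i => (i == p)%:R * c) z (c * z ^+ p).
Proof.
apply/has_sumR => e e0; exists p.+1 => n hn.
rewrite (bigD1 (Ordinal hn)) //= eqxx mul1r big1 ?addr0 ?subrr ?nm0// => i hi.
by rewrite (_ : (i == p :> nat) = false) ?mul0r//; apply: contraNF hi => /eqP e'; apply/eqP/val_inj.
Qed.

(** Near the centre a power series is dominated by its first nonzero term: the
    remaining ones are bounded by a geometric series of ratio at most 1/8, whose
    sum is at most twice its first term.  Isolation of zeros and continuity both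
    follow from this estimate. *)
Lemma psum_tail a z F (M s : R) p : 0 <= M -> 0 < s ->
  (forall i, nm (a i) <= M * s ^+ i) -> nm z * s <= 8^-1 -> psum a z F ->
  (forall i, (i < p)%N -> a i = 0) ->
  nm (F - a p * z ^+ p) <= 2 * M * (nm z * s) ^+ p.+1.
Proof.
move=> M0 s0 ha hz /has_sumR sF ap; rewrite leNgt; apply/negP => hlt.
set B := 2 * M * _ in hlt; set t := nm z * s in hz B hlt.
have [|N hN] := sF (nm (F - a p * z ^+ p) - B); first by lra.
have t0 : 0 <= t by rewrite mulr_ge0 ?nm_ge0// ltW.
have geo n : nm (\sum_(i < p.+1 + n) a i * z ^+ i - a p * z ^+ p) <=
    2 * M * (t ^+ p.+1 - t ^+ (p.+1 + n)).
  elim: n => [|n IH].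
    rewrite addn0 subrr mulr0 big_ord_recr /= addrK big1 ?nm0// => i _.
    by rewrite ap ?mul0r.
  rewrite addnS big_ord_recr /= addrAC; apply: le_trans (nmD _ _) _.
  have h1 : nm (a (p.+1 + n)%N * z ^+ (p.+1 + n)) <= M * t ^+ (p.+1 + n).
    rewrite nmM nmX /t exprMn.
    have z0 : 0 <= nm z ^+ (p.+1 + n) by rewrite exprn_ge0 ?nm_ge0.
    by have := ler_wpM2r z0 (ha (p.+1 + n)%N); rewrite -mulrA [s ^+ _ * _]mulrC.
  rewrite addSn in IH h1 *.
  have h2 : t ^+ (p + n).+2 <= 8^-1 * t ^+ (p + n).+1.
    by rewrite [X in X <= _]exprS; apply: ler_wpM2r => //; rewrite exprn_ge0.
  have h3 : M * t ^+ (p + n).+2 <= M * (8^-1 * t ^+ (p + n).+1) by apply: ler_wpM2l.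
  have h4 : 0 <= M * t ^+ (p + n).+1 by rewrite mulr_ge0// exprn_ge0.
  by rewrite !mulrBr in IH *; lra.
have h1 := geo N; have h2 := hN (p.+1 + N)%N (leq_addl _ _).
set S := \sum_(i < _) _ in h1 h2.
have h3 : nm (F - a p * z ^+ p) <= nm (S - F) + nm (S - a p * z ^+ p).
  rewrite [nm (S - F)]nmBC; apply: le_trans (nmD _ _).
  by rewrite (_ : F - S + _ = F - a p * z ^+ p)//; ring.
have h4 : 2 * M * (t ^+ p.+1 - t ^+ (p.+1 + N)) <= B.
  have : 0 <= M * t ^+ (p.+1 + N) by rewrite mulr_ge0// exprn_ge0.
  by rewrite /B mulrBr; lra.
lra.
Qed.
End PowerSeries.

(** * Meromorphic functions *)

Section Meromorphic.
Local Open Scope classical_set_scope.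
Local Open Scope ring_scope.
Local Open Scope complex_scope.
Variable R : realType.
Local Notation C := R[i].

(** The punctured neighbourhoods of [x0] in terms of a real radius, see
    [near_puncturedR]. *)
Definition punctured (x0 : C) (P : C -> Prop) : Prop :=
  exists2 e : R, 0 < e & forall x, x != x0 -> nm (x - x0) < e -> P x.

Lemma punctured_and x0 P Q : punctured x0 P -> punctured x0 Q ->
  punctured x0 (fun x => P x /\ Q x).
Proof.
move=> [e e0 h] [e' e'0 h']; exists (Num.min e e'); first by rewrite lt_min e0.
by move=> x xx; rewrite lt_min => /andP[h1 h2]; split; [apply: h|apply: h'].
Qed.

Lemma punctured_imp x0 (P Q : C -> Prop) : (forall x, P x -> Q x) -> punctured x0 P -> punctured x0 Q.
Proof. by move=> PQ [e e0 h]; exists e => // x xx hx; apply: PQ; apply: h. Qed.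

Lemma punctured_small x0 (d : R) : 0 < d -> punctured x0 (fun x => nm (x - x0) < d).
Proof. by move=> d0; exists d. Qed.

Lemma punctured_point x0 : punctured x0 (fun x => x != x0).
Proof. by exists 1. Qed.

Lemma punctured_ex x0 P : punctured x0 P -> exists2 x, x != x0 & P x.
Proof.
move=> [e e0 h]; have e2 : 0 < e / 2 by lra.
have hx : x0 + (e / 2)%:C != x0.
  by rewrite -subr_eq0 addrAC subrr add0r -nm_eq0 nm_real gt_eqF// normr_gt0 gt_eqF.
exists (x0 + (e / 2)%:C) => //.
by apply: h => //; rewrite addrAC subrr add0r nm_real gtr0_norm//; lra.
Qed.

(** Equality with a power series off the centre, which is all that
    [meromorphic_at] asks for. *)
Definition germ (a : nat -> C) (x0 : C) (F : C -> C) : Prop :=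
  punctured x0 (fun x => psum a (x - x0) (F x)).

Lemma germ_bound a x0 F : germ a x0 F ->
  exists M s : R, [/\ 0 <= M, 0 < s & forall i, nm (a i) <= M * s ^+ i].
Proof.
move=> /punctured_ex[x xx h]; apply: (psum_bound h); by rewrite subr_eq0.
Qed.

Lemma bound_weaken (a : nat -> C) (M M' s s' : R) : 0 <= M -> 0 < s ->
  M <= M' -> s <= s' -> (forall i, nm (a i) <= M * s ^+ i) -> forall i, nm (a i) <= M' * s' ^+ i.
Proof.
move=> M0 s0 hM hs h i; apply: le_trans (h i) _; apply: ler_pM => //.
  by rewrite exprn_ge0// ltW.
by apply: lerXn2r => //; rewrite nnegrE; lra.
Qed.

Lemma germ_mul a b x0 F G : germ a x0 F -> germ b x0 G ->
  germ (conv a b) x0 (fun x => F x * G x).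
Proof.
move=> ga gb; have [M [s [M0 s0 ha]]] := germ_bound ga; have [M' [s' [M0' s0' hb]]] := germ_bound gb.
have s8 : 0 < 8^-1 / (s + s') by rewrite divr_gt0// ?invr_gt0//; lra.
apply: punctured_imp (punctured_and (punctured_and ga gb) (punctured_small x0 s8)) => x [[pa pb] hx].
apply: (@psum_mul _ _ _ _ _ _ (M + M') (s + s')) => //; try lra.
- by apply: (bound_weaken _ _ _ _ ha) => //; lra.
- by apply: (bound_weaken _ _ _ _ hb) => //; lra.
- by move: hx; rewrite ltr_pdivlMr; [move=> /ltW|lra].
Qed.

Lemma germ_add a b x0 F G : germ a x0 F -> germ b x0 G ->
  germ (fun i => a i + b i) x0 (fun x => F x + G x).
Proof.
move=> ga gb; apply: punctured_imp (punctured_and ga gb) => x [pa pb].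
exact: psum_add pa pb.
Qed.

Lemma germ_pow x0 c p : germ (fun i => (i == p)%:R * c) x0 (fun x => c * (x - x0) ^+ p).
Proof. by exists 1 => // x _ _; apply: psum_delta. Qed.

Lemma germ_ext a x0 F G : (forall x, F x = G x) -> germ a x0 F -> germ a x0 G.
Proof. by move=> e; apply: punctured_imp => x; rewrite e. Qed.

Lemma meromorphicE (f : C -> C) x0 : meromorphic_at f x0 <->
  exists p a, germ a x0 (fun x => (x - x0) ^+ p * f x).
Proof.
split=> -[p [a h]]; exists p, a; last by apply/near_puncturedR.
by move/near_puncturedR: h.
Qed.

Lemma meromorphic_mul (f g : C -> C) x0 : meromorphic_at f x0 -> meromorphic_at g x0 ->
  meromorphic_at (fun x => f x * g x) x0.
Proof.
move=> /meromorphicE[p [a ga]] /meromorphicE[q [b gb]]; apply/meromorphicE.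
exists (p + q)%N, (conv a b); apply: germ_ext (germ_mul ga gb) => x.
by rewrite exprD; ring.
Qed.

Lemma meromorphic_add (f g : C -> C) x0 : meromorphic_at f x0 -> meromorphic_at g x0 ->
  meromorphic_at (fun x => f x + g x) x0.
Proof.
move=> /meromorphicE[p [a ga]] /meromorphicE[q [b gb]]; apply/meromorphicE.
exists (p + q)%N; have h1 := germ_mul (germ_pow x0 1 q) ga; have h2 := germ_mul (germ_pow x0 1 p) gb.
eexists; apply: germ_ext (germ_add h1 h2) => x.
by rewrite exprD; ring.
Qed.

Lemma meromorphic_const (c : C) x0 : meromorphic_at (fun=> c) x0.
Proof.
apply/meromorphicE; exists 0%N; eexists; apply: germ_ext (germ_pow x0 c 0) => x.
by rewrite expr0 mulr1 mul1r.
Qed.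

Lemma meromorphic_sum (I : Type) (r : seq I) (P : pred I) (f : I -> C -> C) x0 :
  (forall i, meromorphic_at (f i) x0) ->
  meromorphic_at (fun x => \sum_(i <- r | P i) f i x) x0.
Proof.
move=> h; elim: r => [|i r IH].
  have -> : (fun x => \sum_(i <- [::] | P i) f i x) = (fun=> 0).
    by apply/funext => x; rewrite big_nil.
  exact: (meromorphic_const 0 x0).
case Pi : (P i).
  have -> : (fun x => \sum_(i <- i :: r | P i) f i x) =
      (fun x => f i x + \sum_(i <- r | P i) f i x).
    by apply/funext => x; rewrite big_cons Pi.
  exact: (meromorphic_add (h i) IH).
have -> : (fun x => \sum_(i <- i :: r | P i) f i x) = (fun x => \sum_(i <- r | P i) f i x).
  by apply/funext => x; rewrite big_cons Pi.
exact: IH.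
Qed.

(** If some coefficient is nonzero, the first such term exceeds the tail
    estimate of [psum_tail] close to the centre. *)
Lemma germ_dichotomy a x0 F : germ a x0 F ->
  punctured x0 (fun x => F x = 0) \/ punctured x0 (fun x => F x <> 0).
Proof.
move=> ga; have [M [s [M0 s0 ha]]] := germ_bound ga.
have [h0|h0] := pselect (forall i, a i = 0).
  left; apply: punctured_imp ga => x px; apply: (has_sum_unique px).
  apply/has_sumR => e e0; exists 0%N => n _; rewrite big1 ?subrr ?nm0// => i _.
  by rewrite h0 mul0r.
have ex : exists i, a i != 0.
  by apply: contrapT => h; apply: h0 => i; apply: contrapT => /eqP ai; apply: h; exists i.
right; case: (ex_minnP ex) => p ap hp.
have ap0 i : (i < p)%N -> a i = 0.
  by move=> hi; apply/eqP; apply: contraTT hi => /hp; rewrite -leqNgt.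
have Apos : 0 < nm (a p) by exact: nm_gt0.
pose B := 2 * M * s ^+ p.+1 + 1.
have B0 : 0 < B.
  have : 0 <= M * s ^+ p.+1 by rewrite mulr_ge0// exprn_ge0// ltW.
  by rewrite /B => ?; lra.
have d1 : 0 < 8^-1 / s by rewrite divr_gt0// invr_gt0.
have d2 : 0 < nm (a p) / B by rewrite divr_gt0.
have hh := punctured_and (punctured_and ga (punctured_point x0)) (punctured_and (punctured_small x0 d1) (punctured_small x0 d2)).
apply: punctured_imp hh => x [[px xx] [h1 h2]] F0.
have zp : 0 < nm (x - x0) by rewrite nm_gt0// subr_eq0.
have hz : nm (x - x0) * s <= 8^-1 by move: h1; rewrite ltr_pdivlMr// => /ltW.
have := psum_tail M0 s0 ha hz px ap0; rewrite F0 sub0r nmN nmM nmX exprMn.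
set z := nm (x - x0) in zp hz h1 h2 *.
have zpp : 0 < z ^+ p by rewrite exprn_gt0.
rewrite (_ : 2 * M * (z ^+ p.+1 * s ^+ p.+1) = (2 * M * s ^+ p.+1 * z) * z ^+ p); last first.
  by rewrite (exprS z); ring.
rewrite ler_pM2r// => hle; move: h2; rewrite ltr_pdivlMr// /B mulrDr => h2.
by move: hle h2 zp; rewrite [z * _]mulrC; set T := _ * z; move=> *; lra.
Qed.

Lemma meromorphic_dichotomy (f : C -> C) x0 : meromorphic_at f x0 ->
  punctured x0 (fun x => f x = 0) \/ punctured x0 (fun x => f x <> 0).
Proof.
move=> /meromorphicE[p [a /germ_dichotomy[h|h]]]; [left|right].
  apply: punctured_imp (punctured_and h (punctured_point x0)) => x [/eqP h1 h2].
  by move: h1; rewrite mulf_eq0 expf_eq0 subr_eq0 (negbTE h2) andbF => /eqP.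
by apply: punctured_imp h => x h1 h2; apply: h1; rewrite h2 mulr0.
Qed.

(** The case [p = 0] of [psum_tail]. *)
Lemma analytic_continuous (f : C -> C) x0 : analytic_at f x0 ->
  forall e : R, 0 < e -> exists2 d : R, 0 < d & forall x, nm (x - x0) < d -> nm (f x - f x0) < e.
Proof.
move=> [a /near_ballR[d d0 h]] e e0.
have ga : germ a x0 f by exists d => // x _; apply: h.
have [M [s [M0 s0 ha]]] := germ_bound ga.
have d1 : 0 < 8^-1 / s by rewrite divr_gt0// invr_gt0.
have B0 : 0 < 2 * M * s + 1.
  have : 0 <= M * s by rewrite mulr_ge0// ltW.
  by move=> ?; lra.
have d2 : 0 < e / (2 * M * s + 1) by rewrite divr_gt0.
exists (Num.min d (Num.min (8^-1 / s) (e / (2 * M * s + 1)))).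
  by rewrite !lt_min d0 d1.
have no i : (i < 0)%N -> a i = 0 by [].
have h00 : nm (x0 - x0) * s <= 8^-1 by rewrite subrr nm0 mul0r invr_ge0.
have p0 : psum a (x0 - x0) (f x0) by apply: h; rewrite subrr nm0.
have := psum_tail M0 s0 ha h00 p0 no; rewrite subrr nm0 mul0r expr1 mulr0 => H0.
have f0 : f x0 = a 0%N.
  apply/eqP; rewrite -subr_eq0 -nm_eq0 eq_le nm_ge0 andbT.
  by move: H0; rewrite expr0 mulr1.
move=> x; rewrite !lt_min => /and3P[h1 h2 h3].
have hz : nm (x - x0) * s <= 8^-1 by move: h2; rewrite ltr_pdivlMr// => /ltW.
have := psum_tail M0 s0 ha hz (h x h1) no; rewrite expr0 mulr1 -f0 expr1 => H.
apply: le_lt_trans H _; move: h3; rewrite ltr_pdivlMr//.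
rewrite (_ : 2 * M * (nm (x - x0) * s) = nm (x - x0) * (2 * M * s)); last by ring.
by have := nm_ge0 (x - x0); rewrite mulrDr mulr1 => ? ?; lra.
Qed.

Lemma has_sum_real (u : nat -> R) (l : R) : series u @ \oo --> l ->
  has_sum (fun n => (u n)%:C) l%:C.
Proof.
move=> /cvgrPdist_lt h; apply/has_sumR => e e0; have [N _ hN] := h e e0.
exists N => n hn; have := hN n hn.
rewrite /series /= big_mkord -rmorph_sum -raddfB /= nm_real distrC.
by [].
Qed.

Lemma has_sum_add (u v : nat -> C) k l : has_sum u k -> has_sum v l ->
  has_sum (fun n => u n + v n) (k + l).
Proof.
move=> hu hv; have := seq_toD hu hv; rewrite /has_sum /seq_to.
have -> : (fun n => series u n + series v n) = series (fun n => u n + v n).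
  by apply/funext => n; rewrite /series /= big_split.
by [].
Qed.

Lemma seq_to_const (c : C) : seq_to (fun=> c) c.
Proof. by apply/cvg_seqR => e e0; exists 0%N => n _; rewrite subrr nm0. Qed.

Lemma has_sum_scale (c : C) (u : nat -> C) k : has_sum u k -> has_sum (fun n => c * u n) (c * k).
Proof.
move=> hu; have := seq_toM (@seq_to_const c) hu; rewrite /has_sum /seq_to.
have -> : (fun n => c * series u n) = series (fun n => c * u n).
  by apply/funext => n; rewrite /series /= big_distrr.
by [].
Qed.
Lemma has_sum_shift (u : nat -> C) T p : has_sum u T ->
  has_sum (fun k => if (p <= k)%N then u (k - p)%N else 0) T.
Proof.
move=> /has_sumR h; apply/has_sumR => e /h [N hN]; exists (N + p)%N => k hk.
have -> : \sum_(i < k) (if (p <= i)%N then u (i - p)%N else 0) = \sum_(i < k - p) u i.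
  have e1 : k = (p + (k - p))%N by lia.
  rewrite [in LHS]e1 big_split_ord /= big1 ?add0r; last first.
    by move=> i _; case: leqP => // hi; have := ltn_ord i; lia.
  by apply: eq_bigr => i _; rewrite leq_addr addKn.
by apply: hN; lia.
Qed.

(** Summation form of the cyclicity of a trace: two series whose terms agree, up
    to a constant, after a shift of the index by [q - p], and whose unmatched
    initial terms vanish. *)
Lemma has_sum_cyclic (u v : nat -> C) T T' c p q :
  (forall k k1, (k + p = k1 + q)%N -> u k = c * v k1) ->
  (forall k, (k + p < q)%N -> u k = 0) -> (forall k1, (k1 + q < p)%N -> v k1 = 0) ->
  has_sum u T' -> has_sum v T -> T' = c * T.
Proof.
move=> huv hu hv /(has_sum_shift p) h1 /(has_sum_shift q) h2.
have h3 := has_sum_scale (c := c) h2.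
have e : (fun k => if (p <= k)%N then u (k - p)%N else 0) =
    (fun k => c * (if (q <= k)%N then v (k - q)%N else 0)).
  apply/funext => k; case: leqP => hp; case: leqP => hq.
  - by apply: huv; lia.
  - by rewrite mulr0 hu//; lia.
  - by rewrite hv ?mulr0//; lia.
  - by rewrite mulr0.
by move: h1; rewrite e => h1; exact: has_sum_unique h1 h3.
Qed.
End Meromorphic.

(** * The exponential and the identity theorem *)

Section Exponential.
Local Open Scope classical_set_scope.
Local Open Scope ring_scope.
Local Open Scope complex_scope.
Variable R : realType.
Local Notation C := R[i].

Lemma fact_ge1 n : 1 <= n`!%:R :> R.
Proof. by rewrite ler1n fact_gt0. Qed.

Lemma nm_nat n : nm (n%:R : C) = n%:R.
Proof. by rewrite -(rmorph_nat (real_complex R)) nm_real normr_nat. Qed.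

Lemma nm_i : nm ('i : C) = 1.
Proof. by rewrite /nm normc_def /= expr0n add0r expr1n sqrtr1. Qed.

Lemma exp_term_bound (z : C) n : nm z <= 8^-1 -> nm (z ^+ n / n`!%:R) <= 1 / 8 ^+ n.
Proof.
move=> hz; rewrite nmM nmV nmX nm_nat div1r -exprVn.
have h : nm z ^+ n <= 8^-1 ^+ n by apply: lerXn2r => //; rewrite nnegrE ?nm_ge0 ?invr_ge0.
apply: le_trans h; rewrite ler_pdivrMr; last by have := fact_ge1 n; lra.
by apply: ler_peMr; [rewrite exprn_ge0 ?nm_ge0|exact: fact_ge1].
Qed.

Lemma has_sum_expR (a : R) : has_sum (fun n => (a%:C) ^+ n / n`!%:R) (expR a)%:C.
Proof.
have h : has_sum (fun n => (exp_coeff a n)%:C) (expR a)%:C.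
  by apply: has_sum_real; exact: is_cvg_series_exp_coeff.
have -> : (fun n => (a%:C) ^+ n / n`!%:R) = (fun n => (exp_coeff a n)%:C).
  by apply/funext => n; rewrite /exp_coeff /= rmorphM rmorphXn fmorphV rmorph_nat.
exact: h.
Qed.

(** Even powers give the cosine series and odd powers the sine series. *)
Lemma has_sum_cis (b : R) : has_sum (fun n => ('i * b%:C) ^+ n / n`!%:R) (cos b +i* sin b).
Proof.
have hc : has_sum (fun n => (cos_coeff b n)%:C) (cos b)%:C.
  by apply: has_sum_real; rewrite cos.unlock; exact: is_cvg_series_cos_coeff.
have hs : has_sum (fun n => (sin_coeff b n)%:C) (sin b)%:C.
  by apply: has_sum_real; rewrite sin.unlock; exact: is_cvg_series_sin_coeff.
have := has_sum_add hc (has_sum_scale (c := 'i) hs).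
rewrite [cos b +i* sin b]complexE /=.
have -> : (fun n => ('i * b%:C) ^+ n / n`!%:R) =
   (fun n => (cos_coeff b n)%:C + 'i * (sin_coeff b n)%:C).
  apply/funext => n; rewrite /cos_coeff /sin_coeff /= -!exprnP.
  have i2 : ('i : C) ^+ 2 = - 1 by rewrite sqr_i.
  rewrite !rmorphM !rmorphXn !fmorphV !rmorph_nat rmorphN rmorph1 exprMn.
  rewrite -{1}(odd_double_half n); case: (boolP (odd n)) => hn /=.
    have e : (n.-1./2 = n./2)%N by move: hn; lia.
    rewrite !mul0r add0r mul1r e add1n exprS -mul2n exprM i2.
    by rewrite -!mulrA.
  by rewrite !mul0r mulr0 addr0 mul1r add0n -mul2n exprM i2 -!mulrA.
exact.
Qed.

(** The exponential is defined through its real and imaginary parts; the Cauchy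
    product of the series of the two factors is the exponential series by the
    binomial theorem. *)
Lemma psum_exp (z : C) : nm z <= 8^-1 -> psum (fun n => (n`!%:R)^-1) z (cexp z).
Proof.
case: z => a b hz.
have ha : nm (a%:C) <= 8^-1.
  apply: le_trans hz; rewrite nm_real -lecR -nmE.
  by have := normc_ge_Re (a +i* b).
have hb : nm ('i * b%:C) <= 8^-1.
  apply: le_trans hz; rewrite nmM nm_i mul1r nm_real.
  rewrite /nm normc_def /= -sqrtr_sqr ler_sqrt; last by rewrite addr_ge0// sqr_ge0.
  by rewrite lerDr sqr_ge0.
have h := cauchy_product (fun i => exp_term_bound i ha) (fun i => exp_term_bound i hb)
  (@has_sum_expR a) (@has_sum_cis b).
rewrite /psum /cexp /=.
have -> : (fun i => i`!%:R^-1 * (a +i* b) ^+ i) =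
  conv (fun n => a%:C ^+ n / n`!%:R) (fun n => ('i * b%:C) ^+ n / n`!%:R).
  apply/funext => n; rewrite [a +i* b]complexE /= exprDn big_distrr /conv /=.
  rewrite (reindex_inj rev_ord_inj) /=; apply: eq_bigr => i _.
  have hi : (i <= n)%N by rewrite -ltnS.
  have hi' : (n.+1 - i.+1 = n - i)%N by rewrite subSS.
  rewrite hi' subKn// -mulr_natr -(bin_fact (n := n) (m := n - i)) ?leq_subr// subKn// !natrM.
  have f0 k : (k`!%:R : C) != 0 by rewrite pnatr_eq0 -lt0n fact_gt0.
  have b0 : ('C(n, n - i)%:R : C) != 0 by rewrite pnatr_eq0 -lt0n bin_gt0 leq_subr.
  by field; rewrite !f0 b0.
exact: h.
Qed.

Lemma meromorphic_cexp (k : C) x0 : meromorphic_at (fun x => cexp (k * x)) x0.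
Proof.
have h1 : meromorphic_at (fun x => cexp (k * (x - x0))) x0.
  apply/meromorphicE; exists 0%N, (fun n => (n`!%:R)^-1 * k ^+ n).
  have d0 : 0 < 8^-1 / (nm k + 1) by rewrite divr_gt0// ?invr_gt0//; have := nm_ge0 k; lra.
  apply: punctured_imp (punctured_small x0 d0) => x.
  rewrite ltr_pdivlMr; last by have := nm_ge0 k; lra.
  move=> hx; rewrite expr0 mul1r.
  have : nm (k * (x - x0)) <= 8^-1.
    by rewrite nmM; have := nm_ge0 (x - x0); move: hx; rewrite mulrDr mulr1 [nm k * _]mulrC; lra.
  move/psum_exp; rewrite /psum.
  have -> : (fun i => i`!%:R^-1 * (k * (x - x0)) ^+ i) = (fun i => i`!%:R^-1 * k ^+ i * (x - x0) ^+ i).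
    by apply/funext => i; rewrite exprMn mulrA.
  exact.
have -> : (fun x => cexp (k * x)) = (fun x => cexp (k * x0) * cexp (k * (x - x0))).
  by apply/funext => x; rewrite -cexpD; congr cexp; ring.
exact: (meromorphic_mul (meromorphic_const _ _) h1).
Qed.

Lemma cexp_continuous0 (k : C) (e : R) : 0 < e ->
  exists2 d : R, 0 < d & forall x, nm x < d -> nm (cexp (k * x) - 1) < e.
Proof.
have h : analytic_at (fun x => cexp (k * x)) 0.
  exists (fun n => (n`!%:R)^-1 * k ^+ n); apply/near_ballR.
  have d0 : 0 < 8^-1 / (nm k + 1) by rewrite divr_gt0// ?invr_gt0//; have := nm_ge0 k; lra.
  exists (8^-1 / (nm k + 1)) => // x.
  rewrite ltr_pdivlMr; last by have := nm_ge0 k; lra.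
  rewrite subr0 => hx.
  have : nm (k * x) <= 8^-1.
    by rewrite nmM; have := nm_ge0 x; move: hx; rewrite mulrDr mulr1 [nm k * _]mulrC; lra.
  move/psum_exp; rewrite /psum.
  have -> : (fun i => i`!%:R^-1 * (k * x) ^+ i) = (fun i => i`!%:R^-1 * k ^+ i * x ^+ i).
    by apply/funext => i; rewrite exprMn mulrA.
  exact.
move=> e0; have [d d0 hd] := analytic_continuous h e0; exists d => // x hx.
have := hd x; rewrite subr0 mulr0 => /(_ hx).
by rewrite {2}/cexp /= expR0 cos0 sin0 mul1r.
Qed.
End Exponential.

Section Qp.
Local Open Scope classical_set_scope.
Local Open Scope ring_scope.
Local Open Scope complex_scope.
Variables (R : realType) (eta : R[i]).
Hypothesis heta : 0 < complex.Im eta.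
Local Notation C := R[i].
Local Notation qp := (qp eta).

Lemma nm_qp_real (t : R) : nm (qp t%:C) = expR (- (pi * complex.Im eta * t)).
Proof.
rewrite /Defs.qp; apply: complexI; rewrite -nmE norm_cexp; congr (expR _)%:C.
by case: (eta) => a b /=; rewrite !(mul0r, mulr0, subr0, sub0r, addr0, add0r, mulr1, mul1r); ring.
Qed.

Lemma nm_qpD a b : nm (qp (a + b)) = nm (qp a) * nm (qp b).
Proof. by rewrite qpD nmM. Qed.

(** Since [eta] has positive imaginary part, the modulus of q^t is strictly
    decreasing in the real variable [t]. *)
Lemma qp_real_inj (s t : R) : qp s%:C = qp t%:C -> s = t.
Proof.
move=> /(congr1 (@nm R)); rewrite !nm_qp_real => /expR_inj /oppr_inj.
by apply: mulfI; rewrite mulf_neq0// gt_eqF// pi_gt0.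
Qed.

Lemma meromorphic_qp (a b : C) x0 : meromorphic_at (fun x => qp (a + b * x)) x0.
Proof.
have -> : (fun x => qp (a + b * x)) = (fun x => qp a * cexp (pi%:C * 'i * eta * b * x)).
  by apply/funext => x; rewrite qpD /Defs.qp -!mulrA.
exact: (meromorphic_mul (meromorphic_const _ _) (meromorphic_cexp _ _)).
Qed.

(** The identity theorem along the half line [x0 - t], [t >= 0], on which
    |q^(2x)| tends to infinity.  Near each point, and off it, a meromorphic
    function vanishes identically or nowhere; at the infimum of the [t] around which it vanishes,
    the second alternative contradicts the definition of the infimum, and the
    first one allows a smaller [t], unless the infimum is 0. *)
Lemma meromorphic_vanish (f : C -> C) :
  (forall x0, meromorphic_at f x0) ->
  (exists r : R, forall y, r%:C < `|qp (2 * y)| -> f y = 0) ->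
  forall x0, punctured x0 (fun y => f y = 0).
Proof.
move=> mf [r hr] x0.
pose A : set R := [set t | 0 <= t /\ punctured (x0 - t%:C) (fun y => f y = 0)].
have spread t (P : C -> Prop) : punctured (x0 - t%:C) P ->
    exists2 d : R, 0 < d & forall t', t' != t -> `|t' - t| < d -> punctured (x0 - t'%:C) P.
  move=> [d d0 hd]; exists d => // t' ht ht'.
  have hn : nm ((x0 - t'%:C) - (x0 - t%:C)) = `|t' - t|.
    rewrite (_ : _ - _ = (t - t')%:C); last by rewrite rmorphB /=; ring.
    by rewrite nm_real distrC.
  have ht0 : 0 < `|t' - t| by rewrite normr_gt0 subr_eq0.
  exists (Num.min `|t' - t| (d - `|t' - t|)); first by rewrite lt_min ht0 subr_gt0.
  move=> y yt; rewrite lt_min => /andP[h1 h2]; apply: hd.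
    apply/eqP => e; move: h1; rewrite e nmBC hn; lra.
  have -> : y - (x0 - t%:C) = (y - (x0 - t'%:C)) + ((x0 - t'%:C) - (x0 - t%:C)) by ring.
  apply: le_lt_trans (nmD _ _) _; rewrite hn; lra.
(* For large [t] a whole ball around [x0 - t] lies in the region where [f]
   vanishes. *)
have A0 : A !=set0.
  have [d d0 hd] : exists2 d : R, 0 < d & forall h, nm h < d -> 2^-1 < nm (qp (2 * h)).
    have [|d d0 hd] := @cexp_continuous0 _ (pi%:C * 'i * eta * 2) 2^-1; first by rewrite invr_gt0.
    exists d => // h /hd; rewrite /Defs.qp mulrA.
    set z := cexp _ => hz; have : nm 1 <= nm z + nm (z - 1).
      by rewrite [nm (z - 1)]nmBC; apply: le_trans (nmD _ _); rewrite addrC subrK.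
    by rewrite nm1; lra.
  pose c := 2 * pi * complex.Im eta.
  have c0 : 0 < c by rewrite !mulr_gt0// pi_gt0.
  pose B := nm (qp (2 * x0)).
  have B0 : 0 < B by rewrite nm_gt0// qp_neq0.
  pose T := 2 * `|r| / B / c.
  have T0 : 0 <= T by apply: divr_ge0 (ltW c0); apply: divr_ge0 (ltW B0); apply: mulr_ge0.
  exists T; split=> //; exists d => // y _ hy; apply: hr.
  rewrite nmE ltcR.
  have -> : 2 * y = 2 * x0 + (2 * (y - (x0 - T%:C)) + (- (2 * T))%:C).
    have -> : (- (2 * T))%:C = - (2 * T%:C) by rewrite rmorphN rmorphM rmorph_nat.
    by ring.
  have eN : nm (qp (2 * x0 + (2 * (y - (x0 - T%:C)) + (- (2 * T))%:C))) =
      B * (nm (qp (2 * (y - (x0 - T%:C)))) * expR (c * T)).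
    transitivity (B * nm (qp (2 * (y - (x0 - T%:C)) + (- (2 * T))%:C))); first exact: nm_qpD.
    congr (_ * _); transitivity (nm (qp (2 * (y - (x0 - T%:C)))) * nm (qp (- (2 * T))%:C)).
      exact: nm_qpD.
    by congr (_ * _); rewrite (nm_qp_real (- (2 * T))); congr expR; rewrite /c; ring.
  rewrite eN.
  have hcT : c * T = 2 * `|r| / B by rewrite /T mulrC divfK// gt_eqF.
  have h1 : 1 + c * T <= expR (c * T) by exact: expR_ge1Dx.
  have h2 := hd _ hy.
  have h3 : 2^-1 * (1 + c * T) <= nm (qp (2 * (y - (x0 - T%:C)))) * expR (c * T).
    have i0 : 0 <= 2^-1 :> R by rewrite invr_ge0.
    have j0 : 0 <= 1 + c * T by rewrite addr_ge0// mulr_ge0// ltW.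
    exact: (ler_pM i0 j0 (ltW h2) h1).
  apply: (@lt_le_trans _ _ (B * (2^-1 * (1 + c * T)))); last by rewrite ler_pM2l.
  rewrite hcT; have -> : B * (2^-1 * (1 + 2 * `|r| / B)) = B / 2 + `|r|.
    by field; rewrite gt_eqF.
  by have := ler_norm r; lra.
have lbA : has_lbound A by exists 0 => t [].
have infA : has_inf A by [].
set s := inf A.
have s0 : 0 <= s by apply: lb_le_inf => // t [].
have sle t : A t -> s <= t by move=> At; apply: ge_inf.
case: (meromorphic_dichotomy (mf (x0 - s%:C))) => h.
  have [d d0 hd] := spread _ _ h.
  have [s00|s00] := eqVneq s 0; first by move: h; rewrite s00 subr0.
  have sp : 0 < s by rewrite lt_def s00.
  pose t := Num.max 0 (s - d / 2).
  have ts : t < s by rewrite /t gt_max sp; lra.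
  have tA : A t.
    split; first by rewrite /t le_max lexx.
    apply: hd; first by rewrite lt_eqF.
    rewrite ltr0_norm; last by rewrite subr_lt0.
    have : s - d / 2 <= t by rewrite /t le_max lexx orbT.
    lra.
  by have := sle _ tA; rewrite leNgt ts.
have [d d0 hd] := spread _ _ h.
have [t tA ht] := inf_adherent d0 infA.
have st := sle _ tA.
have [e|ne] := eqVneq t s.
  case: tA => _; rewrite e => h'.
  by have [y _ [h1 h2]] := punctured_ex (punctured_and h h').
have := hd t ne; rewrite ger0_norm ?subr_ge0//.
have -> : t - s < d by move: ht; rewrite -/s; lra.
move=> /(_ isT) h'; case: tA => _ h''.
by have [y _ [h1 h2]] := punctured_ex (punctured_and h' h'').
Qed.
End Qp.

(** * Laurent polynomials in an exponential *)

Section Laurent.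
Variables (R : realType) (eta : R[i]).
Hypothesis heta : 0 < complex.Im eta.
Local Notation C := R[i].
Local Notation qp := (qp eta).
Local Notation br := (br eta).
Local Notation brn := (brn eta).
Local Notation Phi := (Phi eta).

Local Notation phi_op := (phi_op eta).
Local Notation rcoef := (rcoef eta).

(** Up to a power of [qp z], a polynomial in [qp z]. All that enters the
    exchange relation is of this form in each of the two weights and in lambda,
    once denominators are cleared. *)
Definition laurent (f : C -> C) : Prop :=
  exists (p : {poly C}) (d : nat), forall z, f z * qp z ^+ d = p.[qp z].

Lemma laurent_ext f g : (forall z, f z = g z) -> laurent f -> laurent g.
Proof. by move=> e [p [d h]]; exists p, d => z; rewrite -e. Qed.

Lemma laurent_const c : laurent (fun=> c).
Proof. by exists c%:P, 0%N => z; rewrite mulr1 hornerC. Qed.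

Lemma laurent_add f g : laurent f -> laurent g -> laurent (fun z => f z + g z).
Proof.
move=> [p [d hp]] [p' [d' hp']]; exists (p * 'X^d' + p' * 'X^d), (d + d')%N => z.
by rewrite !hornerE -hp -hp' exprD; ring.
Qed.

Lemma laurent_mul f g : laurent f -> laurent g -> laurent (fun z => f z * g z).
Proof.
move=> [p [d hp]] [p' [d' hp']]; exists (p * p'), (d + d')%N => z.
by rewrite !hornerE -hp -hp' exprD; ring.
Qed.

Lemma laurent_sum (I : Type) (r : seq I) (f : I -> C -> C) :
  (forall i, laurent (f i)) -> laurent (fun z => \sum_(i <- r) f i z).
Proof.
move=> h; elim: r => [|i r IH].
  by apply: (laurent_ext (f := fun=> 0) _ (laurent_const 0)) => z; rewrite big_nil.
by apply: (laurent_ext _ (laurent_add (h i) IH)) => z; rewrite big_cons.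
Qed.

Lemma laurent_prod (I : Type) (r : seq I) (P : pred I) (f : I -> C -> C) :
  (forall i, laurent (f i)) -> laurent (fun z => \prod_(i <- r | P i) f i z).
Proof.
move=> h; elim: r => [|i r IH].
  by apply: (laurent_ext (f := fun=> 1) _ (laurent_const 1)) => z; rewrite big_nil.
case Pi : (P i); last by apply: (laurent_ext _ IH) => z; rewrite big_cons Pi.
by apply: (laurent_ext _ (laurent_mul (h i) IH)) => z; rewrite big_cons Pi.
Qed.

(** The integral slope is what makes [qp (e z)] a Laurent polynomial; it is
    written as a difference of natural numbers to match [laurent]. *)
Definition affine (e : C -> C) : Prop :=
  exists c (a b : nat), forall z, e z = c + (a%:R - b%:R) * z.

Lemma aff_const c : affine (fun=> c).
Proof. by exists c, 0%N, 0%N => z; rewrite subrr mul0r addr0. Qed.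

Lemma aff_id : affine (fun z => z).
Proof. by exists 0, 1%N, 0%N => z; rewrite subr0 mul1r add0r. Qed.

Lemma aff_add e f : affine e -> affine f -> affine (fun z => e z + f z).
Proof.
move=> [c [a [b h]]] [c' [a' [b' h']]]; exists (c + c'), (a + a')%N, (b + b')%N => z.
by rewrite h h' !natrD; ring.
Qed.

Lemma aff_opp e : affine e -> affine (fun z => - e z).
Proof. by move=> [c [a [b h]]]; exists (- c), b, a => z; rewrite h; ring. Qed.

Lemma aff_sub e f : affine e -> affine f -> affine (fun z => e z - f z).
Proof. by move=> h h'; exact: aff_add h (aff_opp h'). Qed.

Lemma aff_nat n e : affine e -> affine (fun z => n%:R * e z).
Proof.
move=> [c [a [b h]]]; exists (n%:R * c), (n * a)%N, (n * b)%N => z.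
by rewrite h !natrM; ring.
Qed.

Lemma qp_nat n z : qp (n%:R * z) = qp z ^+ n.
Proof.
elim: n => [|n IH]; first by rewrite mul0r qp0.
by rewrite -natr1 mulrDl mul1r qpD IH exprSr.
Qed.

Lemma laurent_qp e : affine e -> laurent (fun z => qp (e z)).
Proof.
move=> [c [a [b h]]]; exists (qp c *: 'X^a), b => z.
rewrite h !hornerE -!qp_nat -!qpD; congr qp; ring.
Qed.

Lemma laurent_br e : affine e -> laurent (fun z => br (e z)).
Proof.
move=> h; have := laurent_mul (laurent_add (laurent_qp h) (laurent_mul (laurent_const (- 1)) (laurent_qp (aff_opp h)))) (laurent_const (qp 1 - qp (- 1))^-1).
by apply: laurent_ext => z; rewrite /Defs.br mulN1r.
Qed.

Lemma laurent_brn e k : affine e -> laurent (fun z => brn (e z) k).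
Proof.
move=> h; apply: (@laurent_prod 'I_k _ xpredT (fun i z => br (e z + i%:R))) => i.
by apply: laurent_br; apply: aff_add => //; exact: aff_const.
Qed.

(** A polynomial with infinitely many roots vanishes, and [qp] is injective
    along a real line. The sequences of points used are the large integers
    ([laurent_zero_nat]) and points tending to [z0] ([punctured_zero]). *)
Lemma laurent_zero (f : C -> C) (z0 : C) (g : nat -> R) : laurent f -> injective g ->
  (forall j, f (z0 + (g j)%:C) = 0) -> forall z, f z = 0.
Proof.
move=> [p [d h]] ginj hg z.
suff p0 : p = 0.
  by have := h z; rewrite p0 horner0 => /eqP; rewrite mulf_eq0 expf_eq0 (negbTE (qp_neq0 _ _)) andbF orbF => /eqP.
apply/eqP; apply: contraT => p0.
pose rs := [seq qp (z0 + (g j)%:C) | j <- iota 0 (size p)].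
have hroot : all (root p) rs by apply/allP => y /mapP[j _ ->]; rewrite /root -h hg mul0r.
have hun : uniq rs.
  rewrite map_inj_uniq ?iota_uniq// => i j; rewrite !qpD => /(mulfI (qp_neq0 _ _)) /(qp_real_inj heta).
  exact: ginj.
by have := max_poly_roots p0 hroot hun; rewrite size_map size_iota ltnn.
Qed.

Lemma laurent_zero_nat (f : C -> C) K : laurent f -> (forall k, (K <= k)%N -> f k.+1%:R = 0) ->
  forall z, f z = 0.
Proof.
move=> lf h; apply: (@laurent_zero f 0 (fun j => (K + j).+1%:R)) => //.
  by move=> i j /eqP; rewrite eqr_nat eqSS eqn_add2l => /eqP.
by move=> j; rewrite add0r rmorph_nat h// leq_addr.
Qed.

Lemma punctured_zero (f : C -> C) z0 : laurent f -> punctured z0 (fun z => f z = 0) -> forall z, f z = 0.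
Proof.
move=> lf [e e0 h]; apply: (@laurent_zero f z0 (fun j => e / j.+2%:R)) => //.
  move=> i j /(mulfI (lt0r_neq0 e0)) /invr_inj /eqP; rewrite eqr_nat => /eqP []//.
move=> j; have p0 : 0 < e / j.+2%:R by rewrite divr_gt0.
apply: h; first by rewrite -subr_eq0 addrAC subrr add0r -nm_eq0 nm_real gt_eqF// normr_gt0 gt_eqF.
rewrite addrAC subrr add0r nm_real gtr0_norm// ltr_pdivrMr// ltr_pMr// .
by rewrite ltr1n.
Qed.

(** The zeros are isolated by [meromorphic_dichotomy], unless the function
    vanishes near some point and hence everywhere. *)
Lemma laurent_generic (f : C -> C) z1 : laurent f -> f z1 <> 0 -> generically (fun z => f z != 0).
Proof.
move=> lf hz1 z0; apply/near_puncturedR.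
have [p [d h]] := lf.
have mp : meromorphic_at (fun z => p.[qp z]) z0.
  have -> : (fun z => p.[qp z]) = (fun z => \sum_(i < size p) p`_i * qp (0 + i%:R * z)).
    by apply/funext => z; rewrite horner_coef; apply: eq_bigr => i _; rewrite add0r qp_nat.
  apply: (@meromorphic_sum _ 'I_(size p) _ xpredT (fun i z => p`_i * qp (0 + i%:R * z))) => i.
  exact: (meromorphic_mul (meromorphic_const _ _) (meromorphic_qp _ _ _ _)).
case: (meromorphic_dichotomy mp) => hd.
  case: hz1; apply: (punctured_zero (z0 := z0)) => //; apply: punctured_imp hd => z hz.
  by have := h z; rewrite hz => /eqP; rewrite mulf_eq0 expf_eq0 (negbTE (qp_neq0 _ _)) andbF orbF => /eqP.
by apply: punctured_imp hd => z hz; apply/eqP => fz; apply: hz; rewrite -h fz mul0r.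
Qed.

Lemma laurent_generic_zero (f : C -> C) : laurent f -> generically (fun z => f z = 0) -> forall z, f z = 0.
Proof. by move=> lf /(_ 0) /near_puncturedR h; exact: punctured_zero h. Qed.

Lemma br_generic : generically (fun lam => br lam != 0).
Proof.
apply: (laurent_generic (z1 := 1)); first exact: laurent_br aff_id.
by rewrite br1//; apply/eqP; exact: oner_neq0.
Qed.

Lemma laurent_Phi m L lam k i j : affine L -> affine lam -> laurent (fun z => Phi m (L z) (lam z) k i j).
Proof.
move=> hL hlam; elim: k i j => [|k IH] i j.
  apply: laurent_ext (fun z => esym (Phi0_hw _ _ _ _ _ _)) _.
  case: eqP => _; last exact: laurent_const.
  apply: laurent_mul (laurent_const _); apply: laurent_mul.
    apply: laurent_qp; apply: aff_nat; apply: aff_sub; last exact: aff_const.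
    by apply: aff_add (aff_const _); exact: aff_sub.
  apply: laurent_brn; apply: aff_add (aff_const _); apply: aff_add (aff_const _).
  by apply: aff_sub (aff_const _); apply: aff_add => //; exact: aff_opp.
apply: (laurent_ext (f := fun z => (br k.+1%:R)^-1 * (br i%:R * (qp (- (L z - 2 * j%:R)) * Phi m (L z) (lam z) k i.-1 j) +
  (if j is j'.+1 then br (L z - j'%:R) * Phi m (L z) (lam z) k i j' else 0)))).
  by move=> z; rewrite -(Phi_recF heta) mulKf// br_neq0.
apply: laurent_mul (laurent_const _) _; apply: laurent_add.
  apply: laurent_mul (laurent_const _) _; apply: laurent_mul => //.
  by apply: laurent_qp; apply: aff_opp; apply: aff_sub => //; exact: aff_const.
case: j => [|j]; first exact: laurent_const.
apply: laurent_mul => //.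
by apply: laurent_br; apply: aff_sub => //; exact: aff_const.
Qed.

Lemma laurent_phi_op m L lam j f i : affine L -> affine lam ->
  (forall k, laurent (fun z => f z k)) -> laurent (fun z => phi_op m (L z) (lam z) j (f z) i).
Proof.
move=> hL hlam hf; apply: laurent_sum => k; apply: laurent_mul; first exact: hf.
exact: laurent_Phi.
Qed.

Lemma laurent_rcoef L1 L2 j1 j2 s : affine L1 -> affine L2 -> laurent (fun z => rcoef (L1 z) (L2 z) j1 j2 s).
Proof.
move=> h1 h2; apply: laurent_mul (laurent_const _); apply: laurent_mul.
  apply: laurent_mul (laurent_const _); apply: laurent_qp; apply: aff_add (aff_const _).
  by apply: aff_sub; [apply: aff_opp|]; exact: aff_nat.
apply: laurent_brn; apply: aff_add (aff_const _).
by apply: aff_sub => //; exact: aff_const.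
Qed.

Lemma laurent_eval3 (P : {poly {poly {poly C}}}) a b c : laurent a -> laurent b -> laurent c ->
  laurent (fun z => eval3 P (a z) (b z) (c z)).
Proof.
move=> ha hb hc.
have lpX f n : laurent f -> laurent (fun z => f z ^+ n).
  move=> hf; elim: n => [|n IH]; first exact: laurent_const.
  by apply: (laurent_ext _ (laurent_mul hf IH)) => z; rewrite exprS.
have h1 (p : {poly C}) f : laurent f -> laurent (fun z => p.[f z]).
  move=> hf; apply: (laurent_ext (f := fun z => \sum_(i < size p) p`_i * f z ^+ i)).
    by move=> z; rewrite horner_coef.
  by apply: laurent_sum => i; apply: laurent_mul (laurent_const _) _; exact: lpX.
have h2 (p : {poly {poly C}}) : laurent (fun z => p.[(b z)%:P].[a z]).
  apply: (laurent_ext (f := fun z => \sum_(i < size p) (p`_i).[a z] * b z ^+ i)).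
    move=> z; rewrite (horner_coef p) horner_sum; apply: eq_bigr => i _.
    by rewrite hornerM -polyC_exp hornerC.
  by apply: laurent_sum => i; apply: laurent_mul; [exact: h1|exact: lpX].
rewrite /eval3; apply: (laurent_ext (f := fun z => \sum_(i < size P) (P`_i).[(b z)%:P].[a z] * c z ^+ i)).
  move=> z; rewrite (horner_coef P) !horner_sum; apply: eq_bigr => i _.
  by rewrite -!polyC_exp !hornerM !hornerC.
by apply: laurent_sum => i; apply: laurent_mul; [exact: h2|exact: lpX].
Qed.
End Laurent.

(** * Exchange relation for positive integral weights *)

Section IntegralWeights.
Variables (R : realType) (eta : R[i]).
Hypothesis heta : 0 < complex.Im eta.
Local Notation C := R[i].
Local Notation br := (br eta).

Local Notation exchange := (exchange eta).
Variable RR : C -> C -> C -> nat -> nat -> nat -> nat -> C.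
Hypothesis hRR : is_dynR eta RR.

Lemma exchange_ext r r' L1 L2 n1 n2 lam :
  (forall p, (p <= n1 + n2)%N -> r p = r' p) ->
  exchange r L1 L2 n1 n2 lam -> exchange r' L1 L2 n1 n2 lam.
Proof.
move=> h ex f i j1 j2; rewrite -ex; apply: eq_bigr => p _.
by rewrite h// -ltnS.
Qed.

(** The exchange relation for the dynamical R-matrix. It is only meaningful off
    the poles in lambda. *)
Definition gexchange (L1 L2 : C) (n1 n2 : nat) : Prop :=
  generically (fun lam => exchange (fun p => RR L1 L2 lam p (n1 + n2 - p) n1 n2) L1 L2 n1 n2 lam).

Lemma gdesc1 k L2 m1 m2 n1 n2 : (n1 <= k < m1)%N -> generically (fun lam => RR k%:R L2 lam m1 m2 n1 n2 = 0).
Proof. exact: (dynR_descends1 hRR). Qed.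
Lemma gdesc2 k L1 m1 m2 n1 n2 : (n2 <= k < m2)%N -> generically (fun lam => RR L1 k%:R lam m1 m2 n1 n2 = 0).
Proof. exact: (dynR_descends2 hRR). Qed.

Lemma gexchange11 n1 n2 : (n1 <= 1)%N -> (n2 <= 1)%N -> gexchange 1 1 n1 n2.
Proof.
move=> h1 h2.
have g20 : generically (fun lam => RR 1 1 lam 2 0 1 1 = 0) by apply: (@gdesc1 1).
have g02 : generically (fun lam => RR 1 1 lam 0 2 1 1 = 0) by apply: (@gdesc2 1).
have gv := generically_and (br_generic heta) (generically_and (dynR_vector hRR) (generically_and g20 g02)).
apply: generically_imp gv => lam [hl [[[e00 e11] e0101 e0110 e1001 e1010] [e20 e02]]].
case: n1 h1 => [|[|n1]]// _; case: n2 h2 => [|[|n2]]// _.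
- exact: exchange_base00.
- exact: exchange_base01.
- exact: exchange_base10.
- exact: exchange_base11.
Qed.

(** Induction on [k] by [fusion_left]. The index [n1] is split as [n1 + n2] with
    [n2] at most 1 and [n1] at most [k.+1]: this keeps the induction within the
    indices of the irreducible modules. *)
Lemma gexchange_k1 k n1 n2 : (n1 <= k.+1)%N -> (n2 <= 1)%N -> gexchange k.+1%:R 1 n1 n2.
Proof.
elim: k n1 n2 => [|k IH] n1' n3 hn1' hn3; first exact: gexchange11.
(* Only the top index needs a unit from the factor of weight 1. *)
pose n2 := nat_of_bool (n1' == k.+2); pose n1 := (n1' - n2)%N.
have hn2 : (n2 <= 1)%N by rewrite /n2; case: eqP.
have hn1 : (n1 <= k.+1)%N by rewrite /n1 /n2; case: eqP => e; lia.
have -> : n1' = (n1 + n2)%N by rewrite /n1 /n2; case: eqP => e; lia.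
clearbody n1 n2; clear n1' hn1'.
pose N := (n1 + n2 + n3)%N.
rewrite /gexchange -natr1.
have gf : generically (fun lam => forall p, (p < N.+1)%N ->
    RR (k.+1%:R + 1) 1 lam p (N - p) (n1 + n2) n3 =
    \sum_(m2 < p.+1) \sum_(l < (p + (N - p)).+1)
       RR 1 1 lam m2 l n2 n3 * RR k.+1%:R 1 (lam - (1 - 2 * m2%:R)) (p - m2) (N - p) n1 l).
  by apply: generically_lt => p _; apply: (dynR_fusion1 hRR).
have gw : generically (fun lam => forall m2, (m2 < N.+1)%N -> forall l, (l < N.+1)%N ->
    (m2 + l)%N <> (n2 + n3)%N \/ (1 < m2)%N -> RR 1 1 lam m2 l n2 n3 = 0).
  apply: generically_lt => m2 _; apply: generically_lt => l _.
  have [e|ne] := eqVneq (m2 + l)%N (n2 + n3)%N.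
    have [hm|hm] := leqP m2 1.
      by apply: generically_imp (@generically_true _) => lam _ [ne|//]; case: (ne e).
    by apply: generically_imp (@gdesc1 1 1 m2 l n2 n3 _) => //; rewrite hn2.
  by apply: generically_imp (dynR_weight hRR 1 1 _) => [lam -> //|]; apply/eqP; exact: ne.
have ge : generically (fun lam => forall m2, (m2 < 2)%N -> (m2 <= n2 + n3)%N ->
    RR 1 1 lam m2 (n2 + n3 - m2) n2 n3 = 0 \/
    exchange (fun p => RR k.+1%:R 1 (lam - (1 - 2 * m2%:R)) p (n1 + (n2 + n3 - m2) - p) n1 (n2 + n3 - m2))
      k.+1%:R 1 n1 (n2 + n3 - m2) (lam - (1 - 2 * m2%:R))).
  apply: generically_lt => m2 hm2.
  have [hl|hl] := leqP (n2 + n3 - m2) 1.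
    have := generically_shift (1 - 2 * m2%:R) (IH n1 (n2 + n3 - m2)%N hn1 hl).
    by apply: generically_imp => lam h _; right.
  apply: generically_imp (@gdesc2 1 1 m2 (n2 + n3 - m2) n2 n3 _) => [lam h _|]; first by left.
  by rewrite hn3.
have gb := gexchange11 hn2 hn3.
apply: generically_imp (generically_and gf (generically_and gw (generically_and ge gb))).
move=> lam [hf [hw [he hb]]].
(* The coefficients known to vanish generically are replaced by 0, so that the
   hypotheses of [fusion_left] hold for all indices. *)
pose a m2 l := if [&& (m2 <= 1)%N & (m2 + l == n2 + n3)%N] then RR 1 1 lam m2 l n2 n3 else 0.
pose b m2 p m3 l := RR k.+1%:R 1 (lam - (1 - 2 * m2%:R)) p m3 n1 l.
apply: (@fusion_left _ _ heta _ a b) => //.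
- move=> p hp; rewrite hf ?ltnS// subnKC//.
  apply: eq_bigr => m2 _; apply: eq_bigr => l _; rewrite /a; case: ifP => // hc.
  rewrite hw ?mul0r//; first by have := ltn_ord m2; lia.
  by move: hc; case: leqP => hm /=; [move=> /eqP; left|right].
- by move=> m2 l hml; rewrite /a; case: eqP; rewrite ?andbF.
- by move=> m2 l hm2; rewrite /a leqNgt hm2.
- apply: exchange_ext hb => p hp; rewrite /a subnKC// eqxx andbT; case: leqP => // hp1.
  by rewrite hw//; [lia|lia|right].
- move=> m2 hm2 hm2'; rewrite /a hm2 subnKC// eqxx /=.
  by apply: he.
Qed.

(** The same induction in the second weight, by [fusion_right]. *)
Lemma gexchange_kl k l n1 n2 : (n1 <= k.+1)%N -> (n2 <= l.+1)%N ->
  gexchange k.+1%:R l.+1%:R n1 n2.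
Proof.
elim: l n1 n2 => [|l IH] n1 n2' hn1 hn2'; first exact: gexchange_k1.
pose n3 := nat_of_bool (n2' == l.+2); pose n2 := (n2' - n3)%N.
have hn3 : (n3 <= 1)%N by rewrite /n3; case: eqP.
have hn2 : (n2 <= l.+1)%N by rewrite /n2 /n3; case: eqP => e; lia.
have -> : n2' = (n2 + n3)%N by rewrite /n2 /n3; case: eqP => e; lia.
clearbody n2 n3; clear n2' hn2'.
rewrite /gexchange -(natr1 l.+1); pose N := (n1 + n2 + n3)%N.
have gf : generically (fun lam => forall p, (p < N.+1)%N ->
    RR k.+1%:R (l.+1%:R + 1) lam p (N - p) n1 (n2 + n3) =
    \sum_(m3 < (N - p).+1) \sum_(i < (p + (N - p)).+1)
       RR k.+1%:R l.+1%:R (lam - (1 - 2 * n3%:R)) i (N - p - m3) n1 n2 *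
       RR k.+1%:R 1 lam p m3 i n3).
  by apply: generically_lt => p _; apply: (dynR_fusion2 hRR).
have gw : generically (fun lam => forall i, (i < N.+1)%N -> forall m, (m < N.+1)%N ->
    (i + m)%N <> (n1 + n2)%N -> RR k.+1%:R l.+1%:R (lam - (1 - 2 * n3%:R)) i m n1 n2 = 0).
  apply: generically_lt => i _; apply: generically_lt => m _.
  have [e|/eqP ne] := eqVneq (i + m)%N (n1 + n2)%N.
    by apply: generically_imp (@generically_true _).
  apply: (generically_shift (1 - 2 * n3%:R) (P := fun lam => _ -> RR k.+1%:R l.+1%:R lam i m n1 n2 = 0)).
  by apply: generically_imp (dynR_weight hRR k.+1%:R l.+1%:R ne) => lam h _; exact: h.
have gw2 : generically (fun lam => forall p, (p < N.+1)%N -> forall m3, (m3 < N.+1)%N ->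
    forall i, (i < N.+1)%N -> (1 < m3)%N -> RR k.+1%:R 1 lam p m3 i n3 = 0).
  apply: generically_lt => p _; apply: generically_lt => m3 _; apply: generically_lt => i _.
  have [hm|hm] := leqP m3 1; first by apply: generically_imp (@generically_true _).
  apply: (@generically_imp _ (fun lam => RR k.+1%:R 1 lam p m3 i n3 = 0)) => //.
  by apply: (@gdesc2 1); rewrite hn3 hm.
have ge : generically (fun lam => forall i, (i < (n1 + n2).+1)%N ->
    RR k.+1%:R l.+1%:R (lam - (1 - 2 * n3%:R)) i (n1 + n2 - i) n1 n2 = 0 \/
    exchange (fun p => RR k.+1%:R 1 lam p (i + n3 - p) i n3) k.+1%:R 1 i n3 lam).
  apply: generically_lt => i hi.
  have [hik|hik] := leqP i k.+1.
    by apply: generically_imp (gexchange_k1 hik hn3) => lam h; right.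
  apply: (@generically_imp _ (fun lam => RR k.+1%:R l.+1%:R (lam - (1 - 2 * n3%:R)) i (n1 + n2 - i) n1 n2 = 0)).
    by move=> lam h; left.
  apply: (generically_shift (1 - 2 * n3%:R) (P := fun lam => RR k.+1%:R l.+1%:R lam i (n1 + n2 - i) n1 n2 = 0)).
  by apply: gdesc1; rewrite hn1.
have gb := generically_shift (1 - 2 * n3%:R) (IH n1 n2 hn1 hn2).
have gall := generically_and gf (generically_and gw (generically_and gw2 (generically_and ge gb))).
apply: generically_imp gall.
move=> lam [hf [hw [hw2 [he hb]]]].
pose A i m := if (i + m == n1 + n2)%N then RR k.+1%:R l.+1%:R (lam - (1 - 2 * n3%:R)) i m n1 n2 else 0.
pose B p m3 i := if (m3 <= 1)%N then RR k.+1%:R 1 lam p m3 i n3 else 0.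
apply: (@fusion_right _ _ heta _ A B) => //.
- move=> p hp; rewrite addnA -/N hf ?ltnS// subnKC//.
  apply: eq_bigr => m3 _; apply: eq_bigr => i _; rewrite /A /B.
  have hm3 := ltn_ord m3; have hi := ltn_ord i.
  case: eqP => hne; last by rewrite hw ?mul0r//; lia.
  case: leqP => // hm; rewrite hw2 ?mulr0//; lia.
- by move=> i m hne; rewrite /A; case: eqP.
- by move=> p m3 i hm3; rewrite /B leqNgt hm3.
- by apply: exchange_ext hb => p hp; rewrite /A subnKC// eqxx.
- move=> i hi; rewrite /A subnKC// eqxx.
  case: (he i) => [|h|h]; [by rewrite ltnS| by left | right].
  apply: exchange_ext h => p hp; rewrite /B; case: leqP => // hm.
  by rewrite hw2//; rewrite /N; lia.
Qed.
End IntegralWeights.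

(** * Exchange relation for arbitrary complex weights *)

Section ComplexWeights.
Variables (R : realType) (eta : R[i]).
Hypothesis heta : 0 < complex.Im eta.
Local Notation C := R[i].
Local Notation qp := (qp eta).

Local Notation phi_op := (phi_op eta).
Local Notation rcoef := (rcoef eta).
Local Notation exchange := (exchange eta).
Local Notation laurent := (laurent eta).
Variable RR : C -> C -> C -> nat -> nat -> nat -> nat -> C.
Hypothesis hRR : is_dynR eta RR.

Section Cleared.
Variables (n1 n2 : nat) (num den : nat -> {poly {poly {poly C}}}).
Local Notation N := (n1 + n2)%N.

Let nu p L1 L2 lam := eval3 (num p) (qp L1) (qp L2) (qp (2 * lam)).
Let de p L1 L2 lam := eval3 (den p) (qp L1) (qp L2) (qp (2 * lam)).

(** The difference of the two sides of the exchange relation, multiplied by the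
    product of the denominators of all coefficients.  It is a Laurent polynomial
    in each of its three parameters. *)
Definition cleared L1 L2 lam f i j1 j2 : C :=
  \sum_(p < N.+1) (nu p L1 L2 lam * \prod_(p' < N.+1 | p' != p) de p' L1 L2 lam) *
    phi_op (N - p) L2 (lam - (L1 - 2 * p%:R)) j2 (phi_op p L1 lam j1 f) i +
  (- 1) * ((\prod_(p' < N.+1) de p' L1 L2 lam) *
    \sum_(s < j1.+1) rcoef L1 L2 j1 j2 s *
    phi_op n1 L1 (lam - (L2 - 2 * n2%:R)) (j1 - s) (phi_op n2 L2 lam (j2 + s) f) i).

Lemma laurent_cleared l1 l2 lm f i j1 j2 : affine l1 -> affine l2 -> affine lm ->
  laurent (fun z => cleared (l1 z) (l2 z) (lm z) f i j1 j2).
Proof.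
move=> h1 h2 hm.
have ev P : laurent (fun z => eval3 P (qp (l1 z)) (qp (l2 z)) (qp (2 * lm z))).
  by apply: laurent_eval3; apply: laurent_qp => //; exact: aff_nat.
have sh a b : affine a -> affine (fun z => lm z - (a z - 2 * b%:R)).
  by move=> ha; apply: aff_sub => //; apply: aff_sub => //; exact: aff_const.
apply: laurent_add.
  apply: laurent_sum => p; apply: laurent_mul.
    by apply: laurent_mul; [exact: ev|apply: laurent_prod => p'; exact: ev].
  apply: laurent_phi_op => //; first exact: sh.
  by move=> k; apply: laurent_phi_op => // k'; exact: laurent_const.
apply: laurent_mul (laurent_const _ _) _; apply: laurent_mul; first by apply: laurent_prod => p'; exact: ev.
apply: laurent_sum => s; apply: laurent_mul; first exact: laurent_rcoef.
apply: laurent_phi_op => //; first exact: sh.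
by move=> k; apply: laurent_phi_op => // k'; exact: laurent_const.
Qed.

Lemma clearedE L1 L2 lam f i j1 j2 : (forall p, (p < N.+1)%N -> de p L1 L2 lam != 0) ->
  cleared L1 L2 lam f i j1 j2 = (\prod_(p' < N.+1) de p' L1 L2 lam) *
   (\sum_(p < N.+1) nu p L1 L2 lam / de p L1 L2 lam *
      phi_op (N - p) L2 (lam - (L1 - 2 * p%:R)) j2 (phi_op p L1 lam j1 f) i -
    \sum_(s < j1.+1) rcoef L1 L2 j1 j2 s *
      phi_op n1 L1 (lam - (L2 - 2 * n2%:R)) (j1 - s) (phi_op n2 L2 lam (j2 + s) f) i).
Proof.
move=> hd; rewrite /cleared mulN1r mulrBr; congr (_ - _).
rewrite big_distrr; apply: eq_bigr => p _ /=.
rewrite [X in _ = X * _](bigD1 p) //= [RHS]mulrA; congr (_ * _).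
have := hd p (ltn_ord p); set d := de p _ _ _; set a := nu p _ _ _; set b := \prod_(_ < _ | _) _.
by clearbody d a b => h0; field.
Qed.

Lemma cleared_exchange L1 L2 lam : (forall p, (p < N.+1)%N -> de p L1 L2 lam != 0) ->
  (forall p, (p < N.+1)%N -> RR L1 L2 lam p (N - p) n1 n2 = nu p L1 L2 lam / de p L1 L2 lam) ->
  exchange (fun p => RR L1 L2 lam p (N - p) n1 n2) L1 L2 n1 n2 lam <->
  forall f i j1 j2, cleared L1 L2 lam f i j1 j2 = 0.
Proof.
move=> hd hR; split=> h f i j1 j2.
  rewrite clearedE// -h -sumrB [X in _ * X]big1 ?mulr0// => p _.
  by rewrite hR// subrr.
have := h f i j1 j2; rewrite clearedE// => /eqP; rewrite mulf_eq0 => /orP[/eqP h0|].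
  exfalso; have : \prod_(p' < N.+1) de p' L1 L2 lam != 0.
    by apply/prodf_neq0 => p _; exact: hd.
  by rewrite h0 eqxx.
rewrite subr_eq0 => /eqP <-; apply: eq_bigr => p _; by rewrite hR.
Qed.
End Cleared.

(** The cleared difference vanishes for all large integral weights. Being a
    Laurent polynomial, it then vanishes for all values of the first weight, and
    after that of the second. Division is possible because the denominators do
    not vanish identically. *)
Lemma gexchange_all L1 L2 n1 n2 : gexchange eta RR L1 L2 n1 n2.
Proof.
pose N := (n1 + n2)%N.
have /choice [PQ hPQ] : forall p, exists PQ : {poly {poly {poly C}}} * {poly {poly {poly C}}},
    forall L1 L2, (exists lambda, eval3 PQ.2 (qp L1) (qp L2) (qp (2 * lambda)) != 0) /\
      generically (fun lambda => RR L1 L2 lambda p (N - p) n1 n2 =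
        eval3 PQ.1 (qp L1) (qp L2) (qp (2 * lambda)) /
        eval3 PQ.2 (qp L1) (qp L2) (qp (2 * lambda))).
  by move=> p; have [P [Q h]] := dynR_rational hRR p (N - p) n1 n2; exists (P, Q).
pose num p := (PQ p).1; pose den p := (PQ p).2.
have gen M1 M2 : generically (fun lam =>
    (forall p, (p < N.+1)%N -> eval3 (den p) (qp M1) (qp M2) (qp (2 * lam)) != 0) /\
    (forall p, (p < N.+1)%N -> RR M1 M2 lam p (N - p) n1 n2 =
       eval3 (num p) (qp M1) (qp M2) (qp (2 * lam)) / eval3 (den p) (qp M1) (qp M2) (qp (2 * lam)))).
  apply: generically_and; apply: generically_lt => p _; have [[z hz] hg] := hPQ p M1 M2 => //.
  apply: (laurent_generic heta (z1 := z)); last exact/eqP.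
  by apply: laurent_eval3; [exact: laurent_const|exact: laurent_const|apply: laurent_qp; apply: aff_nat; exact: aff_id].
have c0 M1 M2 lam f i j1 j2 : cleared n1 n2 num den M1 M2 lam f i j1 j2 = 0.
  have A k l : (n1 <= k)%N -> (n2 <= l)%N -> forall lam, cleared n1 n2 num den k.+1%:R l.+1%:R lam f i j1 j2 = 0.
    move=> hk hl; apply: (laurent_generic_zero heta).
      by apply: laurent_cleared; [exact: aff_const|exact: aff_const|exact: aff_id].
    have gk : gexchange eta RR k.+1%:R l.+1%:R n1 n2.
      by apply: (gexchange_kl heta) => //; exact: leqW.
    apply: generically_imp (generically_and (gen k.+1%:R l.+1%:R) gk) => lam' [[hd hR]].
    by move/(cleared_exchange hd hR).
  have B l : (n2 <= l)%N -> cleared n1 n2 num den M1 l.+1%:R lam f i j1 j2 = 0.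
    move=> hl; apply: (laurent_zero_nat heta (f := fun M1 => cleared n1 n2 num den M1 l.+1%:R lam f i j1 j2) (K := n1)).
      by apply: laurent_cleared; [exact: aff_id|exact: aff_const|exact: aff_const].
    by move=> k hk; exact: A.
  apply: (laurent_zero_nat heta (f := fun M2 => cleared n1 n2 num den M1 M2 lam f i j1 j2) (K := n2)).
    by apply: laurent_cleared; [exact: aff_const|exact: aff_id|exact: aff_const].
  exact: B.
apply: generically_imp (gen L1 L2) => lam [hd hR].
by apply/(cleared_exchange hd hR).
Qed.
End ComplexWeights.

(** * Composites of intertwiners in any order *)

Section Composites.
Variables (R : realType) (eta : R[i]).
Hypothesis heta : 0 < complex.Im eta.
Local Notation C := R[i].

Local Notation phi_op := (phi_op eta).
Local Notation rcoef := (rcoef eta).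
Local Notation exchange := (exchange eta).
Variables (n M : nat) (Lambda : 'I_n -> C).
Local Notation Z := (mindex n M).

Definition lwt (m : 'I_n -> nat) (s : seq 'I_n) : C := \sum_(b <- s) (Lambda b - 2 * (m b)%:R).

(** [PhiV] with the factors in any order [s] and applied to any argument [f],
    see [PhiV_fold]; the exchange relation compares two such orders. *)
Fixpoint phi_fold (s : seq 'I_n) (m m' : 'I_n -> nat) (lam : C) (f : nat -> C) : nat -> C :=
  if s is a :: s' then phi_op (m a) (Lambda a) (lam - lwt m s') (m' a) (phi_fold s' m m' lam f)
  else f.

Lemma lwt_cat m s t : lwt m (s ++ t) = lwt m s + lwt m t.
Proof. exact: big_cat. Qed.

Lemma lwt_cons m a s : lwt m (a :: s) = Lambda a - 2 * (m a)%:R + lwt m s.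
Proof. exact: big_cons. Qed.

Lemma eq_phi_fold s m1 m2 m1' m2' lam f g i : {in s, m1 =1 m2} -> {in s, m1' =1 m2'} -> f =1 g ->
  phi_fold s m1 m1' lam f i = phi_fold s m2 m2' lam g i.
Proof.
elim: s i => [|a s IH] i h h' e //=.
have hs b : b \in s -> b \in a :: s by rewrite inE orbC => ->.
rewrite (h a) ?mem_head// (h' a) ?mem_head//.
have -> : lwt m1 s = lwt m2 s by apply: eq_big_seq => b hb; rewrite h// hs.
by apply: eq_phi_op => k; apply: IH => // b hb; [apply: h|apply: h']; exact: hs.
Qed.

Lemma phi_fold_cat s t m m' lam f i :
  phi_fold (s ++ t) m m' lam f i = phi_fold s m m' (lam - lwt m t) (phi_fold t m m' lam f) i.
Proof.
elim: s i => [|a s IH] i //=.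
rewrite lwt_cat (_ : lam - (lwt m s + lwt m t) = lam - lwt m t - lwt m s); last by ring.
exact: eq_phi_op.
Qed.

Lemma phi_fold_linear (I : Type) (r : seq I) (c : I -> C) (f : I -> nat -> C) s m m' lam i :
  phi_fold s m m' lam (fun k => \sum_(p <- r) c p * f p k) i =
  \sum_(p <- r) c p * phi_fold s m m' lam (f p) i.
Proof.
elim: s i => [|a s IH] i //=.
by rewrite (eq_phi_op _ _ _ _ _ _ IH) phi_op_linear.
Qed.

Lemma phi_fold_scale c f s m m' lam i :
  phi_fold s m m' lam (fun k => c * f k) i = c * phi_fold s m m' lam f i.
Proof.
elim: s i => [|a s IH] i //=.
by rewrite (eq_phi_op _ _ _ _ _ _ IH) phi_op_scale.
Qed.

Lemma phi_fold_zero s m m' lam i : phi_fold s m m' lam (fun=> 0) i = 0.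
Proof. by elim: s i => [|a s IH] i //=; rewrite (eq_phi_op _ _ _ _ _ _ IH) phi_op_zero. Qed.

Lemma PhiV_fold (s : seq 'I_n) (m m' : 'I_n -> nat) lam k i :
  PhiV eta [seq (Lambda a, m a) | a <- s] lam k i [seq m' a | a <- s] =
  phi_fold s m m' lam (bas R k) i.
Proof.
elim: s i => [|a s IH] i //=.
rewrite /lwt big_map; apply: eq_bigr => k' _; by rewrite IH.
Qed.

Lemma phi_fold_support s m m' lam k i :
  (i + \sum_(a <- s) m' a)%N <> (k + \sum_(a <- s) m a)%N ->
  phi_fold s m m' lam (bas R k) i = 0.
Proof.
elim: s i => [|a s IH] i /=.
  by rewrite !big_nil !addn0 /bas; case: eqP.
rewrite !big_cons => h; rewrite /phi_op big1// => k' _.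
have [e|ne] := eqVneq (k' + \sum_(b <- s) m' b)%N (k + \sum_(b <- s) m b)%N.
  by rewrite Phi_support ?mulr0//; lia.
by rewrite IH ?mul0r//; apply/eqP.
Qed.

Definition upd (m : 'I_n -> nat) (a b : 'I_n) (p q : nat) : 'I_n -> nat :=
  fun i => if i == a then p else if i == b then q else m i.

Lemma upd_a m a b p q : upd m a b p q a = p.
Proof. by rewrite /upd eqxx. Qed.

Lemma upd_b m a b p q : a != b -> upd m a b p q b = q.
Proof. by move=> h; rewrite /upd eq_sym (negbTE h) eqxx. Qed.

Lemma upd_out m a b p q i : i != a -> i != b -> upd m a b p q i = m i.
Proof. by rewrite /upd => /negbTE -> /negbTE ->. Qed.

Variable RR : C -> C -> C -> nat -> nat -> nat -> nat -> C.
Local Notation exch a b m lam := (exchange (fun p => RR (Lambda a) (Lambda b) lam p (m a + m b - p) (m a) (m b))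
   (Lambda a) (Lambda b) (m a) (m b) lam).

(** The exchange relation inside a composite. It applies since the factors to
    the left of the exchanged pair only see the total weight of the pair, which
    the dynamical R-matrix conserves. *)
Lemma phi_fold_swap s1 s2 a b (m m' : 'I_n -> nat) lam f i :
  uniq (s1 ++ a :: b :: s2) ->
  exch a b m (lam - lwt m s2) ->
  \sum_(p < (m a + m b).+1) RR (Lambda a) (Lambda b) (lam - lwt m s2) p (m a + m b - p) (m a) (m b) *
     phi_fold (s1 ++ b :: a :: s2) (upd m a b p (m a + m b - p)) m' lam f i =
  \sum_(s < (m' a).+1) rcoef (Lambda a) (Lambda b) (m' a) (m' b) s *
     phi_fold (s1 ++ a :: b :: s2) m (upd m' a b (m' a - s) (m' b + s)) lam f i.
Proof.
rewrite cat_uniq /= !inE !negb_or => /and3P[_ /and3P[as1 bs1 hs1] /and3P[/andP[ab as2] bs2 _]] ex.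
have o1 c : c \in s1 -> (c != a) && (c != b).
  by move=> hc; apply/andP; split; apply: contraTN hc => /eqP ->.
have o2 c : c \in s2 -> (c != a) && (c != b).
  by move=> hc; apply/andP; split; apply: contraTN hc => /eqP ->.
pose g := phi_fold s2 m m' lam f.
pose lam' := lam - lwt m s2; pose W := lwt m (a :: b :: s2).
transitivity (phi_fold s1 m m' (lam - W) (fun k => \sum_(p < (m a + m b).+1)
   RR (Lambda a) (Lambda b) lam' p (m a + m b - p) (m a) (m b) *
   phi_op (m a + m b - p) (Lambda b) (lam' - (Lambda a - 2 * p%:R)) (m' b)
     (phi_op p (Lambda a) lam' (m' a) g) k) i).
  rewrite (@phi_fold_linear _ _ (fun p : 'I_(m a + m b).+1 => RR (Lambda a) (Lambda b) lam' p (m a + m b - p) (m a) (m b))).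
  apply: eq_bigr => p _; congr (_ * _); rewrite phi_fold_cat.
  have hp : (p <= m a + m b)%N by rewrite -ltnS.
  have l2 : lwt (upd m a b p (m a + m b - p)) s2 = lwt m s2.
    by apply: eq_big_seq => c /o2/andP[ca cb]; rewrite upd_out.
  have -> : lam - lwt (upd m a b p (m a + m b - p)) (b :: a :: s2) = lam - W.
    by rewrite /W !lwt_cons l2 upd_a upd_b// natrB// natrD; ring.
  apply: eq_phi_fold => // [c /o1/andP[ca cb]|k]; first by rewrite upd_out.
  rewrite /= upd_a upd_b// !lwt_cons l2 upd_a.
  rewrite -/lam' (_ : lam - _ = lam' - (Lambda a - 2 * p%:R)); last by rewrite /lam'; ring.
  apply: eq_phi_op => k'; apply: eq_phi_op => k''; apply: eq_phi_fold => // c /o2/andP[ca cb].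
  by rewrite upd_out.
transitivity (phi_fold s1 m m' (lam - W) (fun k => \sum_(s < (m' a).+1) rcoef (Lambda a) (Lambda b) (m' a) (m' b) s *
    phi_op (m a) (Lambda a) (lam' - (Lambda b - 2 * (m b)%:R)) (m' a - s) (phi_op (m b) (Lambda b) lam' (m' b + s) g) k) i).
  by apply: eq_phi_fold => // k; exact: ex.
rewrite (@phi_fold_linear _ _ (fun s : 'I_(m' a).+1 => rcoef (Lambda a) (Lambda b) (m' a) (m' b) s)).
apply: eq_bigr => s _; congr (_ * _); rewrite phi_fold_cat -/W.
apply: eq_phi_fold => // [c /o1/andP[ca cb]|k]; first by rewrite upd_out.
rewrite /= upd_a upd_b// !lwt_cons.
rewrite (_ : lam - (_ + _) = lam' - (Lambda b - 2 * (m b)%:R)); last by rewrite /lam'; ring.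
apply: eq_phi_op => k'; apply: eq_phi_op => k''; apply: eq_phi_fold => // c /o2/andP[ca cb].
by rewrite upd_out.
Qed.

(** The composite in the order [s] as a matrix indexed by the indices of the
    intertwiners (rows) and of their values (columns). R-matrices of the two
    kinds act on it from the two sides. *)
Definition Wmx (s : seq 'I_n) (lam : C) (f : nat -> C) (i : nat) : 'M[C]_#|Z| :=
  \matrix_(r, c) phi_fold s (mpart (enum_val r)) (mpart (enum_val c)) lam f i.

Lemma sum_mindex (F : Z -> C) : \sum_(k < #|Z|) F (enum_val k) = \sum_m F m.
Proof. by rewrite [RHS](big_enum_val _). Qed.

Lemma sum_mindex_cond (P : pred Z) (F : Z -> C) : \sum_(m | P m) F m =
  \sum_(k < #|Z|) (if P (enum_val k) then F (enum_val k) else 0).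
Proof. by rewrite big_mkcond -(sum_mindex (fun m => if P m then F m else 0)). Qed.

Lemma mpart_sum (m : Z) : (\sum_i mpart m i = M)%N.
Proof. by have /eqP := valP m. Qed.

(** The default value in [insubd] is not met when [a] and [b] differ and [p] is
    at most the sum of the two entries, see [zupdE]. *)
Definition zupd (m : Z) (a b : 'I_n) (p : nat) : Z :=
  insubd m [ffun i => inord (upd (mpart m) a b p (mpart m a + mpart m b - p) i)].

Lemma sum_two (F : 'I_n -> nat) a b : a != b ->
  (\sum_i F i = F a + F b + \sum_(i | (i != a) && (i != b)) F i)%N.
Proof.
move=> ab; rewrite (bigD1 a) //= (bigD1 b) ?addnA//=; last by rewrite eq_sym.
Qed.

Lemma zupdE m a b p : a != b -> (p <= mpart m a + mpart m b)%N ->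
  mpart (zupd m a b p) =1 upd (mpart m) a b p (mpart m a + mpart m b - p).
Proof.
move=> ab hp i.
have tot : (mpart m a + mpart m b <= M)%N by have := mpart_sum m; rewrite (sum_two _ ab) => e; rewrite -[leqRHS]e leq_addr.
have hle c : (upd (mpart m) a b p (mpart m a + mpart m b - p) c < M.+1)%N.
  by rewrite /upd; case: eqP => _; [lia|]; case: eqP => _; [lia|]; exact: ltn_ord.
have hsum : (\sum_c (([ffun i => inord (upd (mpart m) a b p (mpart m a + mpart m b - p) i)] : {ffun 'I_n -> 'I_M.+1}) c : nat) == M)%N.
  apply/eqP; under eq_bigr do rewrite ffunE inordK//.
  rewrite (sum_two _ ab) upd_a upd_b// subnKC// -[RHS](mpart_sum m) [in RHS](sum_two _ ab).
  by congr addn; apply: eq_bigr => c /andP[ca cb]; rewrite upd_out.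
by rewrite /mpart /zupd insubdK ?ffunE ?inordK//.
Qed.

Lemma mpart_inj (m1 m2 : Z) : mpart m1 =1 mpart m2 -> m1 = m2.
Proof. by move=> h; apply: val_inj; apply/ffunP => i; apply: val_inj; exact: h. Qed.

Definition agree (a b : 'I_n) (m m' : Z) : bool :=
  [forall i, (i != a) && (i != b) ==> (mpart m i == mpart m' i)].

Lemma agree_sum a b m m' : a != b -> agree a b m m' ->
  (mpart m a + mpart m b = mpart m' a + mpart m' b)%N.
Proof.
move=> ab /forallP h; have := mpart_sum m; rewrite -[X in _ = X](mpart_sum m') !(sum_two _ ab).
rewrite (eq_bigr (mpart m')) => [/eqP|i hi]; first by rewrite eqn_add2r => /eqP.
by apply/eqP; have := h i; rewrite hi.
Qed.

(** Turns the matrix products with operators acting in two factors into sums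
    over a single index, as they occur in [exchange]. *)
Lemma sum_agree a b (m : Z) (G : Z -> C) : a != b ->
  \sum_(m' | agree a b m' m) G m' = \sum_(p < (mpart m a + mpart m b).+1) G (zupd m a b p).
Proof.
move=> ab.
have hin m' : agree a b m' m -> (mpart m' a <= mpart m a + mpart m b)%N.
  by move=> h; rewrite -(agree_sum ab h) leq_addr.
rewrite (reindex_onto (fun p : 'I_(mpart m a + mpart m b).+1 => zupd m a b p)
   (fun m' => inord (mpart m' a))) /=; last first.
  move=> m' h; apply: mpart_inj => i; rewrite inordK ?ltnS ?hin//.
  rewrite zupdE ?hin// /upd; case: eqP => [->//|/eqP ia]; case: eqP => [->|/eqP ib].
    by rewrite -(agree_sum ab h) addKn.
  by apply/esym/eqP; have /forallP/(_ i) := h; rewrite ia ib.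
apply: eq_bigl => p; have hp : (p <= mpart m a + mpart m b)%N by rewrite -ltnS.
apply/andP; split.
  by apply/forallP => i; apply/implyP => /andP[ia ib]; rewrite zupdE// upd_out.
by apply/eqP; apply: val_inj; rewrite /= zupdE// upd_a inordK.
Qed.

Lemma agree_sym a b m m' : agree a b m m' = agree a b m' m.
Proof. by apply: eq_forallb => i; rewrite [mpart m i == _]eq_sym. Qed.

(** The values of the dynamical variable at which the exchange relation is used
    when [a] and [b] are permuted directly to the left of [s]. *)
Definition exchange_at (a b : 'I_n) (s : seq 'I_n) (lam : C) : Prop :=
  forall m : Z, exch a b (mpart m) (lam - lwt (mpart m) s).

(** The matrix form of [phi_fold_swap]: the sum over the indices of the two
    exchanged factors is a sum over the multi-indices that agree elsewhere. *)
Lemma Wmx_swap s1 s2 a b (P : pred 'I_n) lam f i :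
  uniq (s1 ++ a :: b :: s2) -> P =1 mem s2 -> exchange_at a b s2 lam ->
  dynRop M Lambda RR a b P lam *m Wmx (s1 ++ b :: a :: s2) lam f i =
  Wmx (s1 ++ a :: b :: s2) lam f i *m qRop eta M Lambda a b.
Proof.
move=> hu hP ex.
have [ab us2 as2 bs2] : [/\ a != b, uniq s2, a \notin s2 & b \notin s2].
  by move: hu; rewrite cat_uniq /= !inE !negb_or => /and3P[_ _ /and3P[/andP[-> ->] -> ->]].
have wP m : wtsum Lambda m P = lwt (mpart m) s2.
  by rewrite /wtsum /lwt [RHS]big_uniq//; apply: eq_bigl => c; rewrite hP.
apply/matrixP => r c; rewrite !mxE.
set m := enum_val r; set m' := enum_val c.
transitivity (\sum_(m1 | agree a b m1 m) RR (Lambda a) (Lambda b) (lam - lwt (mpart m) s2)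
    (mpart m1 a) (mpart m1 b) (mpart m a) (mpart m b) *
    phi_fold (s1 ++ b :: a :: s2) (mpart m1) (mpart m') lam f i).
  rewrite [RHS]sum_mindex_cond; apply: eq_bigr => k _; rewrite !mxE -/m -/m' -/(agree a b _ _).
  case: ifP => h; last by rewrite mul0r.
  rewrite wP; congr (RR _ _ (_ - _) _ _ _ _ * _).
  apply: eq_big_seq => d hd; have /forallP/(_ d) := h.
  have -> : (d != a) && (d != b) by apply/andP; split; apply: contraTN hd => /eqP ->.
  by move=> /eqP ->.
rewrite sum_agree//.
transitivity (\sum_(p < (mpart m a + mpart m b).+1) RR (Lambda a) (Lambda b) (lam - lwt (mpart m) s2) p
    (mpart m a + mpart m b - p) (mpart m a) (mpart m b) *
     phi_fold (s1 ++ b :: a :: s2) (upd (mpart m) a b p (mpart m a + mpart m b - p)) (mpart m') lam f i).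
  apply: eq_bigr => p _; have hp : (p <= mpart m a + mpart m b)%N by rewrite -ltnS.
  have hz := zupdE ab hp; rewrite !hz upd_a upd_b//; congr (_ * _).
  by apply: eq_phi_fold.
rewrite phi_fold_swap//.
have hw : ((mpart m' a).+1 <= (mpart m' a + mpart m' b).+1)%N by rewrite ltnS leq_addr.
pose G p := rcoef (Lambda a) (Lambda b) (mpart m' a) (mpart m' b) (mpart m' a - p) *
     phi_fold (s1 ++ a :: b :: s2) (mpart m) (upd (mpart m') a b p (mpart m' a + mpart m' b - p)) lam f i.
transitivity (\sum_(p < (mpart m' a).+1) G p).
  rewrite [RHS](reindex_inj rev_ord_inj) /=; apply: eq_bigr => s _.
  have hs : (s <= mpart m' a)%N by rewrite -ltnS.
  rewrite /G subSS subKn//; congr (_ * _); apply: eq_phi_fold => // d _.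
  by rewrite /upd; case: eqP => // _; case: eqP => // _; lia.
rewrite (big_ord_widen _ G hw).
transitivity (\sum_(m1 | agree a b m1 m')
    phi_fold (s1 ++ a :: b :: s2) (mpart m) (mpart m1) lam f i *
    qRmatrix eta (Lambda a) (Lambda b) (mpart m' a) (mpart m' b) (mpart m1 a) (mpart m1 b)); last first.
  rewrite sum_mindex_cond; apply: eq_bigr => k _; rewrite !mxE -/m -/m' -/(agree a b _ _) agree_sym.
  by case: ifP => // _; rewrite mulr0.
rewrite sum_agree// big_mkcond; apply: eq_bigr => p _ /=.
have hp : (p <= mpart m' a + mpart m' b)%N by rewrite -ltnS.
have hz := zupdE ab hp; rewrite !hz upd_a upd_b// (qRmatrixE heta) ltnS.
case: leqP => hpa; last by rewrite mulr0.
have -> : (mpart m' a + mpart m' b - p == mpart m' b + (mpart m' a - p))%N by apply/eqP; lia.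
rewrite /= mulrC /G; congr (_ * _); exact: eq_phi_fold.
Qed.
End Composites.

(** * Invertibility of the R-matrices *)

Section Invertibility.
Variables (R : realType) (eta : R[i]).
Hypothesis heta : 0 < complex.Im eta.
Local Notation C := R[i].
Local Notation br := (br eta).
Local Notation brn := (brn eta).

Local Notation rcoef := (rcoef eta).
Variables (n M : nat) (Lambda : 'I_n -> C).
Local Notation Z := (mindex n M).
Variable RR : C -> C -> C -> nat -> nat -> nat -> nat -> C.
Local Notation phi_fold := (phi_fold eta Lambda).
Local Notation lwt := (lwt Lambda).
Local Notation exchange_at := (exchange_at eta M Lambda RR).
Local Notation Wmx := (Wmx eta M Lambda).

(** A grading [mu] of the index set replaces a total order of the basis. *)
Lemma triangular_unit (N : nat) (A : 'M[C]_N) (mu : 'I_N -> nat) :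
  (forall i, A i i != 0) -> (forall i j, A i j != 0 -> i != j -> (mu j < mu i)%N) ->
  A \in unitmx.
Proof.
move=> hd ht; rewrite -unitmx_tr -row_free_unit; apply: inj_row_free => v hv.
suff H k : forall i, (mu i < k)%N -> v 0 i = 0.
  by apply/rowP => i; rewrite mxE (H (mu i).+1).
elim: k => [//|k IH] i; rewrite ltnS => hi.
have := congr1 (fun w : 'rV_N => w 0 i) hv; rewrite !mxE (bigD1 i) //= !mxE big1 ?addr0.
  by move=> /eqP; rewrite mulf_eq0 (negbTE (hd i)) orbF => /eqP.
move=> j ji; rewrite mxE; have [->|h] := eqVneq (A i j) 0; first by rewrite mulr0.
rewrite IH ?mul0r//; apply: leq_trans hi; apply: ht => //; by rewrite eq_sym.
Qed.

Lemma rcoef00 L1 L2 j1 j2 : rcoef L1 L2 j1 j2 0 != 0.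
Proof. by rewrite rcoef0 qp_neq0. Qed.

(** The quantum R-matrix only moves units from the factor [a] to the factor [b]. *)
Lemma qRop_unit a b : a != b -> qRop eta M Lambda a b \in unitmx.
Proof.
move=> ab; apply: (triangular_unit (mu := fun i => (M - mpart (enum_val i) a)%N)) => [i|i j].
  rewrite !mxE -/(agree a b _ _) /agree.
  have -> : [forall k, (k != a) && (k != b) ==> (mpart (enum_val i) k == mpart (enum_val i) k)].
    by apply/forallP => k; rewrite eqxx implybT.
  by rewrite (qRmatrixE heta) leqnn subnn addn0 eqxx rcoef00.
rewrite !mxE -/(agree a b _ _); case: ifP => [ag|_]; last by rewrite eqxx.
rewrite (qRmatrixE heta); case: ifP => [/andP[h1 /eqP h2] _ ij|_]; last by rewrite eqxx.
have hM (m : Z) : (mpart m a <= M)%N by rewrite -ltnS; exact: ltn_ord.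
have h3 := hM (enum_val i); have h4 := hM (enum_val j).
suff h5 : mpart (enum_val i) a <> mpart (enum_val j) a by lia.
move=> e; move/eqP: ij; apply; apply: enum_val_inj; apply: mpart_inj => c.
have [->//|ca] := eqVneq c a; have [->|cb] := eqVneq c b.
  by rewrite h2 e subnn addn0.
by apply/esym/eqP; have /forallP/(_ c) := ag; rewrite ca cb.
Qed.

(** The sum of all partial sums over the tails of [s]; it grades multi-indices
    in such a way that composites of intertwiners are triangular. *)
Fixpoint sufsum (s : seq 'I_n) (m : 'I_n -> nat) : nat :=
  if s is a :: s' then (\sum_(b <- s) m b + sufsum s' m)%N else 0%N.

(** At every stage of the composite the degree in the Verma module is
    nonnegative, so the tail sums of [m'] do not exceed those of [m]. *)
Lemma phi_fold_triangular s m m' lam i : phi_fold s m m' lam (bas R 0) i != 0 ->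
  (sufsum s m' <= sufsum s m)%N /\ (sufsum s m' = sufsum s m -> {in s, m' =1 m}).
Proof.
elim: s i => [|a s IH] i // h.
have hs : (i + \sum_(b <- a :: s) m' b = \sum_(b <- a :: s) m b)%N.
  by apply/eqP; apply: contraTT h => ne; rewrite phi_fold_support ?eqxx//; apply/eqP.
have [k hk] : exists k, phi_fold s m m' lam (bas R 0) k != 0.
  apply: contrapT => hno; move/eqP: h; apply; rewrite /= /phi_op big1// => k _.
  have [->|hk] := eqVneq (phi_fold s m m' lam (bas R 0) k) 0; first by rewrite mul0r.
  by case: hno; exists k.
have [h1 h2] := IH k hk; rewrite /=; split; first by lia.
move=> e; have e1 : sufsum s m' = sufsum s m by lia.
have e2 : (\sum_(b <- a :: s) m' b = \sum_(b <- a :: s) m b)%N by lia.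
have hin := h2 e1; move=> b; rewrite inE => /orP[/eqP ->|]; last exact: hin.
move: e2; rewrite !big_cons (eq_big_seq _ hin) => /eqP; by rewrite eqn_add2r => /eqP.
Qed.

Lemma brn_generic c k : generically (fun lam : C => brn (c - lam) k != 0).
Proof.
have g (i : 'I_k) : generically (fun lam => br (c - lam + i%:R) != 0).
  apply: (laurent_generic heta (z1 := c + i%:R - 1)).
    by apply: laurent_br; apply: aff_add (aff_const _); apply: aff_sub; [exact: aff_const|exact: aff_id].
  rewrite (_ : _ + _ = 1) ?br1//; last by ring.
  by apply/eqP; exact: oner_neq0.
apply: generically_imp (generically_forall g) => lam h.
by apply/prodf_neq0 => i _; exact: h.
Qed.

(** On the diagonal all stages have degree 0, and the coefficient is a product
    of quantum Pochhammer symbols. *)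
Lemma phi_fold_diag s m : generically (fun lam => phi_fold s m m lam (bas R 0) 0%N != 0).
Proof.
elim: s => [|a s IH] /=.
  by apply: generically_const; rewrite /bas eqxx oner_neq0.
have g2 : generically (fun lam => brn (- (lam - lwt m s) + Lambda a - 2 * (m a)%:R + 0%:R + 1) (m a) != 0).
  apply: generically_imp (brn_generic (lwt m s + Lambda a - 2 * (m a)%:R + 1) (m a)) => lam.
  by congr (brn _ _ != 0); rewrite mulr0n; ring.
apply: generically_imp (generically_and g2 IH) => lam [h1 h2].
rewrite /phi_op big_ord_recl big1 ?addr0.
  rewrite Phi0_hw add0n eqxx mul0r qp0 mul1r brn0 mulr1.
  by rewrite mulf_neq0.
move=> k _; rewrite phi_fold_support ?mul0r//= /bump; lia.
Qed.

Lemma Wmx_unit s : (forall c, c \in s) ->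
  generically (fun lam => Wmx s lam (bas R 0) 0%N \in unitmx).
Proof.
move=> hs.
have g := generically_forall (fun m : Z => phi_fold_diag s (mpart m)).
apply: generically_imp g => lam h.
apply: (triangular_unit (mu := fun i => sufsum s (mpart (enum_val i)))) => [i|i j].
  by rewrite mxE.
rewrite mxE => hij ij; have [h1 h2] := phi_fold_triangular hij.
rewrite ltn_neqAle h1 andbT; apply: contra ij => /eqP e; apply/eqP; apply: enum_val_inj.
by apply: mpart_inj => c; rewrite h2.
Qed.

Lemma exchange_at_generic a b s : is_dynR eta RR -> generically (exchange_at a b s).
Proof.
move=> hRR; apply: generically_forall => m.
exact: (generically_shift (lwt (mpart m) s) (gexchange_all heta hRR (Lambda a) (Lambda b) (mpart m a) (mpart m b))).
Qed.

(** In [Wmx_swap], for the coefficients on the highest weight vector, all the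
    other matrices are generically invertible. *)
Lemma dynRop_unit s1 a b s2 (P : pred 'I_n) : is_dynR eta RR ->
  uniq (s1 ++ a :: b :: s2) -> (forall c, c \in s1 ++ a :: b :: s2) -> P =1 mem s2 ->
  generically (fun lam => dynRop M Lambda RR a b P lam \in unitmx).
Proof.
move=> hRR hu hin hP.
have hin' c : c \in s1 ++ b :: a :: s2.
  by have := hin c; rewrite !mem_cat !inE => h; rewrite [(c == b) || _]orbCA h.
have ab : a != b by move: hu; rewrite cat_uniq /= !inE !negb_or => /and3P[_ _ /and3P[/andP[-> _] _ _]].
have g := generically_and (exchange_at_generic a b s2 hRR) (generically_and (Wmx_unit hin) (Wmx_unit hin')).
apply: generically_imp g => lam [ex [u1 u2]].
have e := Wmx_swap heta (bas R 0) 0 hu hP ex.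
have : dynRop M Lambda RR a b P lam *m Wmx (s1 ++ b :: a :: s2) lam (bas R 0) 0 \in unitmx.
  by rewrite e unitmx_mul u1 qRop_unit.
by rewrite unitmx_mul => /andP[].
Qed.
End Invertibility.

(** * Moving a factor to either end, and cyclicity of the trace *)

Section Cyclicity.
Variables (R : realType) (eta : R[i]).
Hypothesis heta : 0 < complex.Im eta.
Local Notation C := R[i].
Local Notation Phi := (Phi eta).

Local Notation phi_op := (phi_op eta).
Variables (n M : nat) (Lambda : 'I_n -> C).
Local Notation Z := (mindex n M).
Variable RR : C -> C -> C -> nat -> nat -> nat -> nat -> C.
Local Notation phi_fold := (phi_fold eta Lambda).
Local Notation lwt := (lwt Lambda).
Local Notation exchange_at := (exchange_at eta M Lambda RR).
Local Notation Wmx := (Wmx eta M Lambda).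
Local Notation dyn := (dynRop M Lambda RR).
Local Notation qR := (qRop eta M Lambda).

(** Repeated use of [Wmx_swap]. A tail [w] of [s1] followed by [t] is what
    stands to the right of the pair at the moment of the exchange. *)
Lemma Wmx_move_left j (P : 'I_n -> pred 'I_n) lam f i s0 s1 t :
  uniq (s0 ++ s1 ++ j :: t) ->
  (forall u k w, s1 = u ++ k :: w -> P k =1 mem (w ++ t) /\ exchange_at j k (w ++ t) lam) ->
  (\big[mulmx/1%:M]_(k <- s1) dyn j k (P k) lam) *m Wmx (s0 ++ s1 ++ j :: t) lam f i =
  Wmx (s0 ++ j :: s1 ++ t) lam f i *m \big[mulmx/1%:M]_(k <- s1) qR j k.
Proof.
elim: s1 s0 => [|k s1 IH] s0 hu hs; first by rewrite !big_nil mul1mx mulmx1.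
have [hP ex] := hs [::] k s1 erefl.
rewrite !big_cons -mulmxA cat_cons -(cat_rcons k s0) IH; first last.
- by move=> u k' w e; apply: (hs (k :: u)); rewrite e.
- by rewrite cat_rcons.
rewrite mulmxA cat_rcons (Wmx_swap heta) ?mulmxA//.
have e : perm_eq (s0 ++ (k :: s1) ++ j :: t) (s0 ++ [:: j, k & s1 ++ t]).
  by rewrite perm_cat2l -[X in perm_eq _ X]/([:: j] ++ (k :: s1) ++ t) perm_sym perm_catCA.
by rewrite -(perm_uniq e).
Qed.

(** The inverse exchanges; the factor [j] starts at the right end here and is
    compared with its position before [s1]. *)
Lemma Wmx_move_right j (P : 'I_n -> pred 'I_n) lam f i s0 s1 :
  uniq (s0 ++ s1 ++ [:: j]) ->
  (forall u k w, s1 = u ++ k :: w ->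
     [/\ P k =1 mem w, exchange_at k j w lam & dyn k j (P k) lam \in unitmx]) ->
  (\big[mulmx/1%:M]_(k <- s1) invmx (dyn k j (P k) lam)) *m Wmx (s0 ++ s1 ++ [:: j]) lam f i =
  Wmx (s0 ++ j :: s1) lam f i *m \big[mulmx/1%:M]_(k <- s1) invmx (qR k j).
Proof.
elim: s1 s0 => [|k s1 IH] s0 hu hs; first by rewrite !big_nil mul1mx mulmx1.
have [hP ex un] := hs [::] k s1 erefl.
rewrite !big_cons -mulmxA cat_cons -(cat_rcons k s0) IH; first last.
- by move=> u k' w e; apply: (hs (k :: u)); rewrite e.
- by rewrite cat_rcons.
rewrite mulmxA cat_rcons mulmxA; congr (_ *m _).
have hu' : uniq (s0 ++ [:: k, j & s1]).
  have e : perm_eq (s0 ++ (k :: s1) ++ [:: j]) (s0 ++ [:: k, j & s1]).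
    by rewrite perm_cat2l /= perm_cons cats1 perm_rcons.
  by rewrite -(perm_uniq e).
have kj : k != j by move: hu'; rewrite cat_uniq /= !inE !negb_or => /and3P[_ _ /and3P[/andP[-> _] _ _]].
have := Wmx_swap heta f i hu' hP ex => /(congr1 (fun X => invmx (dyn k j (P k) lam) *m X *m invmx (qR k j))).
by rewrite mulKmx// -[RHS]mulmxA mulmxK ?qRop_unit// => <-.
Qed.

Section Cyclic.
Variables (j : 'I_n) (s : seq 'I_n) (m m' : 'I_n -> nat) (lam : C).
Hypothesis hlwt : lwt m (j :: s) = 0.
Local Notation wtj := (Lambda j - 2 * (m j)%:R).

Let shift_lam : lam - wtj - lwt m s = lam.
Proof. by move: hlwt; rewrite lwt_cons => h; rewrite -addrA -opprD h subr0. Qed.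

Let phi_op_bas k1 i : phi_op (m j) (Lambda j) lam (m' j) (bas R k1) i = Phi (m j) (Lambda j) lam k1 i (m' j).
Proof.
have [e|ne] := eqVneq (i + m' j)%N (k1 + m j)%N; last first.
  rewrite Phi_support; last by apply/eqP.
  rewrite /phi_op big1// => k _; rewrite /bas; case: eqP => [->|_]; last by rewrite mul0r.
  by rewrite Phi_support ?mulr0//; apply/eqP.
have hk : (k1 < (i + m' j).+1)%N by rewrite e ltnS leq_addr.
rewrite /phi_op (bigD1 (Ordinal hk)) //= big1 ?addr0 => [|k hne].
  by rewrite /bas eqxx mul1r.
rewrite /bas (_ : (k == k1 :> nat) = false) ?mul0r//.
by apply: contraNF hne => /eqP h; apply/eqP; apply: val_inj.
Qed.

(** On both sides the composite splits into the coefficient of the factor [j]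
    between the degrees [k1] and [k] and the coefficient of the remaining
    factors between [k] and [k1]; by conservation of degree no other
    intermediate degree contributes. The total weight is 0, so that lambda
    returns to its value after going around. *)
Lemma cyclic_term k k1 : (k + m' j = k1 + m j)%N ->
  phi_fold (j :: s) m m' (lam - wtj) (bas R k) k = phi_fold (rcons s j) m m' lam (bas R k1) k1.
Proof.
move=> e; rewrite -cats1 phi_fold_cat /= shift_lam.
have hk : (k1 < (k + m' j).+1)%N by rewrite e ltnS leq_addr.
rewrite {1}/phi_op (bigD1 (Ordinal hk)) //= big1 ?addr0; last first.
  move=> k' hne; rewrite Phi_support ?mulr0// => h; move/eqP: hne; apply; apply: val_inj => /=; lia.
have -> : lwt m [:: j] = wtj by rewrite lwt_cons /lwt big_nil addr0.
have -> : phi_fold s m m' (lam - wtj) (phi_op (m j) (Lambda j) (lam - lwt m [::]) (m' j) (bas R k1)) k1 =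
  phi_fold s m m' (lam - wtj) (fun i => Phi (m j) (Lambda j) lam k1 k (m' j) * bas R k i) k1.
  apply: eq_phi_fold => // i; rewrite {1}/lwt big_nil subr0 phi_op_bas /bas.
  case: eqP => [->|ne]; first by rewrite mulr1.
  by rewrite mulr0 Phi_support//; lia.
by rewrite phi_fold_scale mulrC.
Qed.

(** The terms of either trace without a partner in the other one vanish, because
    the intermediate degree would be negative. *)
Lemma cyclic_zero_left k : (k + m' j < m j)%N -> phi_fold (j :: s) m m' (lam - wtj) (bas R k) k = 0.
Proof.
move=> h; rewrite /= /phi_op big1// => k' _; rewrite Phi_support ?mulr0//; lia.
Qed.

Lemma cyclic_zero_right k1 : (k1 + m j < m' j)%N -> phi_fold (rcons s j) m m' lam (bas R k1) k1 = 0.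
Proof.
move=> h; rewrite -cats1 phi_fold_cat /=.
transitivity (phi_fold s m m' (lam - lwt m [:: j]) (fun=> 0) k1); last exact: phi_fold_zero.
apply: eq_phi_fold => // i; rewrite {1}/lwt big_nil subr0 phi_op_bas Phi_support//; lia.
Qed.

End Cyclic.

End Cyclicity.

(** * Analytic continuation in x *)

Section Continuity.
Variable K : numFieldType.
Definition cont_at (f : K -> K) (x0 : K) : Prop := (f @ x0 --> f x0)%classic.
Lemma cont_atP f x0 : cont_at f x0 <->
  forall e : K, 0 < e -> ball_near x0 (fun x => `|f x0 - f x| < e).
Proof.
have H := @cvgrPdist_lt K K _ (nbhs x0) (nbhs_filter x0) f (f x0).
by split=> h; [apply: (H.1 h)|apply: H.2].
Qed.
Lemma cont_add f g x0 : cont_at f x0 -> cont_at g x0 -> cont_at (fun x => f x + g x) x0.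
Proof. move=> hf hg; exact: (cvgD hf hg). Qed.
Lemma cont_mul f g x0 : cont_at f x0 -> cont_at g x0 -> cont_at (fun x => f x * g x) x0.
Proof. move=> hf hg; exact: (cvgM hf hg). Qed.
Lemma cont_const c x0 : cont_at (fun=> c) x0.
Proof.
apply/cont_atP => e e0; apply/near_ballP; exists 1 => // x _.
by rewrite subrr normr0.
Qed.
End Continuity.

Section Continuation.
Variables (R : realType) (eta : R[i]).
Hypothesis heta : 0 < complex.Im eta.
Local Notation C := R[i].
Local Notation qp := (qp eta).

Lemma cont_atR (f : C -> C) x0 : cont_at f x0 <->
  forall e : R, 0 < e -> exists2 d : R, 0 < d & forall x, nm (x - x0) < d -> nm (f x - f x0) < e.
Proof.
split.
  move=> /cont_atP h e e0; have e0' : 0 < e%:C by rewrite ltcR.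
  have /near_ballR[d d0 hd] := h _ e0'; exists d => // x hx.
  by have := hd x hx; rewrite nmE ltcR nmBC.
move=> h; apply/cont_atP => e e0; have eE := RRe_real (gtr0_real e0).
have e0' : 0 < complex.Re e by rewrite -ltcR eE.
have [d d0 hd] := h _ e0'; apply/near_ballR; exists d => // x hx.
by rewrite -eE nmE ltcR nmBC; exact: hd.
Qed.

Lemma cont_qp a b x0 : cont_at (fun x => qp (a + b * x)) x0.
Proof.
apply/cont_atR => e e0; pose B := nm (qp (a + b * x0)).
have B0 : 0 < B by rewrite nm_gt0// qp_neq0.
have eB : 0 < e / B by rewrite divr_gt0.
have [d d0 hd] := cexp_continuous0 (pi%:C * 'i * eta * b) eB.
exists d => // x hx.
have -> : qp (a + b * x) - qp (a + b * x0) = qp (a + b * x0) * (cexp (pi%:C * 'i * eta * b * (x - x0)) - 1).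
  rewrite mulrBr mulr1; congr (_ - _).
  have -> : a + b * x = (a + b * x0) + b * (x - x0) by ring.
  by rewrite qpD; congr (_ * _); rewrite /Defs.qp -!mulrA.
by rewrite nmM -/B mulrC -ltr_pdivlMr//; exact: hd.
Qed.

(** Continuity at [x] fixes the value there, which meromorphy leaves open; both
    properties together are stable under the operations used below. *)
Definition tame (x : C) (f : C -> C) : Prop := (forall x0, meromorphic_at f x0) /\ cont_at f x.

Lemma tame_const x c : tame x (fun=> c).
Proof. by split=> [x0|]; [exact: meromorphic_const|exact: cont_const]. Qed.

Lemma tame_add x f g : tame x f -> tame x g -> tame x (fun y => f y + g y).
Proof.
move=> [hf cf] [hg cg]; split=> [x0|]; first exact: (meromorphic_add (hf x0) (hg x0)).
exact: cont_add.
Qed.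

Lemma tame_mul x f g : tame x f -> tame x g -> tame x (fun y => f y * g y).
Proof.
move=> [hf cf] [hg cg]; split=> [x0|]; first exact: (meromorphic_mul (hf x0) (hg x0)).
exact: cont_mul.
Qed.

Lemma tame_ext x f g : (forall y, f y = g y) -> tame x f -> tame x g.
Proof. by move=> /funext ->. Qed.

Lemma tame_sum x (I : Type) (r : seq I) (f : I -> C -> C) : (forall i, tame x (f i)) ->
  tame x (fun y => \sum_(i <- r) f i y).
Proof.
move=> h; elim: r => [|i r IH].
  by apply: tame_ext (tame_const x 0) => y; rewrite big_nil.
by apply: tame_ext (tame_add (h i) IH) => y; rewrite big_cons.
Qed.

Lemma tame_qp x a b : tame x (fun y => qp (a + b * y)).
Proof. by split=> [x0|]; [exact: meromorphic_qp|exact: cont_qp]. Qed.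

Definition tame_mx x p q (A : C -> 'M[C]_(p, q)) : Prop := forall i j, tame x (fun y => A y i j).

Lemma tame_mx_const x p q (A : 'M[C]_(p, q)) : tame_mx x (fun=> A).
Proof. by move=> i j; exact: tame_const. Qed.

Lemma tame_mx_mul x p q r (A : C -> 'M[C]_(p, q)) (B : C -> 'M[C]_(q, r)) :
  tame_mx x A -> tame_mx x B -> tame_mx x (fun y => A y *m B y).
Proof.
move=> hA hB i j; apply: (tame_ext (f := fun y => \sum_k A y i k * B y k j)).
  by move=> y; rewrite mxE.
by apply: tame_sum => k; apply: tame_mul; [exact: hA|exact: hB].
Qed.

(** The difference vanishes on a punctured neighbourhood of [x] by
    [meromorphic_vanish], hence at [x] by continuity. *)
Lemma tame_identity x f g : tame x f -> tame x g ->
  (exists r : R, forall y, r%:C < `|qp (2 * y)| -> f y = g y) -> f x = g x.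
Proof.
move=> tf tg [r hr].
have [mh ch] := tame_add tf (tame_mul (tame_const x (- 1)) tg).
set h := fun y => _ in mh ch.
have hz : punctured x (fun y => h y = 0).
  apply: (meromorphic_vanish heta mh); exists r => y /hr e.
  by rewrite /h e mulN1r subrr.
suff hx0 : h x = 0 by apply/eqP; rewrite -subr_eq0 -hx0 /h mulN1r.
apply/eqP; rewrite -nm_eq0; apply/eqP; apply/eqP; rewrite eq_le nm_ge0 andbT leNgt; apply/negP => hpos.
move/cont_atR : ch => /(_ _ hpos)[d d0 hd].
have [y _ [h1 h2]] := punctured_ex (punctured_and hz (punctured_small x d0)).
by have := hd y h2; rewrite h1 sub0r nmN ltxx.
Qed.

Lemma has_sum_fin (I : Type) (r : seq I) (u : I -> nat -> C) (T : I -> C) :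
  (forall i, has_sum (u i) (T i)) -> has_sum (fun k => \sum_(i <- r) u i k) (\sum_(i <- r) T i).
Proof.
move=> h; elim: r => [|i r IH].
  rewrite big_nil; apply/has_sumR => e e0; exists 0%N => n _.
  by rewrite big1 ?subrr ?nm0// => k _; rewrite big_nil.
rewrite big_cons; have := has_sum_add (h i) IH.
have -> : (fun k => u i k + \sum_(i <- r) u i k) = (fun k => \sum_(i <- i :: r) u i k).
  by apply/funext => k; rewrite big_cons.
exact.
Qed.

Lemma has_sum_mulmx p q r s (A : 'M[C]_(p, q)) (X : nat -> 'M[C]_(q, r)) (T : 'M[C]_(q, r)) (B : 'M[C]_(r, s)) :
  (forall i j, has_sum (fun k => X k i j) (T i j)) ->
  forall i j, has_sum (fun k => (A *m X k *m B) i j) ((A *m T *m B) i j).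
Proof.
move=> h i j.
have e (Y : 'M[C]_(q, r)) : (A *m Y *m B) i j = \sum_b \sum_a (B b j * A i a) * Y a b.
  rewrite mxE; apply: eq_bigr => b _; rewrite mxE big_distrl; apply: eq_bigr => a _ /=; ring.
rewrite e; have -> : (fun k => (A *m X k *m B) i j) = (fun k => \sum_b \sum_a (B b j * A i a) * X k a b).
  by apply/funext => k; rewrite e.
apply: (has_sum_fin (u := fun b k => \sum_a (B b j * A i a) * X k a b)) => b.
apply: (has_sum_fin (u := fun a k => (B b j * A i a) * X k a b)) => a.
exact: has_sum_scale (h a b).
Qed.
End Continuation.

(** * The factors before and after a given one *)

Section Neighbours.
Variables (n : nat) (j : 'I_n).
Definition before : seq 'I_n := enum [pred k : 'I_n | (k < j)%N].
Definition after : seq 'I_n := enum [pred k : 'I_n | (j < k)%N].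

Lemma pairwise_enum : pairwise (fun a b : 'I_n => (a < b)%N) (enum 'I_n).
Proof.
rewrite -(pairwise_map val ltn) val_enum_ord; rewrite -sorted_pairwise; last exact: ltn_trans.
exact: iota_ltn_sorted.
Qed.

Lemma pairwise_tail (u w : seq 'I_n) k i : pairwise (fun a b : 'I_n => (a < b)%N) (u ++ k :: w) ->
  i \in u ++ k :: w -> (k < i)%N = (i \in w).
Proof.
rewrite pairwise_cat pairwise_cons => /and3P[/allrelP h1 _ /andP[/allP h2 _]].
have hw : i \in w -> (k < i)%N by move=> /h2.
have hu : i \in u -> (i < k)%N by move=> hi; apply: h1 => //; exact: mem_head.
rewrite mem_cat inE => /or3P[hi|/eqP ->|hi]; last by rewrite hi hw.
  by apply/idP/idP => [ki|/hw//]; have := ltn_trans ki (hu hi); rewrite ltnn.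
by rewrite ltnn; apply/esym/negP => /h2; rewrite ltnn.
Qed.

Lemma enum_split : enum 'I_n = before ++ j :: after.
Proof.
have eP (P : pred 'I_n) : enum P = [seq x <- enum 'I_n | P x] by rewrite enumT.
rewrite /before /after (eP [pred k : 'I_n | (k < j)%N]) (eP [pred k : 'I_n | (j < k)%N]).
have := pairwise_enum; have : j \in enum 'I_n by rewrite mem_enum.
case/splitPr => p1 p2; rewrite pairwise_cat pairwise_cons => /and3P[/allrelP h1 _ /andP[/allP h2 _]].
rewrite !filter_cat /= !ltnn.
have e1 : [seq x : 'I_n <- p1 | (x < j)%N] = p1.
  by apply/all_filterP/allP => x hx; apply: h1 => //; exact: mem_head.
have e2 : [seq x : 'I_n <- p2 | (x < j)%N] = [::].
  by apply/eqP; rewrite -(negbK (_ == _)) -has_filter; apply/hasPn => x /h2 hx; rewrite -leqNgt ltnW.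
have e3 : [seq x : 'I_n <- p1 | (j < x)%N] = [::].
  apply/eqP; rewrite -(negbK (_ == _)) -has_filter; apply/hasPn => x hx; rewrite -leqNgt ltnW//.
  by apply: h1 => //; exact: mem_head.
have e4 : [seq x : 'I_n <- p2 | (j < x)%N] = p2.
  by apply/all_filterP/allP => x /h2.
by rewrite e1 e2 e3 e4 cats0.
Qed.

Lemma mem_split c : c \in before ++ j :: after.
Proof. by rewrite -enum_split mem_enum. Qed.

Lemma uniq_split : uniq (before ++ j :: after).
Proof. by rewrite -enum_split enum_uniq. Qed.

(** The shift of lambda prescribed in the qKZB operator is the one that occurs
    when the factor [j] is exchanged with [k] on its way to the left: the
    factors to the right of the pair are those between [k] and [j] and those
    after [j]. *)
Lemma before_tail u k w : before = u ++ k :: w ->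
  (fun i : 'I_n => ((k < i < j) || (j < i))%N) =1 mem (w ++ after).
Proof.
move=> e i; have hp := pairwise_enum; rewrite enum_split in hp.
have hj := pairwise_tail hp (mem_split i).
have hi := mem_split i.
rewrite e -catA cat_cons in hp hi.
have hk := pairwise_tail hp hi.
have hu := uniq_split; rewrite e -catA cat_cons cat_uniq /= cat_uniq /= in hu.
rewrite !inE mem_cat -hj; case: (ltnP j i) => [_|hij]; first by rewrite !orbT.
rewrite !orbF hk mem_cat inE -hj.
have -> : (j < i)%N = false by rewrite ltnNge hij.
rewrite orbF; case: (ltngtP i j) hij => // [ij|ij] _; last first.
  rewrite andbF (val_inj ij); apply/esym/negbTE.
  by case/and3P: hu => _ _ /andP[_ /and3P[_ /norP[h _] _]].
by rewrite andbT; case: eqP => [e'|]; rewrite ?orbF//; move: ij; rewrite e' ltnn.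
Qed.

Lemma after_tail u k w : after = u ++ k :: w -> (fun i : 'I_n => (k < i)%N) =1 mem w.
Proof.
move=> e i; have hp := pairwise_enum; rewrite enum_split in hp.
have hi := mem_split i.
rewrite e -cat_cons catA in hp hi.
exact: (pairwise_tail hp hi).
Qed.

Lemma big_before (N : nat) (T : nzRingType) (F : 'I_n -> 'M[T]_N) :
  \big[mulmx/1%:M]_(k < n | (k < j)%N) F k = \big[mulmx/1%:M]_(k <- before) F k.
Proof. by rewrite -big_filter [index_enum _]unlock. Qed.

Lemma big_after (N : nat) (T : nzRingType) (F : 'I_n -> 'M[T]_N) :
  \big[mulmx/1%:M]_(k < n | (j < k)%N) F k = \big[mulmx/1%:M]_(k <- after) F k.
Proof. by rewrite -big_filter [index_enum _]unlock. Qed.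
End Neighbours.

(** * The qKZB equation *)

Section Equation.
Variables (R : realType) (eta : R[i]).
Hypothesis heta : 0 < complex.Im eta.
Local Notation C := R[i].
Local Notation qp := (qp eta).

Variables (n M : nat) (Lambda : 'I_n -> C).
Hypothesis hLambda : \sum_i Lambda i = 2 * M%:R.
Local Notation Z := (mindex n M).
Variable RR : C -> C -> C -> nat -> nat -> nat -> nat -> C.
Hypothesis hRR : is_dynR eta RR.
Local Notation phi_fold := (phi_fold eta Lambda).
Local Notation lwt := (lwt Lambda).
Local Notation exchange_at := (exchange_at eta M Lambda RR).
Local Notation Wmx := (Wmx eta M Lambda).
Local Notation dyn := (dynRop M Lambda RR).
Local Notation qR := (qRop eta M Lambda).
Variable j : 'I_n.
Local Notation pre := (before j).
Local Notation suf := (after j).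
Local Notation N := #|Z|.

(* The dynamical ([A1], [A2]) and quantum ([Q1], [Q2]) R-matrices met by the
   factor [j] on its way to the left ([A1], [Q1]) and to the right ([A2], [Q2])
   end. *)
Let A1 (l : C) : 'M[C]_N := \big[mulmx/1%:M]_(k <- pre) dyn j k (fun i : 'I_n => ((k < i < j) || (j < i))%N) l.
Let Q1 : 'M[C]_N := \big[mulmx/1%:M]_(k <- pre) qR j k.
Let A2 (l : C) : 'M[C]_N := \big[mulmx/1%:M]_(k <- suf) invmx (dyn k j (fun i : 'I_n => (k < i)%N) l).
Let Q2 : 'M[C]_N := \big[mulmx/1%:M]_(k <- suf) invmx (qR k j).
Let Emx (y : C) : 'M[C]_N := opmx (fun m m' : Z => (m == m')%:R * qp (- (wt Lambda m j * y))).

Lemma unit_prod (s : seq 'I_n) (B : 'I_n -> 'M[C]_N) : (forall k, k \in s -> B k \in unitmx) ->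
  \big[mulmx/1%:M]_(k <- s) B k \in unitmx.
Proof.
elim: s => [|k s IH] h; first by rewrite big_nil unitmx1.
rewrite big_cons unitmx_mul h ?mem_head//=; apply: IH => k' hk'; apply: h.
by rewrite inE hk' orbT.
Qed.

Let in_pre k : (k \in pre) = (k < j)%N. Proof. by rewrite mem_enum. Qed.
Let in_suf k : (k \in suf) = (j < k)%N. Proof. by rewrite mem_enum. Qed.

Let Q1_unit : Q1 \in unitmx.
Proof.
apply: unit_prod => k; rewrite in_pre => hk; apply: qRop_unit => //.
by apply/eqP => e; move: hk; rewrite e ltnn.
Qed.

Let Q2_unit : Q2 \in unitmx.
Proof.
apply: unit_prod => k; rewrite in_suf unitmx_inv => hk; apply: qRop_unit => //.
by apply/eqP => e; move: hk; rewrite e ltnn.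
Qed.

Definition left_good (l : C) : Prop :=
  forall u k w, pre = u ++ k :: w -> exchange_at j k (w ++ suf) l.
Definition right_good (l : C) : Prop :=
  forall u k w, suf = u ++ k :: w ->
    exchange_at k j w l /\ dyn k j (fun i : 'I_n => (k < i)%N) l \in unitmx.

Lemma cat_nth (s u w : seq 'I_n) k : s = u ++ k :: w ->
  [/\ (size u < size s)%N, nth j s (size u) = k & drop (size u).+1 s = w].
Proof.
move=> ->; split; first by rewrite size_cat /= addnS ltnS leq_addr.
  by rewrite nth_cat ltnn subnn.
by rewrite -cat_rcons drop_size_cat// size_rcons.
Qed.

Lemma left_good_generic : generically left_good.
Proof.
have g : generically (fun l => forall i, (i < size pre)%N -> exchange_at j (nth j pre i) (drop i.+1 pre ++ suf) l).
  by apply: generically_lt => i _; exact: exchange_at_generic.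
apply: generically_imp g => l h u k w /cat_nth[h1 h2 h3].
by have := h _ h1; rewrite h2 h3.
Qed.

Lemma right_good_generic : generically right_good.
Proof.
have g : generically (fun l => forall i, (i < size suf)%N ->
    exchange_at (nth j suf i) j (drop i.+1 suf) l /\
    dyn (nth j suf i) j (fun c : 'I_n => (nth j suf i < c)%N) l \in unitmx).
  apply: generically_lt => i hi; apply: generically_and; first exact: exchange_at_generic.
  have e : suf = take i suf ++ nth j suf i :: drop i.+1 suf by rewrite -drop_nth// cat_take_drop.
  have ep : perm_eq (pre ++ j :: (take i suf ++ nth j suf i :: drop i.+1 suf))
      ((pre ++ take i suf) ++ [:: nth j suf i, j & drop i.+1 suf]).
    by apply/permP => a; rewrite !count_cat /= !count_cat /=; lia.
  rewrite -e in ep.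
  apply: (@dynRop_unit _ _ heta _ _ _ _ (pre ++ take i suf) _ _ (drop i.+1 suf) _ hRR).
  - by rewrite -(perm_uniq ep) uniq_split.
  - by move=> c; rewrite -(perm_mem ep) mem_split.
  - exact: after_tail e.
apply: generically_imp g => l h u k w /cat_nth[h1 h2 h3].
by have := h _ h1; rewrite h2 h3.
Qed.

Let A2_unit lam : right_good lam -> A2 lam \in unitmx.
Proof.
move=> hr; apply: unit_prod => k hk; rewrite unitmx_inv.
have [u [w e]] : exists u w, suf = u ++ k :: w by case/splitPr: hk => u w; exists u, w.
by have [] := hr u k w e.
Qed.

(** Row [r] of the equation. [T] and [T'] are the traces at lambda and at lambda
    shifted by the weight of the index [r]; the shift depends on the row, which
    is why the equation is proved one row at a time. *)
Lemma cyclic_entry lam y (T T' : 'M[C]_N) r :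
  right_good lam -> left_good (lam - wt Lambda (enum_val r) j) ->
  (forall a b, has_sum (fun k => (qp ((lam - 1 - 2 * k%:R) * y) *: Wmx (enum 'I_n) lam (bas R k) k) a b) (T a b)) ->
  (forall a b, has_sum (fun k => (qp ((lam - wt Lambda (enum_val r) j - 1 - 2 * k%:R) * y) *:
      Wmx (enum 'I_n) (lam - wt Lambda (enum_val r) j) (bas R k) k) a b) (T' a b)) ->
  row r (A1 (lam - wt Lambda (enum_val r) j) *m T') =
  row r (invmx (A2 lam) *m T *m (Q2 *m Emx y *m Q1)).
Proof.
set m := enum_val r; set lr := lam - _ => hr hl hT hT'.
have A2u := A2_unit hr.
have hu := uniq_split j.
have eL k : A1 lr *m Wmx (enum 'I_n) lr (bas R k) k *m invmx Q1 = Wmx (j :: pre ++ suf) lr (bas R k) k.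
  rewrite (enum_split j) -[pre ++ _]/([::] ++ pre ++ j :: suf).
  rewrite (Wmx_move_left heta) ?mulmxK//= => u c w e; split; last exact: hl e.
  exact: before_tail e.
have eR k : invmx (A2 lam) *m Wmx (enum 'I_n) lam (bas R k) k *m Q2 = Wmx (pre ++ suf ++ [:: j]) lam (bas R k) k.
  rewrite (enum_split j) -mulmxA -(Wmx_move_right heta (RR := RR) (P := fun k i : 'I_n => (k < i)%N)) ?mulKmx//.
    have e : perm_eq (pre ++ j :: suf) (pre ++ suf ++ [:: j]).
      by rewrite perm_cat2l -cat1s perm_catC.
    by rewrite -(perm_uniq e).
  move=> u c w e; have [h1 h2] := hr u c w e; split=> //; exact: after_tail e.
(* The R-matrices do not depend on the degree, so they can be summed through. *)
have hL := has_sum_mulmx (A := A1 lr) (B := invmx Q1) hT'.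
have hR := has_sum_mulmx (A := invmx (A2 lam)) (B := Q2) hT.
suff E : row r (A1 lr *m T' *m invmx Q1) = row r (invmx (A2 lam) *m T *m Q2 *m Emx y).
  move/(congr1 (fun X => X *m Q1)) : E; rewrite -!row_mul mulmxKV// => ->.
  by rewrite !mulmxA.
apply/rowP => c; rewrite [LHS]mxE [RHS]mxE.
pose m' : Z := enum_val c.
have -> : (invmx (A2 lam) *m T *m Q2 *m Emx y) r c =
    qp (- (wt Lambda m' j * y)) * (invmx (A2 lam) *m T *m Q2) r c.
  have eE a b : Emx y a b = (enum_val b == enum_val a)%:R * qp (- (wt Lambda (enum_val b) j * y)).
    by rewrite mxE.
  rewrite [LHS]mxE (bigD1 c) //= big1 ?addr0 => [|k kc].
    by rewrite eE eqxx mul1r mulrC.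
  by rewrite eE (inj_eq enum_val_inj) eq_sym (negbTE kc) mul0r mulr0.
have hlwt : lwt (mpart m) (j :: pre ++ suf) = 0.
  have e : perm_eq (j :: pre ++ suf) (enum 'I_n).
    by rewrite (enum_split j) -cat1s perm_catCA.
  rewrite /lwt (perm_big _ e) /= big_enum /= sumrB hLambda -mulr_sumr -natr_sum.
  by rewrite mpart_sum subrr.
have eT (a : C) (W B1 B2 : 'M[C]_N) : B1 *m (a *: W) *m B2 = a *: (B1 *m W *m B2).
  by rewrite -scalemxAr -scalemxAl.
have uL k : (A1 lr *m (qp ((lr - 1 - 2 * k%:R) * y) *: Wmx (enum 'I_n) lr (bas R k) k) *m invmx Q1) r c =
    qp ((lr - 1 - 2 * k%:R) * y) * phi_fold (j :: pre ++ suf) (mpart m) (mpart m') lr (bas R k) k.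
  by rewrite eT eL !mxE.
have uR k : (invmx (A2 lam) *m (qp ((lam - 1 - 2 * k%:R) * y) *: Wmx (enum 'I_n) lam (bas R k) k) *m Q2) r c =
    qp ((lam - 1 - 2 * k%:R) * y) * phi_fold (rcons (pre ++ suf) j) (mpart m) (mpart m') lam (bas R k) k.
  by rewrite eT eR !mxE catA cats1.
apply: (@has_sum_cyclic _ _ _ _ _ _ (mpart m' j) (mpart m j) _ _ _ (hL r c) (hR r c)).
- move=> k k1 e; rewrite uL uR (cyclic_term heta lam hlwt e) mulrA -qpD; congr (qp _ * _).
  have -> : k%:R = k1%:R + (mpart m j)%:R - (mpart m' j)%:R :> C.
    by rewrite -natrD -e natrD addrK.
  rewrite /lr /wt; ring.
- by move=> k h; rewrite uL (cyclic_zero_left heta) ?mulr0.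
- by move=> k h; rewrite uR (cyclic_zero_right heta) ?mulr0.
Qed.

Variable F : C -> C -> Z -> Z -> C.
Hypothesis hF : is_trace_matrix eta Lambda F.

(** One radius of convergence for the finitely many matrix entries. *)
Lemma trace_sum l : exists r : R, forall y, r%:C < `|qp (2 * y)| ->
  exists T : 'M[C]_N, (forall a b, has_sum (fun k => (qp ((l - 1 - 2 * k%:R) * y) *:
      Wmx (enum 'I_n) l (bas R k) k) a b) (T a b)) /\
    trace_op F l y = trace_prefactor eta M y *: T.
Proof.
have /choice [rr hrr] (p : Z * Z) := (hF l p.1 p.2).2.
exists (\sum_p `|rr p|) => y hy.
have /choice [TT hTT] (p : Z * Z) : exists T, has_sum (trace_term eta Lambda p.1 p.2 l y) T /\
    F l y p.1 p.2 = trace_prefactor eta M y * T.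
  have [|T h1 h2] := hrr p y; last by exists T.
  apply: le_lt_trans hy; rewrite lecR; apply: le_trans (ler_norm _) _.
  by rewrite (bigD1 p) //= lerDl sumr_ge0.
exists (\matrix_(a, b) TT (enum_val a, enum_val b)); split=> [a b|].
  have [h _] := hTT (enum_val a, enum_val b); rewrite mxE.
  have -> : (fun k => (qp ((l - 1 - 2 * k%:R) * y) *: Wmx (enum 'I_n) l (bas R k) k) a b) =
    trace_term eta Lambda (enum_val a) (enum_val b) l y; last exact: h.
  by apply/funext => k; rewrite !mxE /trace_term PhiV_fold mulrC.
by apply/matrixP => a b; rewrite !mxE; have [_ ->] := hTT (enum_val a, enum_val b).
Qed.

(** Collects the rows given by [cyclic_entry]. The finitely many shifts of
    lambda that occur have a common radius of convergence. *)
Lemma qKZB_far lam v : right_good lam -> (forall m : Z, left_good (lam - wt Lambda m j)) ->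
  exists r : R, forall y, r%:C < `|qp (2 * y)| ->
    qKZB Lambda RR j (fun l => trace_op F l y *m v) lam =
    trace_op F lam y *m (qKZ eta M Lambda j y *m v).
Proof.
move=> hr hl; have [r0 h0] := trace_sum lam.
have /choice [rr hrr] (m : Z) := trace_sum (lam - wt Lambda m j).
exists (`|r0| + \sum_m `|rr m|) => y hy.
have s0 : 0 <= \sum_m `|rr m| by rewrite sumr_ge0.
have [|T [hT eT]] := h0 y.
  by apply: le_lt_trans hy; rewrite lecR; apply: le_trans (ler_norm _) _; rewrite lerDl.
have A2u := A2_unit hr.
rewrite /qKZB big_after -/(A2 lam).
have -> : qKZ eta M Lambda j y = Q2 *m Emx y *m Q1 by rewrite /qKZ big_after big_before.
rewrite eT; apply: (can_inj (mulKmx (_ : invmx (A2 lam) \in unitmx))); first by rewrite unitmx_inv.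
rewrite mulKmx//; apply/colP => i; rewrite [LHS]mxE big_before -/(A1 _).
have [|T' [hT' eT']] := hrr (enum_val i) y.
  apply: le_lt_trans hy; rewrite lecR; apply: le_trans (ler_norm _) _.
  rewrite (bigD1 (enum_val i)) //= addrCA lerDl addr_ge0// sumr_ge0//.
have := cyclic_entry hr (hl (enum_val i)) hT hT'.
move/(congr1 (fun X => (X *m v) 0 0)); rewrite -!row_mul ![row _ _ _ _]mxE => E.
rewrite eT' -!scalemxAl -!scalemxAr [LHS]mxE [RHS]mxE; congr (_ * _).
by move: E; rewrite -!mulmxA => E; exact: E.
Qed.

(** Entrywise continuation of [qKZB_far] from the domain of convergence to the
    regular point [x]. *)
Lemma qKZB_qKZ x v : trace_regular F x -> generically (fun lam =>
    qKZB Lambda RR j (fun l => trace_op F l x *m v) lam =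
    trace_op F lam x *m (qKZ eta M Lambda j x *m v)).
Proof.
move=> hx.
have g := generically_and right_good_generic
  (generically_forall (fun m : Z => generically_shift (wt Lambda m j) left_good_generic)).
apply: generically_imp g => lam [hr hl]; have [r h] := qKZB_far v hr hl.
have tF l : tame_mx x (fun y => trace_op F l y).
  move=> a b; apply: (tame_ext (f := fun y => F l y (enum_val a) (enum_val b))).
    by move=> y; rewrite mxE.
  split; first exact: (hF l _ _).1.
  by apply/cont_atR => e e0; apply: analytic_continuous (hx l _ _) _ e0.
have tFv (B : 'M[C]_N) l : tame_mx x (fun y => B *m (trace_op F l y *m v)).
  apply: tame_mx_mul; first exact: tame_mx_const.
  by apply: tame_mx_mul; [exact: tF|exact: tame_mx_const].
have tE : tame_mx x Emx.
  move=> a b; apply: (tame_ext (f := fun y => (enum_val b == enum_val a)%:R * qp (0 + (- wt Lambda (enum_val b) j) * y))).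
    by move=> y; rewrite mxE add0r mulNr.
  by apply: tame_mul; [exact: tame_const|exact: tame_qp].
have tK : tame_mx x (qKZ eta M Lambda j).
  apply: tame_mx_mul (tame_mx_const _ _); exact: tame_mx_mul (tame_mx_const _ _) tE.
apply/colP => i.
apply: (tame_identity heta (f := fun y => (qKZB Lambda RR j (fun l => trace_op F l y *m v) lam) i 0)
   (g := fun y => (trace_op F lam y *m (qKZ eta M Lambda j y *m v)) i 0)).
- rewrite /qKZB; move: i (0 : 'I_1); apply: tame_mx_mul; first exact: tame_mx_const.
  move=> i b.
  apply: (tame_ext (f := fun y => (\big[mulmx/1%:M]_(k < n | (k < j)%N)
      dyn j k (fun i => (k < i < j) || (j < i))%N (lam - wt Lambda (enum_val i) j) *m
      (trace_op F (lam - wt Lambda (enum_val i) j) y *m v)) i 0)).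
    by move=> y; rewrite [RHS]mxE.
  exact: (tFv _ _ i 0).
- exact: (tame_mx_mul (tF lam) (tame_mx_mul tK (tame_mx_const x v)) i 0).
- by exists r => y /h ->.
Qed.
End Equation.

Theorem theorem6p1 (R : realType) (eta : R[i]) (heta : 0 < complex.Im eta)
    (n M : nat) (hn : (0 < n)%N)
    (Lambda : 'I_n -> R[i]) (hLambda : \sum_i Lambda i = 2 * M%:R)
    (RR : R[i] -> R[i] -> R[i] -> nat -> nat -> nat -> nat -> R[i])
    (hRR : is_dynR eta RR)
    (F : R[i] -> R[i] -> mindex n M -> mindex n M -> R[i])
    (hF : is_trace_matrix eta Lambda F)
    (x : R[i]) (hx : trace_regular F x)
    (j : 'I_n) (v : 'cV[R[i]]_#|mindex n M|) :
  generically (fun lambda : R[i] =>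
    qKZB Lambda RR j (fun l => trace_op F l x *m v) lambda =
    trace_op F lambda x *m (qKZ eta M Lambda j x *m v)).
Proof. exact: (qKZB_qKZ heta hLambda hRR j hF v hx). Qed.
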